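(* Let $0\le a\le 1/2$ and $b>0$, and let $T$ be the triangle with vertices $(0,0)$, $(1,0)$, $(a,b)$. If $b^2\le a^2+(1-a)^2$, then $$\mu_2(T)\le \frac{\pi^2}{b^2}.$$ In particular, this inequality holds for any such triangle $T$ whose side on the $x$-axis is its longest or middle side and whose angle at the vertex $(1,0)$ is at most $\pi/4$.
   Context: $\mu_2(T)$ denotes the second (i.e. smallest positive) eigenvalue of the Neumann problem $\Delta\varphi=-\mu\varphi$ on $T$, $\partial\varphi/\partial n=0$ on $\partial T$. *)

(* Defs.v *)
From HB Require Import structures.
From mathcomp Require Import all_boot all_order all_algebra.
From mathcomp Require Import all_classical all_reals all_analysis.
Set Implicit Arguments.
Unset Strict Implicit.
Unset Printing Implicit Defensive.
Import Order.TTheory GRing.Theory Num.Theory.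
Import numFieldNormedType.Exports.
Local Open Scope classical_set_scope.
Local Open Scope ring_scope.

Section PlaneGeometry.
Context {R : realType}.
Implicit Types A B C P Q : R * R.

(* The library norm on R * R is the sup norm, hence an explicit Euclidean
   distance. *)
Definition eucl_dist P Q : R :=
  Num.sqrt ((P.1 - Q.1) ^+ 2 + (P.2 - Q.2) ^+ 2).

Definition dotp P Q : R := P.1 * Q.1 + P.2 * Q.2.

(* Angle at the vertex P between the half-lines PA and PB. *)
Definition angle A P B : R :=
  acos (dotp (A - P) (B - P) / (eucl_dist A P * eucl_dist B P)).

(* The interior of the triangle ABC, in barycentric coordinates. *)
Definition triangle A B C : set (R * R) :=
  [set P | exists s t u : R,
    [/\ 0 < s, 0 < t, 0 < u, s + t + u = 1 & P = s *: A + t *: B + u *: C]].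

(* l is the longest side of a triangle with sides l, m, n; ties allowed. *)
Definition longest_side (l m n : R) : Prop := m <= l /\ n <= l.

Definition middle_side (l m n : R) : Prop :=
  m <= l <= n \/ n <= l <= m.

End PlaneGeometry.

Section Neumann.
Context {R : realType}.
Implicit Types (Om : set (R * R)) (u v g h phi : R * R -> R) (mu : R).

Definition area := (@lebesgue_measure R \x @lebesgue_measure R)%E.

Definition e1 : R * R := (1, 0).
Definition e2 : R * R := (0, 1).

Definition square_integrable Om u : Prop :=
  measurable_fun Om u /\ area.-integrable Om (fun p => (u p ^+ 2)%:E).

(* Test functions of class C^1 with compact support in Om. They define the same
   first-order weak derivatives as smooth ones (Gilbarg-Trudinger, 7.3). *)
Definition test_function Om phi : Prop :=
  [/\ forall p, differentiable phi p,
      continuous ('D_e1 phi), continuous ('D_e2 phi),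
      compact (closure [set p | phi p != 0]) &
      closure [set p | phi p != 0] `<=` Om].

Definition weak_derivative Om (e : R * R) u g : Prop :=
  forall phi, test_function Om phi ->
    \int[area]_(p in Om) (u p * 'D_e phi p) =
    - \int[area]_(p in Om) (g p * phi p).

(* u belongs to the Sobolev space H^1(Om), with weak gradient (gx, gy). *)
Definition H1 Om u gx gy : Prop :=
  [/\ square_integrable Om u, square_integrable Om gx,
      square_integrable Om gy,
      weak_derivative Om e1 u gx & weak_derivative Om e2 u gy].

(* u is a weak solution of Delta u = - mu u in Om, du/dn = 0 on the boundary:
   testing against every v in H^1(Om), without condition on the boundary
   values of v, encodes both the equation and the Neumann condition, by Green's
   formula. *)
Definition neumann_solution Om mu u : Prop :=
  exists gx gy, H1 Om u gx gy /\
    forall v hx hy, H1 Om v hx hy ->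
      \int[area]_(p in Om) (gx p * hx p + gy p * hy p) =
      mu * \int[area]_(p in Om) (u p * v p).

Definition neumann_eigenvalue Om mu : Prop :=
  exists u, neumann_solution Om mu u /\
    ~ {ae area, forall p, Om p -> u p = 0}.

(* The second eigenvalue of a connected domain, 0 being the first one. *)
Definition is_mu2 Om mu : Prop :=
  [/\ 0 < mu, neumann_eigenvalue Om mu &
      forall nu, 0 < nu -> neumann_eigenvalue Om nu -> mu <= nu].

End Neumann.

(* Main.v *)
(* Write l_O, l_E, l_V for the barycentric coordinates on T. The trial function
   is x cos(pi l_O) + y cos(pi l_E) + z cos(pi l_V) with x + y + z = 0, hence of
   mean zero. Its mass and energy are quadratic forms in (x, y, z): by the affine
   symmetries of T, the three cosines have the same mass and are orthogonal, and
   sin(pi l_i), sin(pi l_j) have for i != j the same correlation, 8/pi^2 times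
   their common mass. Taking y = 1 and the best x, the Rayleigh quotient is at
   most pi^2/b^2 when b^2 <= a^2 + (1-a)^2. If the angle at E is at most pi/4,
   then b <= 1 - a, and the condition holds.

   That mu_2 exists and is at most this quotient is the direct method, which
   needs the compactness of H^1(T) in L^2(T). For it, two copies of T are glued
   into the unit square by the reflection r : (s, t) |-> (1 - t, 1 - s), and u is
   extended by u o r. Instead of showing that the extension is in H^1, one tests
   u on T against the vector field (A, - A o r), A = sin(m pi s) cos(n pi t), in
   the coordinates (s, t): it is tangent to the sides, so no boundary term
   appears, and this bounds the cosine coefficients of the extension by those of
   its gradient. Parseval's and Bessel's inequalities then give
   |u|^2 <= (finitely many squared coefficients) + eps |grad u|^2, which yields
   both Poincare's inequality and compactness. *)

(* The trial function is modelled on a = 0, b = 1: there x = 0, and cos (pi l_E) - cos (pi l_V) is a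
   Neumann eigenfunction of the right isosceles triangle with eigenvalue pi^2, so the estimate has
   no slack in that case. Moving a away from 0 is paid for by a coefficient x <= 0 of order a. Of pi
   only 1 <= 16/pi^2 <= 2 enters; the upper bound is itself the positivity of the Gram matrix of the
   sines.

   The analytic obstacle is the boundary: weak derivatives are tested with compactly supported
   functions only. The field (A, - A o r) has zero normal component: A = 0 on s = 0, A o r = 0 on t
   = 0 because sin (m pi) = 0, and on s + t = 1, which r fixes pointwise, the field is a multiple of
   (1, -1). Its divergence is m pi (B + B o r) with B = cos (m pi s) cos (n pi t), so pairing it
   with u yields m pi times a cosine coefficient of the extension. This controls large m; large n
   follows because the extension is invariant under r, which exchanges the two frequencies up to
   sign. *)
Require Import Defs.
From HB Require Import structures.
From mathcomp Require Import all_boot all_order all_algebra.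
From mathcomp Require Import all_classical all_reals all_analysis.
From mathcomp Require Import measurable_realfun ring lra.
Set Implicit Arguments.
Unset Strict Implicit.
Unset Printing Implicit Defensive.
Import Order.TTheory GRing.Theory Num.Theory.
Import numFieldNormedType.Exports.
Local Open Scope classical_set_scope.
Local Open Scope ring_scope.

(** * Comparison with geometric sequences, and nonnegative quadratic polynomials *)

Section RealLimits.
Context {R : realType}.

(** All limits of the direct method come with geometric rates; this turns such a rate into the
    limiting inequality. *)
Lemma ler0_geometric (x c : R) : 0 <= c ->
  (forall k : nat, x <= 2^-1 ^+ k * c) -> x <= 0.
Proof.
move=> c0 xk; have cvg : (fun k : nat => 2^-1 ^+ k * c) @ \oo --> (0 : R).
  rewrite -[X in _ --> X](mul0r c); apply: cvgMr_tmp.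
  by apply: cvg_expr; rewrite ger0_norm// invf_lt1// ltr1n.
rewrite -(cvg_lim (@Rhausdorff R) cvg); apply: limr_ge; first by apply/cvg_ex; exists 0.
exact: nearW.
Qed.

Lemma eqr0_geometric (x c : R) : 0 <= c ->
  (forall k : nat, `|x| <= 2^-1 ^+ k * c) -> x = 0.
Proof.
by move=> c0 xk; apply/eqP; rewrite -normr_le0; exact: ler0_geometric xk.
Qed.

(** The case c = 0 matters because the forms may be degenerate. It serves twice: for the
    Cauchy-Schwarz inequality, and with a = 0 for the Euler-Lagrange equation of a minimizer. *)
Lemma discriminant_le (a b c : R) : 0 <= c ->
  (forall t, 0 <= a + 2 * (t * b) + t ^+ 2 * c) -> b ^+ 2 <= a * c.
Proof.
move=> c0 H; have [c_eq0|c_neq0] := eqVneq c 0.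
  have [->|b0] := eqVneq b 0; first by rewrite expr0n c_eq0 mulr0.
  have := H (- (a + 1) / (2 * b)); rewrite c_eq0 mulr0 addr0.
  have -> : a + 2 * (- (a + 1) / (2 * b) * b) = - 1 by field.
  by rewrite lerNr oppr0 ler10.
have c_gt0 : 0 < c by rewrite lt_neqAle eq_sym c_neq0.
have := H (- b / c); rewrite (_ : _ + _ = a - b ^+ 2 / c); last by field.
by rewrite subr_ge0 ler_pdivrMr.
Qed.

End RealLimits.

(** * The direct method in semi-inner product spaces *)

Section SemiInnerProduct.
Context {R : realType} {V : lmodType R}.

(** Definiteness is not asked for: functions equal almost everywhere are not identified, and the
    energy vanishes on constants. *)
Definition semi_inner_product (n : V -> V -> R) :=
  [/\ forall c x y z, n (c *: x + y) z = c * n x z + n y z,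
      forall x y, n x y = n y x & forall x, 0 <= n x x].

Variables (n : V -> V -> R) (nP : semi_inner_product n).

Lemma sipC x y : n x y = n y x. Proof. by case: nP. Qed.

Lemma sip_ge0 x : 0 <= n x x. Proof. by case: nP. Qed.

Lemma sipDl x y z : n (x + y) z = n x z + n y z.
Proof. by case: nP => h _ _; rewrite -[x]scale1r h mul1r scale1r. Qed.

Lemma sip0l z : n 0 z = 0.
Proof. by apply: (@addrI _ (n 0 z)); rewrite -sipDl !addr0. Qed.

Lemma sipZl c x z : n (c *: x) z = c * n x z.
Proof. by case: nP => h _ _; rewrite -[c *: x]addr0 h sip0l addr0. Qed.

Lemma sipNl x z : n (- x) z = - n x z.
Proof. by rewrite -scaleN1r sipZl mulN1r. Qed.

Lemma sipBl x y z : n (x - y) z = n x z - n y z.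
Proof. by rewrite sipDl sipNl. Qed.

Lemma sipDr x y z : n z (x + y) = n z x + n z y.
Proof. by rewrite ![n z _]sipC sipDl. Qed.

Lemma sipZr c x z : n z (c *: x) = c * n z x.
Proof. by rewrite ![n z _]sipC sipZl. Qed.

Lemma sipBr x y z : n z (x - y) = n z x - n z y.
Proof. by rewrite ![n z _]sipC sipBl. Qed.

Lemma sip_suml (I : Type) (r : seq I) (P : pred I) (F : I -> V) z :
  n (\sum_(i <- r | P i) F i) z = \sum_(i <- r | P i) n (F i) z.
Proof.
by apply: (big_morph (n ^~ z)) => [x y|]; [exact: sipDl|exact: sip0l].
Qed.

Lemma sqr_sipD x y : n (x + y) (x + y) = n x x + 2 * n x y + n y y.
Proof. by rewrite !(sipDl, sipDr) (sipC y x); ring. Qed.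

Lemma sqr_sipB x y : n (x - y) (x - y) = n x x - 2 * n x y + n y y.
Proof. by rewrite !(sipBl, sipBr) (sipC y x); ring. Qed.

Lemma sip_cauchy_schwarz x y : n x y ^+ 2 <= n x x * n y y.
Proof.
apply: discriminant_le; first exact: sip_ge0.
move=> t; have := sip_ge0 (x + t *: y).
by rewrite sqr_sipD !(sipZl, sipZr) expr2 !mulrA.
Qed.

Lemma sqr_sipB_le x y : n (x - y) (x - y) <= 2 * (n x x + n y y).
Proof.
by have := sip_ge0 (x + y); rewrite sqr_sipB sqr_sipD => ?; lra.
Qed.

Lemma sqr_sipD_le x y : n (x + y) (x + y) <= 2 * (n x x + n y y).
Proof.
by have := sip_ge0 (x - y); rewrite sqr_sipB sqr_sipD => ?; lra.
Qed.

(** Put t = 2^-k and d = x - y. Positivity at t y + d and t y - d gives 2 t |n y d| <= t^2 M + t^2,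
    so the cross term is at most t (M + 1); the remaining term n d d is at most t^2 <= t. *)
Lemma sqr_sip_dist (M : R) (k : nat) x y :
  n (x - y) (x - y) <= 4^-1 ^+ k -> n y y <= M ->
  `|n x x - n y y| <= 2^-1 ^+ k * (M + 2).
Proof.
move=> xyk yM; set d := x - y; have -> : x = y + d by rewrite /d addrC subrK.
rewrite sqr_sipD; set t : R := 2^-1 ^+ k.
have t0 : 0 < t by rewrite exprn_gt0.
have tE : 4^-1 ^+ k = t ^+ 2 by rewrite /t exprAC; congr (_ ^+ _); field.
have t1 : t <= 1 by rewrite exprn_ile1// invf_le1// ler1n.
have d0 := sip_ge0 d; have cs := sip_cauchy_schwarz y d; have y0 := sip_ge0 y.
have yd1 := sip_ge0 (t *: y + d); have yd2 := sip_ge0 (t *: y - d).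
rewrite sqr_sipD !(sipZl, sipZr) in yd1.
rewrite sqr_sipB !(sipZl, sipZr) in yd2.
rewrite tE -/d in xyk.
have td1 : `|2 * n y d| <= t * (M + 1).
  rewrite -(ler_pM2l t0) -[t in X in X <= _]gtr0_norm// -normrM ler_norml.
  by apply/andP; split; nra.
rewrite (_ : _ - _ = 2 * n y d + n d d); last by ring.
rewrite (le_trans (ler_normD _ _))// (_ : M + 2 = M + 1 + 1); last by ring.
rewrite mulrDr mulr1 lerD// ger0_norm// (le_trans xyk)//.
by rewrite expr2 ler_piMr// ltW.
Qed.

Section Orthogonal.
Variables (e : nat -> V) (w : nat -> R).
Hypothesis w_gt0 : forall k, 0 < w k.
Hypothesis e_orth : forall i j, i != j -> n (e i) (e j) = 0.

Let proj x K := \sum_(k < K) (n x (e k) / w k) *: e k.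

Let sip_proj x z K : n (proj x K) z = \sum_(k < K) n x (e k) * n z (e k) / w k.
Proof.
rewrite sip_suml; apply: eq_bigr => k _.
by rewrite sipZl (sipC (e k)) mulrAC.
Qed.

(** An upper bound on the norms, with positive weights, is the right hypothesis for the family sin
    (m pi s) cos (n pi t), which contains zero vectors (m = 0). *)
Lemma bessel x K : (forall k, n (e k) (e k) <= w k) ->
  \sum_(k < K) n x (e k) ^+ 2 / w k <= n x x.
Proof.
move=> ew; have := sip_ge0 (x - proj x K).
rewrite sqr_sipB [n x (proj _ _)]sipC !sip_proj.
have sq_le : \sum_(k < K) n x (e k) * n (proj x K) (e k) / w k <=
    \sum_(k < K) n x (e k) ^+ 2 / w k.
  apply: ler_sum => i _; rewrite sip_proj (bigD1 i)//= big1 ?addr0; last first.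
    by move=> j ji; rewrite e_orth ?mulr0 ?mul0r// eq_sym.
  rewrite expr2 !mulrA ler_pM2r ?invr_gt0//.
  rewrite [leLHS](_ : _ = n x (e i) ^+ 2 * (n (e i) (e i) / w i)); last by ring.
  by rewrite -expr2 ler_piMr ?sqr_ge0// ler_pdivrMr// mul1r.
set A := \sum_(k < K) n x (e k) ^+ 2 / w k in sq_le *.
by move=> h; lra.
Qed.

Hypothesis e_norm : forall k, n (e k) (e k) = w k.

Let coef x K := \sum_(k < K) n x (e k) ^+ 2 / w k.

Let proj_coef x K k : (k < K)%N -> n (proj x K) (e k) = n x (e k).
Proof.
move=> kK; rewrite sip_proj (bigD1 (Ordinal kK))//= e_norm big1 ?addr0.
  by rewrite mulfK ?gt_eqF.
by move=> j jk; rewrite e_orth ?mulr0 ?mul0r// eq_sym; apply: contraNneq jk =>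
  kj; apply/eqP/val_inj.
Qed.

Let sqr_proj x K L : (K <= L)%N -> n (proj x L) (proj x K) = coef x K.
Proof.
move=> KL; rewrite sipC sip_proj; apply: eq_bigr => k _.
by rewrite proj_coef ?expr2// (leq_trans (ltn_ord k)).
Qed.

Let sqr_projB x K L : (K <= L)%N ->
  n (proj x L - proj x K) (proj x L - proj x K) = coef x L - coef x K.
Proof. by move=> KL; rewrite sqr_sipB !sqr_proj//; ring. Qed.

Let sqr_distp x K : n (x - proj x K) (x - proj x K) = n x x - coef x K.
Proof.
rewrite sqr_sipB sqr_proj// (sipC x (proj _ _)) sip_proj.
have -> : \sum_(k < K) n x (e k) * n x (e k) / w k = coef x K.
  by apply: eq_bigr => i _; rewrite expr2.
by ring.
Qed.

Hypothesis complete : forall x_ : nat -> V,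
  (forall k j, (k <= j)%N -> n (x_ j - x_ k) (x_ j - x_ k) <= 4^-1 ^+ k) ->
  exists x, forall k, n (x - x_ k) (x - x_ k) <= 4^-1 ^+ k.
Hypothesis total : forall x, (forall k, n x (e k) = 0) -> n x x = 0.

(** The projections of x have a limit y by completeness, and x - y is orthogonal to every [e k],
    hence of norm 0 by totality. So some projection is close to x, and the defect n x x - [coef] x K
    is exactly its squared distance to x. *)
Lemma parseval x (eps : R) : 0 < eps ->
  exists K, n x x <= \sum_(k < K) n x (e k) ^+ 2 / w k + eps.
Proof.
move=> eps0.
have coef_nd : {homo coef x : K L / (K <= L)%N >-> K <= L}.
  by move=> K L KL; rewrite -subr_ge0 -sqr_projB// sip_ge0.
have coef_cvg : cvgn (coef x).
  apply: nondecreasing_is_cvgn => //; exists (n x x) => _ [K _ <-].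
  by apply: bessel => k; rewrite e_norm.
have coef_lim K : coef x K <= limn (coef x) by exact: nondecreasing_cvgn_le.
(* Completeness is stated for sequences with rate 4^-k, so a fast subsequence of projections is
   taken. It need not be monotone, hence the two cases in [dist]. *)
have /choice[K KP] : forall j, exists K, (j < K)%N /\
    limn (coef x) - coef x K <= 4^-1 ^+ j.
  move=> j; have j0 : 0 < 4^-1 ^+ j :> R by rewrite exprn_gt0.
  have /cvgrPdist_le /(_ _ j0) [M _ MP] := coef_cvg.
  exists (maxn M j.+1); split; first by rewrite leq_max leqnn orbT.
  by have := MP _ (leq_maxl M j.+1); apply: le_trans; rewrite ler_norm.
have dist j k : (k <= j)%N ->
    n (proj x (K j) - proj x (K k)) (proj x (K j) - proj x (K k)) <= 4^-1 ^+ k.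
  move=> kj; have [KK|/ltnW KK] := leqP (K k) (K j).
    rewrite sqr_projB//; have := (KP k).2; have := coef_lim (K j); lra.
  rewrite -opprB sipNl sipC sipNl opprK sqr_projB//.
  have le4 : 4^-1 ^+ j <= 4^-1 ^+ k :> R.
    by rewrite ler_wiXn2l// invf_le1// ler1n.
  have := (KP j).2; have := coef_lim (K k); lra.
have [y yP] := complete (fun k j kj => dist j k kj).
have xy0 : n (x - y) (x - y) = 0.
  apply: total => k; apply/eqP; rewrite -sqrf_eq0; apply/eqP.
  apply: (@eqr0_geometric _ _ (w k)); first exact: ltW.
  (* The index k + i makes the projection keep the k-th coefficient, while its distance to y still
     tends to 0 with i. *)
  move=> i; have ki : (k < K (k + i)%N)%N.
    by rewrite (leq_trans _ (KP _).1)// ltnS leq_addr.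
  rewrite ger0_norm ?sqr_ge0//.
  have -> : n (x - y) (e k) = - n (y - proj x (K (k + i)%N)) (e k).
    by rewrite !sipBl proj_coef//; ring.
  rewrite sqrrN (le_trans (sip_cauchy_schwarz _ _))// e_norm ler_pM2r//.
  rewrite (le_trans (yP _))// exprD (@le_trans _ _ (4^-1 ^+ i))//.
    by rewrite ler_piMl ?exprn_ge0// exprn_ile1// invf_le1// ler1n.
  by rewrite lerXn2r ?nnegrE ?invr_ge0// lef_pV2 ?posrE// ler_nat.
have [j jP] : exists j : nat, 2 * 4^-1 ^+ j <= eps.
  apply: contrapT => /forallNP h.
  suff : eps <= 0 by rewrite leNgt eps0.
  apply: (@ler0_geometric _ _ 2) => // k.
  have /negP := h k; rewrite -ltNge => /ltW /le_trans; apply.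
  rewrite mulrC ler_pM2r// lerXn2r ?nnegrE ?invr_ge0//.
  by rewrite lef_pV2 ?posrE// ler_nat.
exists (K j); have := sqr_sipD_le (x - y) (y - proj x (K j)).
rewrite addrA subrK sqr_distp xy0 add0r => h.
by have := yP j; rewrite -/(coef _ _); lra.
Qed.

End Orthogonal.
End SemiInnerProduct.

(** The image of [U] under [f] is an ultrafilter containing the compact interval [-M, M], so it
    converges there. *)
Lemma ultra_cauchy {R : realType} (U : set_system nat) (UU : UltraFilter U)
    (M eta : R) (f : nat -> R) : 0 < eta -> (forall k, `|f k| <= M) ->
  exists2 B, U B & forall i j, B i -> B j -> `|f i - f j| <= eta.
Proof.
move=> eta0 fM.
have cM : compact (`[- M, M] : set R) by exact: segment_compact.
have FF : UltraFilter (fmap f U).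
  split=> [|G GF fUG]; first exact: fmap_proper_filter.
  apply/seteqP; split => // A GA; have [//|UnA] := in_ultra_setVsetC (f @^-1` A) UU.
  have /(filterI GA) : G (~` A) by apply: fUG.
  by rewrite setICr => /filter_not_empty.
rewrite compact_ultra in cM.
have [|l [_ lP]] := cM (fmap f U) FF.
  have fI k : (f @^-1` `[- M, M]%classic) k by rewrite /= in_itv/= -ler_norml.
  by rewrite /fmap /nbhs/=; exact: filterE fI.
have e2 : 0 < eta / 2 by rewrite divr_gt0.
have /cvgrPdist_le /(_ _ e2) UB := lP.
exists (fun k => `|l - f k| <= eta / 2) => // i j Bi Bj.
rewrite -(subrKA l) (le_trans (ler_normD _ _))// (splitr eta) lerD//.
by rewrite distrC.
Qed.

Section DirectMethod.
Context {R : realType} {V : lmodType R}.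
Variables (n q : V -> V -> R) (one w : V) (Lambda : R).
Hypotheses (nP : semi_inner_product n) (qP : semi_inner_product q).
Hypothesis one_gt0 : 0 < n one one.
Hypothesis q_one : forall v, q one v = 0.
(** The shift to [k.+1] leaves room for H^1, where three components converge, each with error
    4^-(k+1). *)
Hypothesis complete : forall x_ : nat -> V,
  (forall k j, (k <= j)%N -> n (x_ j - x_ k) (x_ j - x_ k) +
     q (x_ j - x_ k) (x_ j - x_ k) <= 4^-1 ^+ k) ->
  exists x, forall k,
    n (x - x_ k.+1) (x - x_ k.+1) + q (x - x_ k.+1) (x - x_ k.+1) <= 4^-1 ^+ k.
(** A quantitative form of Rellich's theorem: up to a small multiple of the energy, finitely many
    bounded functionals control the mass. *)
Hypothesis compact_embedding : forall eps, 0 < eps ->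
  exists (K : nat) (l : nat -> V -> R) (C : R),
    [/\ forall i x y, l i (x - y) = l i x - l i y,
        forall i x, l i x ^+ 2 <= C * n x x &
        forall x, n x x <= \sum_(i < K) l i x ^+ 2 + eps * q x x].
Variable P : R.
Hypothesis P_gt0 : 0 < P.
Hypothesis poincare : forall x, n x one = 0 -> n x x <= P * q x x.
Hypotheses (w_one : n w one = 0) (w_gt0 : 0 < n w w).
Hypothesis qw : q w w <= Lambda * n w w.

Let A := [set q x x | x in [set x | n x one = 0 /\ n x x = 1]].
Let mu := inf A.

Let normalized x : n x one = 0 -> 0 < n x x -> A (q x x / n x x).
Proof.
move=> x1 x0; exists ((Num.sqrt (n x x))^-1 *: x).
  split; first by rewrite (sipZl nP) x1 mulr0.
  rewrite (sipZl nP) (sipZr nP) mulrA -expr2 exprVn sqr_sqrtr ?ltW//.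
  by rewrite mulVf ?gt_eqF.
rewrite (sipZl qP) (sipZr qP) mulrA -expr2 exprVn sqr_sqrtr ?ltW//.
by rewrite mulrC.
Qed.

Let A_inf : has_inf A.
Proof.
split; first by eexists; exact: normalized w_one w_gt0.
by exists 0 => _ [x _ <-]; exact: sip_ge0.
Qed.

Let mu_le x : n x one = 0 -> mu * n x x <= q x x.
Proof.
move=> x1; have := sip_ge0 nP x; rewrite le_eqVlt => /predU1P[<-|x0].
  by rewrite mulr0 sip_ge0.
rewrite -ler_pdivlMr//; apply: ge_inf; first by case: A_inf.
exact: normalized.
Qed.

Let mu_gt0 : 0 < mu.
Proof.
rewrite (@lt_le_trans _ _ P^-1) ?invr_gt0//; apply: lb_le_inf.
  by case: A_inf.
move=> _ [x [x1 xx] <-]; have := poincare x1.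
by rewrite xx mulrC -ler_pdivrMr// div1r.
Qed.

Let minimizing k : exists x,
  [/\ n x one = 0, n x x = 1 & mu <= q x x <= mu + 2^-1 ^+ k].
Proof.
have k0 : 0 < 2^-1 ^+ k :> R by rewrite exprn_gt0.
have [_ [x [x1 xx] <-] qx] := inf_adherent k0 A_inf.
exists x; split => //; rewrite (ltW qx) andbT.
by rewrite -[mu]mulr1 -xx mu_le.
Qed.

(* An ultrafilter replaces the extraction of a subsequence: each of the finitely
   many functionals of compact_embedding converges along it. *)
Let minimizer : exists u, [/\ n u one = 0, n u u = 1 & q u u = mu].
Proof.
have [x_ x_P] := choice minimizing.
have [U [UU oo_U]] := ultraFilterLemma (@eventually_filter).
have q_le k : q (x_ k) (x_ k) <= mu + 1.
  have [_ _ /andP[_ h]] := x_P k; rewrite (le_trans h)// lerD2l.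
  by rewrite exprn_ile1// invf_le1// ler1n.
have cauchy_n (d : R) : 0 < d -> exists2 B, U B & forall i j, B i -> B j ->
    n (x_ i - x_ j) (x_ i - x_ j) <= d.
  (* Each summand of [compact_embedding] gets d / 2: the energy of x_i - x_j is at most 4 (mu + 1),
     and the K squared differences are at most [eta] each, since [eta] <= 1. *)
  move=> d0; pose eps := d / (8 * (mu + 1)).
  have eps0 : 0 < eps by rewrite divr_gt0// mulr_gt0// addr_gt0.
  have [K [l [C [lB lC lK]]]] := compact_embedding eps0.
  pose eta : R := Num.min 1 (d / (2 * (K%:R + 1))).
  have K1 : 0 < K%:R + 1 :> R by rewrite ltr_pwDr.
  have eta0 : 0 < eta by rewrite lt_min ltr01 divr_gt0// mulr_gt0.
  have C0 : 0 <= C.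
    by rewrite -[C]mulr1 -(let: And3 _ h _ := x_P 0%N in h) (le_trans _ (lC 0%N _))// sqr_ge0.
  have lx i k : `|l i (x_ k)| <= C + 1.
    rewrite -(ler_pXn2r (ltn0Sn 1)) ?nnegrE ?normr_ge0 ?addr_ge0//.
    rewrite real_normK ?num_real// (le_trans (lC _ _))//.
    have [_ -> _] := x_P k; nra.
  have [B UB BP] : exists2 B, U B & forall i j k, B i -> B j -> (k < K)%N ->
      `|l k (x_ i) - l k (x_ j)| <= eta.
    elim: (K) => [|K' [B UB BP]]; first by exists setT => //; exact: filterT.
    have [B' UB' B'P] := ultra_cauchy UU eta0 (lx K').
    exists (B `&` B'); first exact: filterI.
    move=> i j k [Bi B'i] [Bj B'j]; rewrite ltnS leq_eqVlt => /predU1P[->|kK'].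
      exact: B'P.
    exact: BP.
  exists B => // i j Bi Bj; apply: (le_trans (lK _)).
  have qij := sqr_sipB_le qP (x_ i) (x_ j).
  have qi := q_le i; have qj := q_le j.
  have : \sum_(k < K) l k (x_ i - x_ j) ^+ 2 <= d / 2.
    rewrite (@le_trans _ _ (\sum_(k < K) eta))//.
      apply: ler_sum => k _; rewrite lB.
      have h := BP _ _ k Bi Bj (ltn_ord k).
      have e1 : eta <= 1 by rewrite ge_min lexx.
      rewrite -real_normK ?num_real// expr2 (le_trans _ h)// ler_piMr//.
      exact: le_trans e1.
    rewrite sumr_const card_ord -mulr_natl.
    have : eta <= d / (2 * (K%:R + 1)) by rewrite ge_min lexx orbT.
    rewrite ler_pdivlMr ?mulr_gt0// => h; nra.
  have : eps * q (x_ i - x_ j) (x_ i - x_ j) <= d / 2.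
    rewrite (@le_trans _ _ (eps * (4 * (mu + 1))))//.
      by rewrite ler_pM2l//; lra.
    by rewrite /eps (_ : _ / _ * _ = d / 2)//; field; rewrite gt_eqF// addr_gt0.
  by move=> h1 h2; lra.
(* Parallelogram law: as x_i + x_j has energy at least mu times its mass 4 - N, where N is the mass
   of x_i - x_j, the energy of x_i - x_j is at most mu N plus twice the excess of the energies of
   x_i and x_j over mu. For i, j >= 2k + 3 each excess is at most 4^-k / 8. *)
have cauchy_nq (k : nat) : exists2 B, U B & forall i j, B i -> B j ->
    n (x_ i - x_ j) (x_ i - x_ j) + q (x_ i - x_ j) (x_ i - x_ j) <= 4^-1 ^+ k /\
    q (x_ i) (x_ i) <= mu + 4^-1 ^+ k.
  have k0 : 0 < 4^-1 ^+ k :> R by rewrite exprn_gt0.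
  have d0 : 0 < 4^-1 ^+ k / (2 * (mu + 1)) by rewrite divr_gt0// mulr_gt0// addr_gt0.
  have [B UB BP] := cauchy_n _ d0.
  exists (B `&` [set i | (k.*2 + 3 <= i)%N]).
    by apply: filterI => //; apply: oo_U; exists (k.*2 + 3)%N.
  move=> i j [Bi /= ki] [Bj /= kj].
  have nij := BP _ _ Bi Bj; rewrite ler_pdivlMr ?mulr_gt0 ?addr_gt0// in nij.
  have [i1 ii /andP[_ qi]] := x_P i; have [j1 jj /andP[_ qj]] := x_P j.
  have mu_ij : mu * n (x_ i + x_ j) (x_ i + x_ j) <= q (x_ i + x_ j) (x_ i + x_ j).
    by apply: mu_le; rewrite (sipDl nP) i1 j1 addr0.
  have le4 m : (k.*2 + 3 <= m)%N -> 2^-1 ^+ m <= 4^-1 ^+ k / 8 :> R.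
    move=> km; rewrite (@le_trans _ _ (2^-1 ^+ (k.*2 + 3)))//.
      by rewrite ler_wiXn2l// invf_le1// ler1n.
    rewrite exprD -muln2 mulnC exprM (_ : 2^-1 ^+ 2 = 4^-1 :> R); last by field.
    by rewrite ler_pM2l//; lra.
  have := le4 _ ki; have := le4 _ kj.
  have qpar : q (x_ i - x_ j) (x_ i - x_ j) =
      2 * q (x_ i) (x_ i) + 2 * q (x_ j) (x_ j) - q (x_ i + x_ j) (x_ i + x_ j).
    by rewrite (sqr_sipB qP) (sqr_sipD qP); ring.
  have npar : n (x_ i + x_ j) (x_ i + x_ j) = 4 - n (x_ i - x_ j) (x_ i - x_ j).
    by rewrite (sqr_sipB nP) (sqr_sipD nP) ii jj; ring.
  rewrite npar in mu_ij.
  set t := 4^-1 ^+ k in k0 nij *; set N := n _ _ in nij mu_ij *.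
  by move=> hj hi; split; nra.
have /choice[B BP] : forall k, exists B, U B /\ forall i j, B i -> B j ->
    n (x_ i - x_ j) (x_ i - x_ j) + q (x_ i - x_ j) (x_ i - x_ j) <= 4^-1 ^+ k /\
    q (x_ i) (x_ i) <= mu + 4^-1 ^+ k.
  by move=> k; have [B] := cauchy_nq k; exists B.
(* Choosing [m k] in the first k + 1 sets at once makes [m j] and [m k] both lie in [B k] whenever k
   <= j. *)
have /choice[m mP] : forall k, exists m, forall i, (i <= k)%N -> B i m.
  move=> k; suff /filter_ex [i iP] : U [set m | forall i, (i <= k)%N -> B i m].
    by exists i.
  elim: k => [|k IH].
    by apply: filterS (BP 0%N).1 => j Bj i; rewrite leqn0 => /eqP ->.
  apply: filterS2 IH (BP k.+1).1 => j h Bj i; rewrite leq_eqVlt ltnS => /predU1P[->//|].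
  exact: h.
have [u uP] := complete (x_ := x_ \o m) (fun k j kj =>
  ((BP k).2 _ _ (mP j k kj) (mP k k (leqnn k))).1).
have nu k : n (u - x_ (m k.+1)) (u - x_ (m k.+1)) <= 4^-1 ^+ k.
  by apply: le_trans (uP k); rewrite lerDl sip_ge0.
have qu k : q (u - x_ (m k.+1)) (u - x_ (m k.+1)) <= 4^-1 ^+ k.
  by apply: le_trans (uP k); rewrite lerDr sip_ge0.
have le41 k : 4^-1 ^+ k <= 2^-1 ^+ k :> R.
  by rewrite lerXn2r ?nnegrE ?invr_ge0// lef_pV2 ?posrE// ler_nat.
exists u; split.
- apply/eqP; rewrite -sqrf_eq0; apply/eqP/(@eqr0_geometric _ _ (n one one)).
    exact: ltW.
  move=> k; rewrite ger0_norm ?sqr_ge0//.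
  have -> : n u one = n (u - x_ (m k.+1)) one.
    by rewrite (sipBl nP); have [-> _ _] := x_P (m k.+1); rewrite subr0.
  rewrite (le_trans (sip_cauchy_schwarz nP _ _))// ler_pM2r//.
  exact: le_trans (nu k) (le41 k).
- apply/eqP; rewrite -subr_eq0; apply/eqP/(@eqr0_geometric _ _ 3) => // k.
  have [_ nm _] := x_P (m k.+1); rewrite -[X in _ - X]nm.
  have := sqr_sip_dist (M := 1) nP (nu k); rewrite nm lexx => /(_ isT).
  by rewrite (_ : 1 + 2 = 3 :> R)//; ring.
- apply/eqP; rewrite -subr_eq0; apply/eqP/(@eqr0_geometric _ _ (mu + 4)).
    by rewrite addr_ge0// ltW.
  move=> k; rewrite -(subrKA (q (x_ (m k.+1)) (x_ (m k.+1)))).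
  rewrite (le_trans (ler_normD _ _))//.
  have h := sqr_sip_dist qP (qu k) (q_le (m k.+1)).
  have [_ _ /andP[qmk _]] := x_P (m k.+1).
  have h2 : `|q (x_ (m k.+1)) (x_ (m k.+1)) - mu| <= 2^-1 ^+ k.
    rewrite ger0_norm ?subr_ge0// lerBlDl.
    have := (BP k).2 _ _ (mP k.+1 k (leqnSn k)) (mP k.+1 k (leqnSn k)).
    by move=> [_ /le_trans]; apply; rewrite lerD2l.
  rewrite (_ : mu + 4 = mu + 1 + 2 + 1); last by ring.
  by rewrite [in leRHS]mulrDr mulr1 lerD.
Qed.

(** At the minimizer u, for v orthogonal to [one], the quadratic polynomial q - mu n evaluated at u
    + t v is nonnegative with zero constant term, so its linear coefficient vanishes. Constants are
    added back afterwards. Conversely, an eigenvector for nu > 0 is orthogonal to [one], as testing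
    it against [one] shows, so nu is a competitor for the infimum. *)
Theorem least_eigenvector : exists mu' u, [/\ 0 < mu' <= Lambda, 0 < n u u,
  forall v, q u v = mu' * n u v &
  forall nu x, 0 < nu -> 0 < n x x -> (forall v, q x v = nu * n x v) ->
    mu' <= nu].
Proof.
have [u [u1 uu qu]] := minimizer; exists mu, u; split.
- rewrite mu_gt0/= -(ler_pM2r w_gt0) (le_trans _ qw)//; exact: mu_le.
- by rewrite uu.
- have uv v : n v one = 0 -> q u v = mu * n u v.
    move=> v1; apply/eqP; rewrite -subr_eq0 -sqrf_eq0 eq_le sqr_ge0 andbT.
    have c0 : 0 <= q v v - mu * n v v by rewrite subr_ge0 mu_le.
    have := @discriminant_le _ 0 (q u v - mu * n u v) _ c0; rewrite mul0r; apply.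
    move=> t; have := @mu_le (u + t *: v).
    rewrite (sipDl nP) u1 (sipZl nP) v1 mulr0 addr0 => /(_ erefl).
    rewrite (sqr_sipD nP) (sqr_sipD qP) !(sipZl nP, sipZr nP, sipZl qP, sipZr qP).
    by rewrite uu qu -subr_ge0; apply: eq_rect; congr (0 <= _); ring.
  move=> v; pose c := n v one / n one one.
  have -> : v = (v - c *: one) + c *: one by rewrite subrK.
  rewrite (sipDr nP) (sipDr qP) !(sipZr nP, sipZr qP) u1 (sipC qP u one) q_one.
  rewrite !mulr0 !addr0 uv// (sipBl nP) (sipZl nP) /c.
  by rewrite divfK ?subrr// gt_eqF.
- move=> nu x nu0 xx xP; have := xP one; rewrite (sipC qP) q_one => /esym/eqP.
  rewrite mulf_eq0 gt_eqF//= => /eqP /mu_le.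
  by rewrite xP ler_pM2r.
Qed.

End DirectMethod.

(** * Square-integrable functions *)

Section L2functions.
Context {d} {X : measurableType d} {R : realType}.
Variables (mu : {measure set X -> \bar R}) (D : set X).
Implicit Types u v : X -> R.

Definition L2 u : Prop :=
  measurable_fun D u /\ mu.-integrable D (fun x => (u x ^+ 2)%:E).

Definition ip u v : R := \int[mu]_(x in D) (u x * v x).

Hypothesis mD : measurable D.

Lemma L2_measurable u : L2 u -> measurable_fun D u.
Proof. by case. Qed.

Lemma L2M u v : L2 u -> L2 v -> mu.-integrable D (EFin \o (fun x => u x * v x)).
Proof.
move=> [mu' iu] [mv iv].
apply: (le_integrable mD _ _ (integrableD mD iu iv)).
  by apply/measurable_EFinP; exact: measurable_funM.
move=> x Dx /=; rewrite lee_fin.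
rewrite [leRHS]ger0_norm ?addr_ge0 ?sqr_ge0//.
by rewrite ler_norml; apply/andP; split; nra.
Qed.

Lemma L2Z c u : L2 u -> L2 (c *: u).
Proof.
move=> [mu' iu]; split; first exact: measurable_funM.
have -> : (fun x => ((c *: u) x ^+ 2)%:E) =
    (fun x => ((c ^+ 2)%:E * (u x ^+ 2)%:E)%E).
  by apply/funext => x; rewrite -EFinM -exprMn.
exact: integrableZl.
Qed.

Lemma L2D u v : L2 u -> L2 v -> L2 (u + v).
Proof.
move=> Lu Lv; have [[mu' iu] [mv iv]] := (Lu, Lv); split.
  exact: measurable_funD.
have -> : (fun x => ((u + v) x ^+ 2)%:E) =
    (fun x => ((u x ^+ 2)%:E + (2%:E * (u x * v x)%:E + (v x ^+ 2)%:E))%E).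
  by apply/funext => x; rewrite -!EFinM -!EFinD -[(u + v) x]/(u x + v x); congr EFin; ring.
apply: integrableD => //; apply: integrableD => //; apply: integrableZl => //.
exact: L2M.
Qed.

Lemma L2B u v : L2 u -> L2 v -> L2 (u - v).
Proof. by move=> Lu Lv; rewrite -scaleN1r; apply: L2D => //; exact: L2Z. Qed.

Lemma L20 : L2 0.
Proof.
split; first exact: measurable_cst.
by rewrite (_ : (fun _ => _) = cst 0%E); [exact: integrable0|
  apply/funext => x; rewrite expr0n].
Qed.

Lemma ipC u v : ip u v = ip v u.
Proof. by apply: eq_Rintegral => x _; rewrite mulrC. Qed.

Lemma ip_linear c u v w : L2 u -> L2 v -> L2 w ->
  ip (c *: u + v) w = c * ip u w + ip v w.
Proof.
move=> Lu Lv Lw; rewrite /ip -RintegralZl//; last exact: L2M.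
rewrite -RintegralD//; last 2 first.
- by have := L2M (L2Z c Lu) Lw; apply: eq_integrable => // x _ /=; rewrite mulrA.
- exact: L2M.
by apply: eq_Rintegral => x _; rewrite mulrA -mulrDl.
Qed.

Lemma ip_ge0 u : 0 <= ip u u.
Proof. by apply: Rintegral_ge0 => x _; rewrite -expr2 sqr_ge0. Qed.

Lemma ipE u : L2 u -> (ip u u)%:E = (\int[mu]_(x in D) (u x ^+ 2)%:E)%E.
Proof.
move=> [_ iu]; rewrite /ip /Rintegral fineK; last first.
  by under eq_fun do rewrite -expr2; exact: integrable_fin_num.
by apply: eq_integral => x _; rewrite expr2.
Qed.

Lemma ip_ae0 u : L2 u -> ip u u = 0 -> ae_eq mu D u (cst 0).
Proof.
move=> Lu; have [mu' _] := Lu; move=> /eqP; rewrite -eqe ipE// => /eqP i0.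
have mu2 : measurable_fun D (fun x => (u x ^+ 2)%:E).
  by apply/measurable_EFinP; exact: measurable_funX.
have : (\int[mu]_(x in D) `|(u x ^+ 2)%:E| = 0)%E.
  rewrite -[RHS]i0; apply: eq_integral => x _.
  by rewrite gee0_abs// lee_fin sqr_ge0.
move/(ae_eq_integral_abs mu mD mu2).
by apply: filterS => x h /h /= [] /eqP; rewrite sqrf_eq0 => /eqP.
Qed.

(** Riesz-Fischer. The series [h] of 2^k (u_(k+1) - u_k)^2 has integral at most the sum of 2^k 4^-k,
    that is 2, so it is finite on a set [G] of full measure. There |u_(k+1) - u_k| <= sqrt (h x)
    2^(-k/2) is summable. Fatou's lemma then passes the rate 4^-k unchanged to the limit. *)
Lemma L2_complete (u_ : nat -> X -> R) : (forall k, L2 (u_ k)) ->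
  (forall k j, (k <= j)%N -> ip (u_ j - u_ k) (u_ j - u_ k) <= 4^-1 ^+ k) ->
  exists u, L2 u /\ forall k, ip (u - u_ k) (u - u_ k) <= 4^-1 ^+ k.
Proof.
move=> Lu fast.
pose g k x := (2 ^+ k * (u_ k.+1 x - u_ k x) ^+ 2)%:E.
pose h x := (\sum_(0 <= k <oo) g k x)%E.
have g0 k x : (0 <= g k x)%E by rewrite lee_fin mulr_ge0// sqr_ge0.
have mu_ k : measurable_fun D (u_ k) by case: (Lu k).
have mg k : measurable_fun D (g k).
  apply/measurable_EFinP; apply: measurable_funM; first exact: measurable_cst.
  by apply: measurable_funX; exact: measurable_funB.
have mh : measurable_fun D h.
  by apply: ge0_emeasurable_sum => // k x _ _; exact: g0.
have h_int : (\int[mu]_(x in D) h x <= 2%:E)%E.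
  rewrite integral_nneseries//.
  have g_le k : (\int[mu]_(x in D) g k x <= (2^-1 ^+ k)%:E)%E.
    have -> : (\int[mu]_(x in D) g k x =
        (2 ^+ k * ip (u_ k.+1 - u_ k) (u_ k.+1 - u_ k))%:E)%E.
      rewrite EFinM ipE; last exact: L2B.
      rewrite -ge0_integralZl//; last 2 first.
        by apply/measurable_EFinP/measurable_funX/measurable_funB.
        by move=> x _; rewrite lee_fin sqr_ge0.
    have k2 : 0 < 2 ^+ k :> R by rewrite exprn_gt0.
    have := fast k k.+1 (leqnSn k); rewrite lee_fin -(ler_pM2l k2).
    by rewrite -[X in _ <= X -> _]exprMn (_ : 2 * 4^-1 = 2^-1 :> R)//; field.
  apply: (@le_trans _ _ (\sum_(0 <= k <oo) (2^-1 ^+ k)%:E)%E).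
    by apply: lee_nneseries => // k *; apply: integral_ge0 => *; exact: g0.
  apply: lime_le; first by apply: is_cvg_nneseries => k _ _; rewrite lee_fin exprn_ge0.
  apply: nearW => n; rewrite sumEFin lee_fin.
  have := @geometric_seriesE R 1 2^-1; rewrite /geometric/= => /(_ _)/(congr1 (@^~ n)).
  rewrite /series/= => E; under eq_bigr do rewrite -[_ ^+ _]mul1r.
  rewrite E ?lt_eqF ?invf_lt1 ?ltr1n// mul1r ler_pdivrMr; last by lra.
  have : 0 <= 2^-1 ^+ n :> R by rewrite exprn_ge0.
  by lra.
pose G := D `&` [set x | (h x < +oo)%E].
have mG : measurable G by apply: measurable_lte => //; exact: measurable_cst.
have aeG : {ae mu, forall x, D x -> G x}.
  have : mu.-integrable D h.
    apply/integrableP; split => //; apply: (le_lt_trans _ (ltry 2)).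
    rewrite (le_trans _ h_int)// (eq_integral h)// => x _.
    by rewrite gee0_abs// nneseries_ge0.
  move/(integrable_ae mD); apply: filterS => x hx Dx; split => //.
  by have := hx Dx; rewrite fin_numElt => /andP[].
pose v k := u_ k \* \1_G.
have mv k : measurable_fun D (v k).
  by apply: measurable_funM => //; exact: measurable_indic.
have v_cvg x : D x -> cvgn (v ^~ x).
  move=> Dx; have [Gx|nGx] := pselect (G x); last first.
    have -> : v ^~ x = cst 0.
      by apply/funext => k; rewrite /v/= indicE memNset ?mulr0.
    exact: is_cvg_cst.
  have -> : v ^~ x = u_ ^~ x.
    by apply/funext => k; rewrite /v/= indicE mem_set ?mulr1.
  pose M := fine (h x).
  have hM : h x = M%:E.
    by rewrite /M fineK// ge0_fin_numE ?nneseries_ge0//; case: Gx.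
  have M0 : 0 <= M by rewrite -lee_fin -hM nneseries_ge0.
  have gM k : (g k x <= M%:E)%E.
    rewrite -hM /h (nneseries_split 0 k.+1)//.
    rewrite add0n big_nat_recr//= -[leLHS]add0e.
    rewrite (le_trans (leeD2r (g k x) (_ : 0 <= \sum_(0 <= i < k) g i x)%E))//.
      by apply: sume_ge0.
    by rewrite leeDl// nneseries_ge0.
  pose r : R := Num.sqrt 2^-1.
  have r0 : 0 <= r by exact: sqrtr_ge0.
  have r1 : r < 1 by rewrite -sqrtr1 ltr_sqrt// invf_lt1// ltr1n.
  have diff_le k : `|u_ k.+1 x - u_ k x| <= Num.sqrt M * r ^+ k.
    rewrite -(ler_pXn2r (ltn0Sn 1)) ?nnegrE ?normr_ge0 ?mulr_ge0 ?sqrtr_ge0 ?exprn_ge0//.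
    rewrite real_normK ?num_real// exprMn sqr_sqrtr// exprAC sqr_sqrtr ?invr_ge0//.
    rewrite exprVn ler_pdivlMr ?exprn_gt0// mulrC.
    by have := gM k; rewrite lee_fin.
  have : cvgn (series (telescope (u_ ^~ x))).
    apply: normed_cvg.
    apply: (series_le_cvg _ _ diff_le) => [k|k|]; rewrite ?normr_ge0//.
      by rewrite mulr_ge0 ?sqrtr_ge0 ?exprn_ge0.
    by apply: is_cvg_geometric_series; rewrite ger0_norm.
  rewrite telescopeK => /cvg_ex[l lP]; apply/cvg_ex; exists (l + u_ 0%N x).
  have -> : u_ ^~ x = (fun k => (u_ k x - u_ 0%N x) + u_ 0%N x).
    by apply/funext => k; rewrite subrK.
  by apply: cvgD => //; exact: cvg_cst.
pose f x := limn (v ^~ x).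
have mf : measurable_fun D f.
  by apply: (measurable_fun_cvg mv) => x Dx; exact: v_cvg.
have f_le k : (\int[mu]_(x in D) ((f x - u_ k x) ^+ 2)%:E <= (4^-1 ^+ k)%:E)%E.
  have -> : (\int[mu]_(x in D) ((f x - u_ k x) ^+ 2)%:E =
      \int[mu]_(x in D) ((f x - v k x) ^+ 2)%:E)%E.
    apply: ge0_ae_eq_integral => //; try by move=> x _; rewrite lee_fin sqr_ge0.
      by apply/measurable_EFinP/measurable_funX/measurable_funB.
      by apply/measurable_EFinP/measurable_funX/measurable_funB.
    apply: filterS aeG => x Gx /Gx xG.
    by rewrite /v/= indicE mem_set// mulr1.
  pose F j x := ((v (j + k)%N x - v k x) ^+ 2)%:E.
  have mF j : measurable_fun D (F j).
    by apply/measurable_EFinP/measurable_funX/measurable_funB.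
  have F0 j x : D x -> (0 <= F j x)%E by rewrite lee_fin sqr_ge0.
  have FE x : D x -> limn_einf (F ^~ x) = ((f x - v k x) ^+ 2)%:E.
    move=> Dx; apply: (cvg_limn_einf_sup _).1; apply: cvg_EFin; first exact: nearW.
    apply: (@cvg_comp _ _ _ (fun j => v (j + k)%N x - v k x) (fun y => y ^+ 2)).
      by apply: cvgB; [rewrite (cvg_shiftn k (v ^~ x)); exact: v_cvg|exact: cvg_cst].
    exact: exprn_continuous.
  rewrite (eq_integral (fun x => limn_einf (F ^~ x))); last first.
    by move=> x /set_mem Dx; rewrite FE.
  apply: (le_trans (fatou mu mD mF F0)).
  rewrite limn_einf_lim; apply: lime_le; first exact: is_cvg_einfs.
  apply: nearW => j; apply: (@le_trans _ _ (\int[mu]_(x in D) F j x)%E).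
    by apply: ereal_inf_lbound; exists j => /=.
  apply: (@le_trans _ _ (ip (u_ (j + k)%N - u_ k) (u_ (j + k)%N - u_ k))%:E).
    rewrite ipE; last exact: L2B.
    apply: ge0_le_integral => //.
      by move=> x _; rewrite lee_fin sqr_ge0.
      by apply/measurable_EFinP/measurable_funX/measurable_funB.
    move=> x Dx; rewrite /F /v/= lee_fin -mulrBl indicE exprMn.
    by case: (x \in G); rewrite ?expr1n ?mulr1// expr0n mulr0 sqr_ge0.
  by rewrite lee_fin; apply: fast; exact: leq_addl.
have L2f k : L2 (f - u_ k).
  split; first exact: measurable_funB.
  apply/integrableP; split.
    by apply/measurable_EFinP/measurable_funX/measurable_funB.
  apply: (le_lt_trans _ (ltry (4^-1 ^+ k))); apply: le_trans (f_le k).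
  rewrite le_eqVlt; apply/orP; left; apply/eqP; apply: eq_integral => x _.
  by rewrite gee0_abs// lee_fin sqr_ge0.
exists f; split.
  by rewrite -[f](subrK (u_ 0%N)); exact: L2D.
by move=> k; rewrite -lee_fin ipE; [exact: f_le|exact: L2f].
Qed.

(** The measurability proof is an argument so that the submodule structure, whose closure proof uses
    it, is found from the predicate alone. *)
Definition L2pred (_ : measurable D) : {pred X -> R} := [pred u | `[< L2 u >]].

Fact L2pred_submod_closed : submod_closed (L2pred mD).
Proof.
split; first by apply/asboolP; exact: L20.
by move=> c u v /asboolP Lu /asboolP Lv; apply/asboolP; apply: L2D => //; exact: L2Z.
Qed.

End L2functions.

HB.instance Definition _ d (X : measurableType d) (R : realType)
    (mu : {measure set X -> \bar R}) (D : set X) (mD : measurable D) :=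
  GRing.isSubmodClosed.Build R (X -> R) (L2pred mu mD)
    (L2pred_submod_closed mu mD).

Definition L2space d (X : measurableType d) (R : realType)
  (mu : {measure set X -> \bar R}) (D : set X) (mD : measurable D) :=
  {u : X -> R | u \in L2pred mu mD}.

HB.instance Definition _ d (X : measurableType d) (R : realType)
    (mu : {measure set X -> \bar R}) (D : set X) (mD : measurable D) :=
  SubChoice.on (L2space mu mD).
HB.instance Definition _ d (X : measurableType d) (R : realType)
    (mu : {measure set X -> \bar R}) (D : set X) (mD : measurable D) :=
  [SubChoice_isSubLmodule of L2space mu mD by <:].

Section L2orthogonal.
Context {d} {X : measurableType d} {R : realType}.
Variables (mu : {measure set X -> \bar R}) (D : set X) (mD : measurable D).

Definition L2form (x y : L2space mu mD) := ip mu D (val x) (val y).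

Lemma L2spaceP (x : L2space mu mD) : L2 mu D (val x).
Proof. by have /asboolP := valP x. Qed.

Definition L2pack u (Lu : L2 mu D u) : L2space mu mD :=
  exist _ u (introT (asboolP _) Lu).

Lemma L2formP : semi_inner_product L2form.
Proof.
split=> [c x y z|x y|x].
- by rewrite /L2form -(ip_linear mD c (L2spaceP x) (L2spaceP y) (L2spaceP z)).
- by rewrite /L2form ipC.
- exact: ip_ge0.
Qed.

Lemma ip_cauchy_schwarz u v : L2 mu D u -> L2 mu D v ->
  ip mu D u v ^+ 2 <= ip mu D u u * ip mu D v v.
Proof. by move=> Lu Lv; exact: (sip_cauchy_schwarz L2formP (L2pack Lu) (L2pack Lv)). Qed.

Variables (e : nat -> X -> R) (w : nat -> R).
Hypothesis Le : forall k, L2 mu D (e k).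
Hypothesis w_gt0 : forall k, 0 < w k.
Hypothesis e_orth : forall i j, i != j -> ip mu D (e i) (e j) = 0.

Lemma L2_bessel u K : (forall k, ip mu D (e k) (e k) <= w k) ->
  L2 mu D u -> \sum_(k < K) ip mu D u (e k) ^+ 2 / w k <= ip mu D u u.
Proof.
move=> ew Lu.
exact: (@bessel _ _ _ L2formP (fun k => L2pack (Le k)) w w_gt0 e_orth (L2pack Lu)).
Qed.

Lemma L2_parseval u (eps : R) : (forall k, ip mu D (e k) (e k) = w k) ->
  (forall v, L2 mu D v -> (forall k, ip mu D v (e k) = 0) -> ip mu D v v = 0) ->
  L2 mu D u -> 0 < eps ->
  exists K, ip mu D u u <= \sum_(k < K) ip mu D u (e k) ^+ 2 / w k + eps.
Proof.
move=> ew total Lu eps0.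
apply: (@parseval _ _ _ L2formP (fun k => L2pack (Le k)) w w_gt0 e_orth ew _ _ (L2pack Lu)) => //.
  move=> x_ fast; have [v [Lv vP]] := L2_complete mD (fun k => L2spaceP (x_ k)) fast.
  by exists (L2pack Lv).
by move=> x; apply: total; exact: L2spaceP.
Qed.

End L2orthogonal.

(** * Limits, bounds and vanishing of integrals *)

Section IntegralTools.
Context {d} {X : measurableType d} {R : realType}.
Variables (mu : {measure set X -> \bar R}) (D : set X) (mD : measurable D).

Lemma Rintegral_cvg (f_ : nat -> X -> R) (f g : X -> R) :
  (forall k, measurable_fun D (f_ k)) ->
  (forall x, D x -> f_ ^~ x @ \oo --> f x) ->
  mu.-integrable D (EFin \o g) ->
  (forall k x, D x -> `|f_ k x| <= g x) ->
  mu.-integrable D (EFin \o f) /\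
  (fun k => \int[mu]_(x in D) f_ k x) @ \oo --> \int[mu]_(x in D) f x.
Proof.
move=> mf_ f_f ig f_g.
have mf : measurable_fun D f by exact: measurable_fun_cvg f_f.
have cvgE x : D x -> (fun k => (f_ k x)%:E) @ \oo --> (f x)%:E.
  by move=> Dx; apply: cvg_EFin; [exact: nearW|exact: f_f].
have [ifE _ cvgi] := dominated_convergence mD
  (fun k => (measurable_EFinP D (f_ k)).2 (mf_ k)) ((measurable_EFinP D f).2 mf)
  (aeW mu cvgE) ig (aeW mu (fun x k Dx => f_g k x Dx)).
split => //; apply: fine_cvg.
by rewrite /Rintegral fineK//; exact: integrable_fin_num.
Qed.

Lemma integrable_bounded (f : X -> R) (M : R) : (mu D < +oo)%E ->
  measurable_fun D f -> (forall x, D x -> `|f x| <= M) ->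
  mu.-integrable D (EFin \o f).
Proof.
move=> Doo mf fM; apply: measurable_bounded_integrable => //.
exists M; split; first exact: num_real.
by move=> N MN x /= Dx; rewrite (le_trans (fM x Dx))// ltW.
Qed.

Lemma integrableM_bounded (f g : X -> R) (M : R) :
  mu.-integrable D (EFin \o f) -> measurable_fun D g ->
  (forall x, D x -> `|g x| <= M) ->
  mu.-integrable D (EFin \o (fun x => f x * g x)).
Proof.
move=> intf mg gM.
have mf : measurable_fun D f by apply/measurable_EFinP; exact: measurable_int intf.
apply: (le_integrable mD _ _ (integrableZl mD M intf)).
  by apply/measurable_EFinP; exact: measurable_funM.
move=> x Dx /=; rewrite lee_fin normrM mulrC normrM ler_wpM2r//.
by rewrite (le_trans (gM _ Dx))// ler_norm.
Qed.

Lemma L2_bounded (f : X -> R) (M : R) : (mu D < +oo)%E ->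
  measurable_fun D f -> (forall x, D x -> `|f x| <= M) -> L2 mu D f.
Proof.
move=> Doo mf fM; split => //.
apply: (@integrable_bounded (fun x => f x ^+ 2) (M ^+ 2)) => //.
  exact: measurable_funX.
move=> x Dx; rewrite normrX lerXn2r ?nnegrE//; last exact: fM.
by rewrite (le_trans (normr_ge0 (f x)))// fM.
Qed.

Lemma L2_integrable (f : X -> R) : (mu D < +oo)%E -> L2 mu D f ->
  mu.-integrable D (EFin \o f).
Proof.
move=> Doo Lf; have L1 : L2 mu D (cst 1).
  by apply: (@L2_bounded _ 1) => // x _; rewrite normr1.
by have := L2M mD Lf L1; apply: eq_integrable => // x _ /=; rewrite mulr1.
Qed.

(** The sets over whose preimage [w] integrates to 0 form a Dynkin system. The map [phi] allows sets
    to be generalized one coordinate at a time, and then on the plane with [phi] the identity. *)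
Lemma dynkin_Rintegral0 d' (Y : measurableType d') (phi : X -> Y) (w : X -> R)
    (G : set (set Y)) : measurable_fun setT phi ->
  mu.-integrable D (EFin \o w) -> @measurable _ Y = <<s G >> ->
  setI_closed G -> \int[mu]_(x in D) w x = 0 ->
  (forall B, G B -> \int[mu]_(x in D `&` phi @^-1` B) w x = 0) ->
  forall B, measurable B -> \int[mu]_(x in D `&` phi @^-1` B) w x = 0.
Proof.
move=> mphi iw GE GI w0 wG B; rewrite GE.
have mB B' : measurable B' -> measurable (D `&` phi @^-1` B').
  by move=> mB'; apply: measurableI => //; rewrite -[_ @^-1` _]setTI; exact: mphi.
move: B; apply: (@dynkin_induction _ _ _
  (fun B => \int[mu]_(x in D `&` phi @^-1` B) w x = 0) GE GI) =>
  [|//|A mA A0|F mF tF F0].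
- by rewrite preimage_setT setIT.
- have := @Rintegral_setU _ _ _ mu (D `&` phi @^-1` A) (D `&` phi @^-1` (~` A)) w.
  rewrite -setIUr -preimage_setU setUv preimage_setT setIT w0 A0 add0r => <- //.
  + exact: mB.
  + by apply: mB; exact: measurableC.
  + by apply/disj_set2P; rewrite setIACA -preimage_setI setICr preimage_set0 setI0.
- rewrite preimage_bigcup setI_bigcupr /Rintegral integral_bigcup.
  + rewrite eseries0// => k _ _.
    have ik : mu.-integrable (D `&` phi @^-1` F k) (EFin \o w).
      exact: (integrableS mD (mB _ (mF k)) (@subIsetl _ _ _) iw).
    rewrite -[LHS]fineK; last exact: (integrable_fin_num (mB _ (mF k)) ik).
    by congr EFin; exact: F0.
  + by move=> i j _ _ [x [[_ xi] [_ xj]]]; apply: (tF i j) => //; exists (phi x).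
  + by move=> k; exact: mB.
  + rewrite -setI_bigcupr -preimage_bigcup; apply: (integrableS mD _ (@subIsetl _ _ _) iw).
      by apply: mB; exact: bigcup_measurable.
Qed.

Lemma Rintegral0_ae (w : X -> R) : mu.-integrable D (EFin \o w) ->
  (forall B, measurable B -> \int[mu]_(x in D `&` B) w x = 0) ->
  ae_eq mu D (EFin \o w) (cst 0%E).
Proof.
move=> iw w0; apply: integral_ae_eq => // E ED mE.
have iE : mu.-integrable E (EFin \o w) by exact: (integrableS mD mE ED iw).
rewrite integral0 -[LHS]fineK; last exact: (integrable_fin_num mE iE).
by congr EFin; rewrite -[RHS](w0 E mE) setIidr.
Qed.

End IntegralTools.

Notation plane R := (measurableTypeR R * measurableTypeR R)%type.

Section PlaneIntegrals.
Context {R : realType}.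
Implicit Types (f g F : R -> R).

Lemma continuous_measurableR f : continuous f ->
  measurable_fun [set: measurableTypeR R] f.
Proof. exact: continuous_measurable_fun. Qed.

Lemma measurable_fun1 f : continuous f ->
  measurable_fun [set: plane R] (fun p => f p.1).
Proof.
by move=> cf; apply: measurableT_comp measurable_fst; exact: continuous_measurableR.
Qed.

Lemma measurable_fun2 f : continuous f ->
  measurable_fun [set: plane R] (fun p => f p.2).
Proof.
by move=> cf; apply: measurableT_comp measurable_snd; exact: continuous_measurableR.
Qed.

Lemma measurable_affine (al be ga : R) :
  measurable_fun [set: plane R] (fun p => al * p.1 + be * p.2 + ga).
Proof.
apply: measurable_funD; last exact: measurable_cst.
by apply: measurable_funD; exact: measurable_funM.
Qed.

Lemma measurable_itvR (i : interval R) : measurable ([set` i] : set (measurableTypeR R)).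
Proof. exact: measurable_itv. Qed.

Lemma lebesgue_measure_itvcc (a b : R) : a <= b ->
  lebesgue_measure `[a, b]%classic = (b - a)%:E.
Proof.
move=> ab; rewrite lebesgue_measure_itv/= lte_fin EFinB.
by case: ltgtP ab => // -> _; rewrite subee.
Qed.

Lemma Rintegral_FTC (f F : R -> R) (a b : R) : a < b ->
  (forall x : R, is_derive x (1 : R) F (f x)) -> continuous f ->
  \int[lebesgue_measure]_(x in `[a, b]) f x = F b - F a.
Proof.
move=> ab dF cf; rewrite /Rintegral (@continuous_FTC2 _ _ F)//.
- exact: continuous_subspaceT.
- have cF x : {for x, continuous F}.
    by apply/differentiable_continuous/derivable1_diffP; case: (dF x).
  split; first by move=> x _; case: (dF x).
    by apply: cvg_at_right_filter; exact: cF.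
  by apply: cvg_at_left_filter; exact: cF.
- by move=> x _; rewrite derive1E; exact: derive_val.
Qed.

Lemma Rintegral_fubini (D : set (plane R)) (F : plane R -> R) :
  measurable D -> (@area R).-integrable D (EFin \o F) ->
  \int[@area R]_(p in D) F p =
  \int[lebesgue_measure]_x \int[lebesgue_measure]_y (F \_ D) (x, y).
Proof.
move=> mD iF; rewrite Rintegral_mkcond /Rintegral.
have iFD : (@area R).-integrable setT (EFin \o (F \_ D)).
  by have := (integrable_mkcond (EFin \o F) mD).1 iF; rewrite restrict_EFin.
rewrite -[X in fine X]integral12_prod_meas1//; congr fine.
apply: ae_eq_integral => //.
- by have := integrable_fubini_F iFD => /measurable_int.
- apply/measurable_EFinP; apply: measurableT_comp => //.
  by have := integrable_fubini_F iFD => /measurable_int.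
(* The inner integral is known to be finite only for almost every x, which is enough under the outer
   integral. *)
have := ae_integrable1 iFD; apply: filterS => x ix _.
by rewrite /fubini_F fineK//; exact: integrable_fin_num.
Qed.

Lemma Rintegral_prod (A B : set (measurableTypeR R)) f g :
  measurable A -> measurable B ->
  (@area R).-integrable (A `*` B) (EFin \o (fun p => f p.1 * g p.2)) ->
  lebesgue_measure.-integrable B (EFin \o g) ->
  lebesgue_measure.-integrable A (EFin \o f) ->
  \int[@area R]_(p in A `*` B) (f p.1 * g p.2) =
  (\int[lebesgue_measure]_(x in A) f x) * (\int[lebesgue_measure]_(x in B) g x).
Proof.
move=> mA mB ifg ig jf; rewrite Rintegral_fubini//; last exact: measurableX.
rewrite -RintegralZr// [RHS]Rintegral_mkcond; apply: eq_Rintegral => x _.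
rewrite patchE; have [Ax|nAx] := boolP (x \in A).
  rewrite -RintegralZl// [RHS]Rintegral_mkcond; apply: eq_Rintegral => y _.
  by rewrite !patchE in_setX Ax/=; case: ifP.
rewrite -[LHS](@eq_Rintegral _ _ _ _ _ _ (cst 0)) ?Rintegral_cst ?mul0r//.
by move=> y _; rewrite patchE in_setX (negbTE nAx).
Qed.

End PlaneIntegrals.

(** * Cosine series on the unit square *)

Section Cosines.
Context {R : realType}.
Implicit Types (m n k : nat) (x y : R).

Definition cosn m x : R := cos (m%:R * pi * x).
Definition sinn m x : R := sin (m%:R * pi * x).

Lemma sin_nat_pi m : sin (m%:R * pi) = 0 :> R.
Proof.
elim: m => [|m IH]; first by rewrite mul0r sin0.
by rewrite -natr1 mulrDl mul1r sinDpi IH oppr0.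
Qed.

Lemma is_derive_cosn m x : is_derive x (1 : R) (cosn m) (- (m%:R * pi) * sinn m x).
Proof.
have h : is_derive x (1 : R) (fun y => m%:R * pi * y) (m%:R * pi).
  by have := is_deriveZ (m%:R * pi) (is_derive_id x (1 : R)); rewrite /GRing.scale/= mulr1.
apply: is_derive_eq (is_derive1_comp (is_derive_cos (m%:R * pi * x)) h) _.
by rewrite /sinn; ring.
Qed.

Lemma is_derive_sinn m x : is_derive x (1 : R) (sinn m) (m%:R * pi * cosn m x).
Proof.
have h : is_derive x (1 : R) (fun y => m%:R * pi * y) (m%:R * pi).
  by have := is_deriveZ (m%:R * pi) (is_derive_id x (1 : R)); rewrite /GRing.scale/= mulr1.
apply: is_derive_eq (is_derive1_comp (is_derive_sin (m%:R * pi * x)) h) _.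
by rewrite /cosn; ring.
Qed.

Lemma is_derive_continuous (f f' : R -> R) :
  (forall x, is_derive x (1 : R) f (f' x)) -> continuous f.
Proof.
move=> df x; apply/differentiable_continuous/derivable1_diffP.
by case: (df x).
Qed.

Lemma continuous_cosn m : continuous (cosn m).
Proof. exact: (is_derive_continuous (is_derive_cosn m)). Qed.

Lemma continuous_sinn m : continuous (sinn m).
Proof. exact: (is_derive_continuous (is_derive_sinn m)). Qed.

Lemma normr_cosn m x : `|cosn m x| <= 1.
Proof. by rewrite ler_norml cos_geN1 cos_le1. Qed.

Lemma normr_sinn m x : `|sinn m x| <= 1.
Proof. by rewrite ler_norml sin_geN1 sin_le1. Qed.

Lemma Rintegral_cosn m :
  \int[lebesgue_measure]_(x in `[0, 1]) cosn m x = (m == 0%N)%:R.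
Proof.
have [->|m0] := eqVneq m 0%N.
  under eq_Rintegral do rewrite /cosn !mul0r cos0.
  by rewrite Rintegral_cst//= lebesgue_measure_itvcc//= subr0 mul1r.
have mpi : m%:R * pi != 0 :> R by rewrite mulf_neq0 ?pnatr_eq0// gt_eqF ?pi_gt0.
have dF x : is_derive x (1 : R) (fun y => (m%:R * pi)^-1 * sinn m y) (cosn m x).
  have := is_deriveZ ((m%:R * pi)^-1) (is_derive_sinn m x).
  by rewrite /GRing.scale/= mulKf.
rewrite (Rintegral_FTC ltr01 dF (@continuous_cosn m)).
by rewrite /sinn mulr0 mulr1 sin0 sin_nat_pi !mulr0 subrr.
Qed.

Lemma cosn_mul m n x : (n <= m)%N ->
  cosn m x * cosn n x = 2^-1 * (cosn (m - n) x + cosn (m + n) x).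
Proof.
by move=> nm; rewrite /cosn natrB// natrD !mulrBl !mulrDl cosB cosD; field.
Qed.

Lemma sinn_mul m n x : (n <= m)%N ->
  sinn m x * sinn n x = 2^-1 * (cosn (m - n) x - cosn (m + n) x).
Proof.
by move=> nm; rewrite /cosn /sinn natrB// natrD !mulrBl !mulrDl cosB cosD; field.
Qed.

(** The squared norm of [cosn m] in L^2(0, 1). *)
Definition cosw m : R := if m == 0%N then 1 else 2^-1.

Lemma cosw_gt0 m : 0 < cosw m.
Proof. by rewrite /cosw; case: ifP. Qed.

Lemma integrable_cosn m :
  lebesgue_measure.-integrable (`[0, 1]%classic : set (measurableTypeR R)) (EFin \o cosn m).
Proof.
apply: continuous_compact_integrable; first exact: segment_compact.
exact/continuous_subspaceT/continuous_cosn.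
Qed.

Lemma Rintegral_cosn_mul m n :
  \int[lebesgue_measure]_(x in `[0, 1]) (cosn m x * cosn n x) =
  (m == n)%:R * cosw m.
Proof.
wlog nm : m n / (n <= m)%N.
  move=> H; have [nm|/ltnW mn] := leqP n m; first exact: H.
  under eq_Rintegral do rewrite mulrC.
  by rewrite (H _ _ mn) eq_sym; case: eqVneq => [->//|_]; rewrite !mul0r.
under eq_Rintegral do rewrite cosn_mul//.
rewrite RintegralZl ?RintegralD//; try exact: integrable_cosn; last first.
  by have := integrableD (measurable_itvR `[0, 1]) (integrable_cosn (m - n)) (integrable_cosn (m + n)).
rewrite !Rintegral_cosn subn_eq0 addn_eq0 (eqn_leq m n) nm andbT /cosw.
case: (leqP m n) => mn; last by rewrite !mul0r gtn_eqF ?addr0 ?mulr0// (leq_ltn_trans _ mn).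
have <- : m = n by apply/eqP; rewrite eqn_leq mn.
by rewrite andbb mul1r; case: eqP => _ /=; [field|rewrite addr0 mulr1].
Qed.

Lemma Rintegral_sinn_mul m n :
  \int[lebesgue_measure]_(x in `[0, 1]) (sinn m x * sinn n x) =
  (m == n)%:R * ((m != 0%N)%:R / 2).
Proof.
wlog nm : m n / (n <= m)%N.
  move=> H; have [nm|/ltnW mn] := leqP n m; first exact: H.
  under eq_Rintegral do rewrite mulrC.
  by rewrite (H _ _ mn) eq_sym; case: eqVneq => [->//|_]; rewrite !mul0r.
under eq_Rintegral do rewrite sinn_mul//.
rewrite RintegralZl ?RintegralB//; try exact: integrable_cosn; last first.
  by have := integrableB (measurable_itvR `[0, 1]) (integrable_cosn (m - n)) (integrable_cosn (m + n)).
rewrite !Rintegral_cosn subn_eq0 addn_eq0 (eqn_leq m n) nm andbT.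
case: (leqP m n) => mn; last by rewrite !mul0r gtn_eqF ?subr0 ?mulr0// (leq_ltn_trans _ mn).
have <- : m = n by apply/eqP; rewrite eqn_leq mn.
by rewrite andbb mul1r; case: eqP => _ /=; rewrite ?subrr ?subr0 ?mul0r ?mulr0// mulrC.
Qed.

Definition square : set (plane R) := `[0, 1] `*` `[0, 1].

Lemma measurable_square : measurable square.
Proof. by apply: measurableX; exact: measurable_itvR. Qed.

Lemma area_square : @area R square = 1%E.
Proof.
rewrite /area product_measure1E; try exact: measurable_itvR.
by rewrite /= !lebesgue_measure_itvcc// subr0 mule1.
Qed.

Lemma area_square_fin : (@area R square < +oo)%E.
Proof. by rewrite area_square ltry. Qed.

Definition cosn2 m n (p : plane R) : R := cosn m p.1 * cosn n p.2.
Definition sincosn m n (p : plane R) : R := sinn m p.1 * cosn n p.2.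

Lemma measurable_prodfun (f g : R -> R) : continuous f -> continuous g ->
  measurable_fun [set: plane R] (fun p => f p.1 * g p.2).
Proof.
by move=> cf cg; apply: measurable_funM; [exact: measurable_fun1|exact: measurable_fun2].
Qed.

Lemma normr_prodfun (f g : R -> R) (p : plane R) : (forall x, `|f x| <= 1) ->
  (forall x, `|g x| <= 1) -> `|f p.1 * g p.2| <= 1.
Proof. by move=> f1 g1; rewrite normrM -[1]mulr1 ler_pM. Qed.

Lemma L2_prodfun (f g : R -> R) : continuous f -> continuous g ->
  (forall x, `|f x| <= 1) -> (forall x, `|g x| <= 1) ->
  L2 (@area R) square (fun p => f p.1 * g p.2).
Proof.
move=> cf cg f1 g1; apply: (@L2_bounded _ _ _ _ _ measurable_square _ 1).
- exact: area_square_fin.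
- by apply: measurable_funTS; exact: measurable_prodfun.
- by move=> p _; exact: normr_prodfun.
Qed.

Lemma L2_cosn2 m n : L2 (@area R) square (cosn2 m n).
Proof. by apply: L2_prodfun => *; rewrite ?normr_cosn//; exact: continuous_cosn. Qed.

Lemma L2_sincosn m n : L2 (@area R) square (sincosn m n).
Proof.
by apply: L2_prodfun => *; rewrite ?normr_cosn ?normr_sinn//;
  [exact: continuous_sinn|exact: continuous_cosn].
Qed.

Lemma ip_prodfun (f1 f2 g1 g2 : R -> R) :
  continuous f1 -> continuous f2 -> continuous g1 -> continuous g2 ->
  (forall x, `|f1 x| <= 1) -> (forall x, `|f2 x| <= 1) ->
  (forall x, `|g1 x| <= 1) -> (forall x, `|g2 x| <= 1) ->
  ip (@area R) square (fun p => f1 p.1 * f2 p.2) (fun p => g1 p.1 * g2 p.2) =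
  (\int[lebesgue_measure]_(x in `[0, 1]) (f1 x * g1 x)) *
  (\int[lebesgue_measure]_(x in `[0, 1]) (f2 x * g2 x)).
Proof.
move=> cf1 cf2 cg1 cg2 f1b f2b g1b g2b; rewrite -Rintegral_prod.
- by apply: eq_Rintegral => p _; ring.
- exact: measurable_itvR.
- exact: measurable_itvR.
- have := L2M measurable_square (L2_prodfun cf1 cf2 f1b f2b) (L2_prodfun cg1 cg2 g1b g2b).
  by apply: eq_integrable; [exact: measurable_square|move=> p _ /=; congr EFin; ring].
- apply: continuous_compact_integrable; first exact: segment_compact.
  by apply: continuous_subspaceT => x; apply: cvgM; [exact: cf2|exact: cg2].
- apply: continuous_compact_integrable; first exact: segment_compact.
  by apply: continuous_subspaceT => x; apply: cvgM; [exact: cf1|exact: cg1].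
Qed.

Lemma ip_cosn2 m n k l : ip (@area R) square (cosn2 m n) (cosn2 k l) =
  ((m, n) == (k, l))%:R * (cosw m * cosw n).
Proof.
rewrite ip_prodfun; try exact: continuous_cosn; try exact: normr_cosn.
rewrite !Rintegral_cosn_mul xpair_eqE.
by rewrite -mulnb natrM; ring.
Qed.

Lemma ip_sincosn m n k l : ip (@area R) square (sincosn m n) (sincosn k l) =
  ((m, n) == (k, l))%:R * ((m != 0%N)%:R / 2 * cosw n).
Proof.
rewrite ip_prodfun; try exact: continuous_cosn; try exact: normr_cosn;
  try exact: continuous_sinn; try exact: normr_sinn.
rewrite Rintegral_cosn_mul Rintegral_sinn_mul xpair_eqE.
by rewrite -mulnb natrM; ring.
Qed.

End Cosines.

(** * Bounded polynomial approximation of step functions *)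

Section StepPolynomials.
Context {R : realType}.

Lemma bernoulli (a : R) n : -1 <= a -> 1 + n%:R * a <= (1 + a) ^+ n.
Proof.
move=> a1; elim: n => [|n IH]; first by rewrite mul0r addr0 expr0.
rewrite exprS; apply: (@le_trans _ _ ((1 + a) * (1 + n%:R * a))).
  rewrite -natr1 -subr_ge0 (_ : _ - _ = n%:R * a ^+ 2); last by ring.
  by rewrite mulr_ge0// sqr_ge0.
by rewrite ler_wpM2l//; lra.
Qed.

(** With r = s^2 and 1 / s = 1 + d, Bernoulli's inequality bounds n s^n by 1 / d, and the other
    factor s^n tends to 0. *)
Lemma cvg_natr_expr (r : R) : 0 <= r < 1 -> (fun n => n%:R * r ^+ n) @ \oo --> (0 : R).
Proof.
move=> /andP[]; rewrite le_eqVlt => /predU1P[<- _|r0 r1].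
  rewrite (_ : (fun n => _) = cst 0); first exact: cvg_cst.
  by apply/funext => -[|n]; rewrite ?mul0r// expr0n mulr0.
pose s := Num.sqrt r; have s0 : 0 < s by rewrite sqrtr_gt0.
have s1 : s < 1 by rewrite -sqrtr1 ltr_sqrt.
pose d := s^-1 - 1; have d0 : 0 < d by rewrite subr_gt0 invf_gt1.
have cvgs : (fun n => d^-1 * s ^+ n) @ \oo --> (0 : R).
  by apply: cvg_geometric; rewrite gtr0_norm.
apply: (squeeze_cvgr (f := cst 0) _ _ cvgs); last exact: cvg_cst.
apply: nearW => n /=.
have r0' := ltW r0; rewrite mulr_ge0 ?exprn_ge0//=.
have -> : r = s * s by rewrite -expr2 sqr_sqrtr// ltW.
rewrite exprMn mulrA ler_pM2r ?exprn_gt0// -[leRHS]mul1r ler_pdivlMr//.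
have d1 : -1 <= d by rewrite (le_trans _ (ltW d0))// lerN10.
have := bernoulli n d1; rewrite (_ : 1 + d = s^-1) ?exprVn; last by rewrite /d addrC subrK.
move=> h.
rewrite mulrAC -ler_pdivlMr ?exprn_gt0// mul1r (le_trans _ h)//.
by rewrite lerDr.
Qed.

(** Let M = N 2^N, so that M y^N = N (2 y)^N. For y < 1/2 this tends to 0, and Bernoulli bounds the
    power below by 1 - M y^N. For y >= 1/2 it is at least N, so (1 + y^N)^M >= N + 1, while (1 -
    y^N)^M (1 + y^N)^M <= 1. The factor N in the exponent settles the case y = 1/2. *)
Lemma cvg_step (y : R) : 0 <= y <= 1 ->
  (fun N => (1 - y ^+ N) ^+ (N * 2 ^ N)) @ \oo --> ((y < 2^-1)%R%:R : R).
Proof.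
move=> /andP[y0 y1].
have yN N : 0 <= y ^+ N <= 1 by rewrite exprn_ge0//= exprn_ile1.
have [y2|y2] := ltP y 2^-1.
  have cvg1 : (fun N => 1 - N%:R * (2 * y) ^+ N) @ \oo --> (1 : R).
    rewrite -[X in _ --> X]subr0; apply: cvgB; first exact: cvg_cst.
    by apply: cvg_natr_expr; apply/andP; split; lra.
  apply: (squeeze_cvgr (h := cst 1) _ cvg1); last exact: cvg_cst.
  apply: nearW => N /=.
  have /andP[a0 a1] := yN N; apply/andP; split; last by rewrite exprn_ile1//; lra.
  have := @bernoulli (- y ^+ N) (N * 2 ^ N); rewrite lerN2 => /(_ a1).
  by rewrite natrM natrX mulrN -mulrA -exprMn.
have cvgh : (fun N => (N.+1%:R : R)^-1) @ \oo --> (0 : R) by exact: cvg_harmonic.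
apply: (squeeze_cvgr (f := cst 0) _ _ cvgh); last exact: cvg_cst.
apply: nearW => N /=.
have /andP[a0 a1] := yN N; rewrite exprn_ge0 ?subr_ge0//=.
have N1 : (N.+1%:R : R) <= (1 + y ^+ N) ^+ (N * 2 ^ N).
  apply: (le_trans _ (bernoulli _ _)); last by rewrite (le_trans _ a0)// lerN10.
  rewrite -nat1r lerD2l natrM natrX -mulrA -exprMn ler_peMr// exprn_ege1//.
  by lra.
rewrite -[leRHS]mul1r ler_pdivlMr//.
apply: (@le_trans _ _ ((1 - y ^+ N) ^+ (N * 2 ^ N) * (1 + y ^+ N) ^+ (N * 2 ^ N))).
  by rewrite ler_wpM2l// exprn_ge0// subr_ge0.
rewrite -exprMn exprn_ile1//; first by rewrite mulr_ge0//; lra.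
by nra.
Qed.

(** The substitution y = 1/2 + (x - c)/4 maps [-1, 1] into [0, 1] for every c in [-1, 1], and sends
    c to the jump 1/2. *)
Definition step_poly (c : R) N : {poly R} :=
  (1 - ((2^-1 - c / 4)%:P + 4^-1 *: 'X) ^+ N) ^+ (N * 2 ^ N).

Lemma step_polyE c N x :
  (step_poly c N).[x] = (1 - (2^-1 + (x - c) / 4) ^+ N) ^+ (N * 2 ^ N).
Proof.
rewrite /step_poly !hornerE; do 4 congr (_ _ _).
by ring.
Qed.

Lemma step_poly_cvg c x : -1 <= c <= 1 -> -1 <= x <= 1 ->
  (fun N => (step_poly c N).[x]) @ \oo --> ((x < c)%R%:R : R).
Proof.
move=> c1 x1; under eq_fun do rewrite step_polyE.
have -> : (x < c) = (2^-1 + (x - c) / 4 < 2^-1) by apply/idP/idP => ?; lra.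
by apply: cvg_step; lra.
Qed.

Lemma normr_step_poly c x N : -1 <= c <= 1 -> -1 <= x <= 1 ->
  `|(step_poly c N).[x]| <= 1.
Proof.
move=> c1 x1; rewrite step_polyE normrX exprn_ile1//.
set y := 2^-1 + _; have /andP[y0 y1] : 0 <= y <= 1 by rewrite /y; lra.
have : 0 <= y ^+ N <= 1 by rewrite exprn_ge0//= exprn_ile1.
by move=> ?; rewrite ger0_norm; lra.
Qed.

End StepPolynomials.

Section CosineTotality.
Context {R : realType}.

Lemma cosn0 (x : R) : cosn 0 x = 1.
Proof. by rewrite /cosn !mul0r cos0. Qed.

(* Indicators of half-lines are bounded limits on [0, 1] of polynomials in
   cos (pi x), because cos (pi x) is decreasing. *)
Lemma half_line_polynomials (s : R) : exists q : nat -> {poly R},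
  (forall N x, 0 <= x <= 1 -> `|(q N).[cosn 1 x]| <= 1) /\
  (forall x, 0 <= x <= 1 ->
     (fun N => (q N).[cosn 1 x]) @ \oo --> ((s < x)%R%:R : R)).
Proof.
have cos11 (x : R) : -1 <= cosn 1 x <= 1 by rewrite cos_geN1 cos_le1.
have [s0|s0] := ltP s 0.
  exists (fun=> 1%:P); split => [N x _|x /andP[x0 _]]; first by rewrite hornerC normr1.
  under eq_fun do rewrite hornerC.
  by rewrite (lt_le_trans s0 x0); exact: cvg_cst.
have [s1|s1] := ltP 1 s.
  exists (fun=> 0); split => [N x _|x /andP[_ x1]]; first by rewrite horner0 normr0.
  under eq_fun do rewrite horner0.
  by rewrite ltNge (le_trans x1 (ltW s1)); exact: cvg_cst.
exists (step_poly (cosn 1 s)); split => [N x _|x x01].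
  exact: normr_step_poly.
have -> : (s < x) = (cosn 1 x < cosn 1 s).
  have mem (y : R) : 0 <= y <= 1 -> pi * y \in `[0, pi].
    have := @pi_ge0 R => pi0 /andP[y0 y1].
    by rewrite in_itv/= mulr_ge0//= ler_piMr.
  by rewrite /cosn !mul1r ltr_cos ?ltr_pM2l ?pi_gt0 ?mem// s0.
exact: step_poly_cvg.
Qed.

Variable v : plane R -> R.
Hypothesis Lv : L2 (@area R) square v.
Hypothesis v0 : forall m n, ip (@area R) square v (cosn2 m n) = 0.

Let iv : (@area R).-integrable square (EFin \o v).
Proof. by apply: L2_integrable Lv; [exact: measurable_square|exact: area_square_fin]. Qed.

Let mv : measurable_fun square v. Proof. by case: Lv. Qed.

(** The bounded multipliers G for which v G stays orthogonal to all cosines. By the product formula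
    they are stable under multiplication by cos (pi x) and by cos (pi y), hence contain the
    polynomials in both. *)
Let orthogonal (G : plane R -> R) :=
  [/\ measurable_fun setT G, exists M, forall p, `|G p| <= M &
      forall m n, \int[@area R]_(p in square) (v p * (cosn2 m n p * G p)) = 0].

Let integrable_v (G : plane R -> R) (M : R) : measurable_fun setT G ->
  (forall p, square p -> `|G p| <= M) ->
  (@area R).-integrable square (EFin \o (fun p => v p * G p)).
Proof.
move=> mG GM; apply: (integrableM_bounded measurable_square iv _ GM).
exact: measurable_funTS.
Qed.

Let measurable_cosn2 m n : measurable_fun setT (@cosn2 R m n).
Proof. by apply: measurable_prodfun; exact: continuous_cosn. Qed.

Let normr_cosn2 m n (p : plane R) : `|cosn2 m n p| <= 1.
Proof. by apply: normr_prodfun => x; exact: normr_cosn. Qed.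

Let integrable_cosn2 m n G : orthogonal G ->
  (@area R).-integrable square (EFin \o (fun p => v p * (cosn2 m n p * G p))).
Proof.
move=> [mG [M GM] _]; apply: (@integrable_v _ M); first exact: measurable_funM.
by move=> p _; rewrite normrM -[M]mul1r ler_pM.
Qed.

Let orthogonal1 : orthogonal (cst 1).
Proof.
split; first exact: measurable_cst; first by exists 1 => p; rewrite normr1.
by move=> m n; rewrite -(v0 m n); apply: eq_Rintegral => p _; rewrite mulr1.
Qed.

Let orthogonalD c G H : orthogonal G -> orthogonal H ->
  orthogonal (fun p => c * G p + H p).
Proof.
move=> oG oH; have [mG [M GM] G0] := oG; have [mH [N HN] H0] := oH; split.
- by apply: measurable_funD => //; exact: measurable_funM.
- exists (`|c| * M + N) => p; rewrite (le_trans (ler_normD _ _))// lerD//.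
  by rewrite normrM ler_wpM2l.
- move=> m n.
  have igG := integrable_cosn2 m n oG; have igH := integrable_cosn2 m n oH.
  have := RintegralD measurable_square (integrableZl measurable_square c igG) igH.
  rewrite /= (RintegralZl _ measurable_square igG) G0 H0 mulr0 addr0 => <-.
  by apply: eq_Rintegral => p _; ring.
Qed.

Let orthogonal_cos1 G : orthogonal G -> orthogonal (fun p => cosn 1 p.1 * G p).
Proof.
move=> oG; have [mG [M GM] G0] := oG; split.
- by apply: measurable_funM => //; apply: measurable_fun1; exact: continuous_cosn.
- by exists M => p; rewrite normrM -[M]mul1r ler_pM// normr_cosn.
- move=> [|m] n.
    rewrite -[RHS](G0 1%N n); apply: eq_Rintegral => p _.
    by rewrite /cosn2 cosn0; ring.
  have igm k := integrable_cosn2 k n oG.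
  have ig k := integrableZl measurable_square 2^-1 (igm k).
  have := RintegralD measurable_square (ig m) (ig m.+2).
  rewrite /= !(RintegralZl _ measurable_square (igm _)) !G0 mulr0 addr0 => <-.
  apply: eq_Rintegral => p _; rewrite /cosn2.
  have := @cosn_mul R m.+1 1 p.1 isT; rewrite subSS subn0 addn1 => E.
  rewrite (_ : _ * _ = v p * (cosn m.+1 p.1 * cosn 1 p.1) * cosn n p.2 * G p).
    by rewrite E; ring.
  by ring.
Qed.

Let orthogonal_cos2 G : orthogonal G -> orthogonal (fun p => cosn 1 p.2 * G p).
Proof.
move=> oG; have [mG [M GM] G0] := oG; split.
- by apply: measurable_funM => //; apply: measurable_fun2; exact: continuous_cosn.
- by exists M => p; rewrite normrM -[M]mul1r ler_pM// normr_cosn.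
- move=> m [|n].
    rewrite -[RHS](G0 m 1%N); apply: eq_Rintegral => p _.
    by rewrite /cosn2 cosn0; ring.
  have igm k := integrable_cosn2 m k oG.
  have ig k := integrableZl measurable_square 2^-1 (igm k).
  have := RintegralD measurable_square (ig n) (ig n.+2).
  rewrite /= !(RintegralZl _ measurable_square (igm _)) !G0 mulr0 addr0 => <-.
  apply: eq_Rintegral => p _; rewrite /cosn2.
  have := @cosn_mul R n.+1 1 p.2 isT; rewrite subSS subn0 addn1 => E.
  rewrite (_ : _ * _ = v p * (cosn n.+1 p.2 * cosn 1 p.2) * cosn m p.1 * G p).
    by rewrite E; ring.
  by ring.
Qed.

Let orthogonal_poly (t : plane R -> R) (q : {poly R}) :
  (forall G, orthogonal G -> orthogonal (fun p => t p * G p)) ->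
  forall G, orthogonal G -> orthogonal (fun p => q.[t p] * G p).
Proof.
move=> ot; elim/poly_ind: q => [|q c IH] G oG.
  have := orthogonalD (-1) oG oG; congr orthogonal.
  by apply/funext => p; rewrite horner0 mul0r mulN1r addNr.
have := orthogonalD c oG (IH _ (ot _ oG)); congr orthogonal.
by apply/funext => p; rewrite hornerMXaddC mulrDl mulrA addrC.
Qed.

Let polys0 (q q' : {poly R}) :
  \int[@area R]_(p in square) (v p * (q.[cosn 1 p.1] * q'.[cosn 1 p.2])) = 0.
Proof.
have [_ _ h] := orthogonal_poly q orthogonal_cos1
  (orthogonal_poly q' orthogonal_cos2 orthogonal1).
rewrite -(h 0%N 0%N); apply: eq_Rintegral => p _.
by rewrite /cosn2 !cosn0 !mul1r mulr1.
Qed.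

Let measurable_horner (q : {poly R}) (t : plane R -> R) :
  measurable_fun setT t -> measurable_fun setT (fun p => q.[t p]).
Proof.
move=> mt; elim/poly_ind: q => [|q c IH].
  by under eq_fun do rewrite horner0; exact: measurable_cst.
under eq_fun do rewrite !hornerE.
by apply: measurable_funD; [exact: measurable_funM|exact: measurable_cst].
Qed.

(** Dominated convergence in [polys0], along polynomials that converge to the indicators of the two
    half-lines. *)
Let quadrant (s t : R) :
  \int[@area R]_(p in square `&` fst @^-1` `]s, +oo[ `&` snd @^-1` `]t, +oo[) v p = 0.
Proof.
have [q [q1 qcvg]] := half_line_polynomials s.
have [q' [q'1 q'cvg]] := half_line_polynomials t.
rewrite -setIA Rintegral_mkcondr.
have [] := @Rintegral_cvg _ _ _ (@area R) square measurable_square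
  (fun N p => v p * ((q N).[cosn 1 p.1] * (q' N).[cosn 1 p.2]))
  (v \_ (fst @^-1` `]s, +oo[ `&` snd @^-1` `]t, +oo[)) (fun p => `|v p|).
- move=> N; apply: measurable_funM => //; apply: measurable_funTS.
  apply: measurable_funM; apply: measurable_horner.
    by apply: measurable_fun1; exact: continuous_cosn.
  by apply: measurable_fun2; exact: continuous_cosn.
- move=> [x y] [/= x01 y01].
  have -> : (v \_ (fst @^-1` `]s, +oo[ `&` snd @^-1` `]t, +oo[)) (x, y) =
      v (x, y) * ((s < x)%R%:R * (t < y)%R%:R).
    rewrite patchE -natrM mulnb.
    have -> : ((x, y) \in fst @^-1` `]s, +oo[ `&` snd @^-1` `]t, +oo[) =
        (s < x) && (t < y).
      by apply/idP/idP => [/set_mem[]|h]; [|apply/mem_set; move: h];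
        rewrite /= !in_itv/= !andbT; [move=> -> ->|case/andP].
    by case: (_ && _); rewrite ?mulr1 ?mulr0.
  apply: cvgM; first exact: cvg_cst.
  by apply: cvgM; [apply: qcvg|apply: q'cvg]; move: x01 y01; rewrite !in_itv.
- exact: (integrable_norm iv).
- move=> N [x y] [/= x01 y01]; rewrite normrM -[leRHS]mulr1 ler_wpM2l// normrM.
  rewrite -[leRHS]mulr1 ler_pM//; [apply: q1|apply: q'1];
    by move: x01 y01; rewrite !in_itv.
move=> _; under eq_fun do rewrite polys0.
move/(cvg_lim (@Rhausdorff R)) => <-.
by apply: (cvg_lim (@Rhausdorff R)); exact: cvg_cst.
Qed.

Let G := @RGenOInfty.G R.

Let GI : setI_closed G.
Proof.
move=> _ _ [x ->] [y ->]; exists (Num.max x y).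
apply/seteqP; split => z /=; rewrite !in_itv/= !andbT gt_max.
  by move=> [-> ->].
by move=> /andP[].
Qed.

Let GE : @measurable _ (measurableTypeR R) = <<s G >>.
Proof. exact: RGenOInfty.measurableE. Qed.

Let measurable_preim1 (A : set (measurableTypeR R)) :
  measurable A -> measurable ((fst : plane R -> _) @^-1` A).
Proof. by move=> mA; rewrite -[_ @^-1` _]setTI; exact: measurable_fst. Qed.

Let measurable_preim2 (A : set (measurableTypeR R)) :
  measurable A -> measurable ((snd : plane R -> _) @^-1` A).
Proof. by move=> mA; rewrite -[_ @^-1` _]setTI; exact: measurable_snd. Qed.

Let integrable_sub (A : set (plane R)) : measurable A ->
  (@area R).-integrable (square `&` A) (EFin \o v).
Proof.
move=> mA; apply: (integrableS measurable_square _ (@subIsetl _ _ _) iv).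
by apply: measurableI => //; exact: measurable_square.
Qed.

Let strip (t : R) A : measurable A ->
  \int[@area R]_(p in square `&` snd @^-1` `]t, +oo[ `&` fst @^-1` A) v p = 0.
Proof.
have mray : measurable (`]t, +oo[%classic : set (measurableTypeR R)).
  exact: measurable_itvR.
move: A; apply: (@dynkin_Rintegral0 _ _ _ (@area R) _ _ _ _ fst v G) => //.
- apply: measurableI; [exact: measurable_square|exact: measurable_preim2].
- by apply: integrable_sub; exact: measurable_preim2.
(* A ray starting at -1 contains [0, 1], so this quadrant cuts the whole strip out of the square. *)
- rewrite -(quadrant (-1) t); congr (Rintegral _ _ _).
  rewrite setIAC; apply/seteqP; split=> [[x y] [[[x01 y01] yt]]|p []//].
  by split => //=; move: x01; rewrite /= !in_itv/= andbT => /andP[x0 _]; lra.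
- by move=> _ [s ->]; rewrite setIAC.
Qed.

Let rectangle A B : measurable A -> measurable B ->
  \int[@area R]_(p in square `&` fst @^-1` A `&` snd @^-1` B) v p = 0.
Proof.
move=> mA; move: B; apply: (@dynkin_Rintegral0 _ _ _ (@area R) _ _ _ _ snd v G) => //.
- apply: measurableI; [exact: measurable_square|exact: measurable_preim1].
- by apply: integrable_sub; exact: measurable_preim1.
- rewrite -(strip (-1) mA); congr (Rintegral _ _ _).
  rewrite setIAC; apply/seteqP; split=> [[x y] [[x01 y01] xA]|p []//].
  split; first by split.
  by move: y01; rewrite /= !in_itv/= andbT => /andP[x0 _]; lra.
- by move=> _ [s ->]; rewrite setIAC; exact: strip.
Qed.

(** Vanishing integrals pass from quadrants to rectangles and from rectangles to all measurable
    sets, so v is 0 almost everywhere. *)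
Lemma cosn2_total : ip (@area R) square v v = 0.
Proof.
have v_ae0 : ae_eq (@area R) square (EFin \o v) (cst 0%E).
  apply: Rintegral0_ae; [exact: measurable_square|exact: iv|].
  move=> B mB; rewrite -[B]preimage_id.
  apply: (@dynkin_Rintegral0 _ _ _ (@area R) square measurable_square _ (plane R) id v
    [set A `*` B | A in measurable & B in measurable]) => //.
  - exact: measurable_prod_measurableType.
  - move=> _ _ [A mA [A' mA' <-]] [C mC [C' mC' <-]]; rewrite -setXI.
    by exists (A `&` C); [exact: measurableI|exists (A' `&` C') => //; exact: measurableI].
  - rewrite -(rectangle measurableT measurableT); congr (Rintegral _ _ _).
    by rewrite !preimage_setT !setIT.
  - move=> _ [A mA [A' mA' <-]]; rewrite -(rectangle mA mA') -setIA.
    by congr (Rintegral _ _ _).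
rewrite /ip /Rintegral (_ : (\int[_]_(_ in _) _)%E = 0%E)//.
rewrite -[RHS](integral0 (@area R) square); apply: ae_eq_integral => //.
- exact: measurable_square.
- by apply/measurable_EFinP; exact: measurable_funM.
- by apply: filterS v_ae0 => p h /h /= [] ->; rewrite mul0r.
Qed.

End CosineTotality.

(** * Mass bounded by low frequencies and by energy *)

Section SquareSpectral.
Context {R : realType}.

Lemma nat_pair_enumeration : exists f : nat -> nat * nat,
  injective f /\ forall p, exists k, f k = p.
Proof.
have : ([set: nat] #= [set: nat * nat])%card by rewrite card_eq_sym; exact: card_nat2.
move=> /card_set_bijP[f [_ finj fsurj]]; exists f; split.
  by move=> i j; apply: finj; rewrite inE.
by move=> p; have [k _ kp] := fsurj p I; exists k.
Qed.

(** Parseval for U, split by frequency. For m >= N a coefficient of U is at most 1 / (pi N) times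
    one of G in absolute value, so Bessel for G bounds this part by |G|^2 / (pi N)^2. By the
    symmetry hypothesis the part n >= N obeys the same bound, whence the factor 2. *)
Lemma square_spectral (U G : plane R -> R) (N : nat) : (0 < N)%N ->
  L2 (@area R) square U -> L2 (@area R) square G ->
  (forall m n, (m%:R * pi * ip (@area R) square U (cosn2 m n)) ^+ 2 =
               ip (@area R) square G (sincosn m n) ^+ 2) ->
  (forall m n, ip (@area R) square U (cosn2 m n) ^+ 2 =
               ip (@area R) square U (cosn2 n m) ^+ 2) ->
  ip (@area R) square U U <=
  \sum_(m < N) \sum_(n < N)
     ip (@area R) square U (cosn2 m n) ^+ 2 / (cosw m * cosw n) +
  2 / (pi * N%:R) ^+ 2 * ip (@area R) square G G.
Proof.
move=> N0 LU LG UG Usym; have [f [finj fsurj]] := nat_pair_enumeration.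
pose a m n := ip (@area R) square U (cosn2 m n) ^+ 2 / (cosw m * cosw n).
have w0 m n : 0 < cosw m * cosw n :> R by rewrite mulr_gt0 ?cosw_gt0.
have a0 m n : 0 <= a m n by rewrite divr_ge0 ?sqr_ge0// ltW.
have asym m n : a m n = a n m by rewrite /a Usym [cosw m * _]mulrC.
have npi0 : 0 < pi * N%:R :> R by rewrite mulr_gt0 ?pi_gt0 ?ltr0n.
(* Stated for any injective indexing [g], because it is applied to the enumeration [f] and to [f]
   with its components exchanged. *)
have bound K (g : nat -> nat * nat) : injective g ->
    \sum_(k < K | (N <= (g k).1)%N) a (g k).1 (g k).2 <=
    (pi * N%:R) ^- 2 * ip (@area R) square G G.
  move=> ginj; rewrite mulrC ler_pdivlMr ?exprn_gt0//.
  pose e k : plane R -> R := sincosn (g k).1 (g k).2.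
  have := @L2_bessel _ _ _ (@area R) square measurable_square e
    (fun k => cosw (g k).1 * cosw (g k).2) (fun k => L2_sincosn _ _)
    (fun k => w0 _ _) _ G K _ LG.
  move=> bes; apply: (le_trans _ (bes _ _)).
  - rewrite mulr_suml big_mkcond/=; apply: ler_sum => k _.
    rewrite -UG; case: ifP => [Ng|_]; last by rewrite divr_ge0 ?sqr_ge0// ltW.
    rewrite /a mulrAC ler_pM2r ?invr_gt0// [leRHS]exprMn [leRHS]mulrC.
    rewrite ler_wpM2l ?sqr_ge0//.
    rewrite [pi * _]mulrC lerXn2r ?nnegrE ?mulr_ge0 ?pi_ge0//.
    by rewrite ler_wpM2r ?pi_ge0// ler_nat.
  - move=> i j ij; rewrite ip_sincosn -!surjective_pairing.
    by rewrite (negbTE (contra_neq (@ginj i j) ij)) mul0r.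
  - move=> k; rewrite ip_sincosn eqxx mul1r ler_wpM2r ?(ltW (cosw_gt0 _))// /cosw.
    by case: eqP => _ /=; rewrite ?mulr0n ?mulr1n ?mul0r ?mul1r ?ler01 ?lexx.
have swap_inj : injective (fun k => ((f k).2, (f k).1)).
  by move=> i j [e2 e1]; apply: finj; rewrite [f i]surjective_pairing e1 e2 -surjective_pairing.
have box K : \sum_(k < K | ((f k).1 < N)%N && ((f k).2 < N)%N) a (f k).1 (f k).2 <=
    \sum_(m < N) \sum_(n < N) a m n.
  rewrite pair_big/=.
  have -> : \sum_(k < K | ((f k).1 < N)%N && ((f k).2 < N)%N) a (f k).1 (f k).2 =
      \sum_(p : 'I_N * 'I_N) \sum_(k < K | f k == (p.1 : nat, p.2 : nat)) a p.1 p.2.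
    rewrite (exchange_big_dep (fun k : 'I_K => ((f k).1 < N)%N && ((f k).2 < N)%N))/=.
      apply: eq_bigr => k /andP[k1 k2].
      rewrite (bigD1 (Ordinal k1, Ordinal k2))/= -?surjective_pairing//.
      rewrite big1 ?addr0// => -[p1 p2] /= /andP[/eqP fk /negP[]].
      by rewrite -pair_eqE/= -!val_eqE/= fk/= !eqxx.
    by move=> [p1 p2] k _ /eqP/= ->/=; rewrite !ltn_ord.
  apply: ler_sum => -[p1 p2] _ /=; have [k fk] := fsurj (p1 : nat, p2 : nat).
  have [kK|kK] := ltnP k K.
    rewrite (bigD1 (Ordinal kK)) ?fk//= big1 ?addr0// => j /andP[/eqP fj /negP[]].
    by rewrite -val_eqE/=; apply/eqP/finj; rewrite fj fk.
  rewrite big1// => j /eqP fj; have jk : j = k :> nat by apply: finj; rewrite fj fk.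
  by move: (ltn_ord j); rewrite jk ltnNge kK.
apply/ler_addgt0Pr => eps eps0.
have orth i j : i != j ->
    ip (@area R) square (cosn2 (f i).1 (f i).2) (cosn2 (f j).1 (f j).2) = 0.
  move=> ij; rewrite ip_cosn2 -!surjective_pairing.
  by rewrite (negbTE (contra_neq (@finj i j) ij)) mul0r.
have norm k : ip (@area R) square (cosn2 (f k).1 (f k).2) (cosn2 (f k).1 (f k).2) =
    cosw (f k).1 * cosw (f k).2 by rewrite ip_cosn2 eqxx mul1r.
have total v : L2 (@area R) square v ->
    (forall k, ip (@area R) square v (cosn2 (f k).1 (f k).2) = 0) ->
    ip (@area R) square v v = 0.
  move=> Lv v0; apply: cosn2_total => // m n.
  by have [k fk] := fsurj (m, n); have := v0 k; rewrite fk.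
have [K KP] := L2_parseval measurable_square (fun k => L2_cosn2 _ _)
  (fun k => w0 _ _) orth norm total LU eps0.
rewrite (le_trans KP)// lerD2r.
rewrite (bigID (fun k : 'I_K => ((f k).1 < N)%N && ((f k).2 < N)%N))/= lerD//.
  exact: box.
have -> : 2 / (pi * N%:R) ^+ 2 * ip (@area R) square G G =
    (pi * N%:R) ^- 2 * ip (@area R) square G G +
    (pi * N%:R) ^- 2 * ip (@area R) square G G by ring.
apply: (le_trans _ (lerD (bound K f finj) (bound K _ swap_inj))) => /=.
rewrite [X in X <= _]big_mkcond [X in _ <= X + _]big_mkcond [X in _ <= _ + X]big_mkcond.
rewrite -big_split/=; apply: ler_sum => k _.
rewrite [a (f k).2 _]asym negb_and -!leqNgt -/(a _ _).
have := a0 (f k).1 (f k).2.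
by case: (N <= _)%N; case: (N <= _)%N => /= h; rewrite ?addr0 ?add0r// lerDl.
Qed.

End SquareSpectral.

(** * Affine geometry of triangles *)

Section AreaScaling.
Context {R : realType}.
Local Notation leb := (@lebesgue_measure R).
Local Notation Rm := (measurableTypeR R).

Lemma measurable_affineR (al ga : R) :
  measurable_fun [set: Rm] (fun x : Rm => (al * x + ga : Rm)).
Proof.
apply: (@continuous_measurable_fun R (fun x => al * x + ga)) => x.
by apply: cvgD; [apply: cvgM; [exact: cvg_cst|exact: cvg_id]|exact: cvg_cst].
Qed.

(** |al| times the image measure agrees with Lebesgue measure on half-open intervals, so both
    coincide. For al < 0 the preimage of such an interval is closed at the other end, hence two
    cases. *)
Lemma lebesgue_measure_affine (al ga : R) (B : set Rm) : al != 0 ->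
  measurable B ->
  leb ((fun x : Rm => (al * x + ga : Rm)) @^-1` B) = (`|al|^-1%:E * leb B)%E.
Proof.
move=> al0 mB; have al_gt0 : 0 < `|al| by rewrite normr_gt0.
pose phi (x : Rm) : Rm := al * x + ga.
have mphi : measurable_fun setT phi by exact: measurable_affineR.
pose m : {measure set Rm -> \bar R} := mscale (NngNum (normr_ge0 al)) (pushforward leb phi).
have mE : leb B = m mphi B.
  apply: (@lebesgue_measure_unique R (m mphi)) => // _ [[x y]] _ <- /=.
  rewrite /m /mscale/= /pushforward/=.
  have [xy|yx] := ltP x y; last first.
    by rewrite set_itv_ge ?preimage_set0 ?measure0 ?mule0// bnd_simp -leNgt.
  rewrite lebesgue_measure_itv/= lte_fin xy.
  move: al0; rewrite neq_lt => /orP[al0|al0].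
    rewrite (_ : _ @^-1` _ = `[(y - ga) / al, (x - ga) / al[%classic); last first.
      apply/seteqP; split=> z; rewrite /phi /= !in_itv/= => /andP[h1 h2].
        by rewrite ler_ndivrMr// ltr_ndivlMr//; apply/andP; split; nra.
      by move: h1 h2; rewrite ler_ndivrMr// ltr_ndivlMr// => h1 h2; apply/andP; split; nra.
    rewrite lebesgue_measure_itv/= lte_fin ltr_nM2r ?invr_lt0// ltrD2r xy.
    by rewrite -!EFinD -EFinM ltr0_norm//; congr EFin; field; rewrite lt_eqF.
  rewrite (_ : _ @^-1` _ = `](x - ga) / al, (y - ga) / al]%classic); last first.
    apply/seteqP; split=> z; rewrite /phi /= !in_itv/= => /andP[h1 h2].
      by rewrite ltr_pdivrMr// ler_pdivlMr//; apply/andP; split; nra.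
    by move: h1 h2; rewrite ltr_pdivrMr// ler_pdivlMr// => h1 h2; apply/andP; split; nra.
  rewrite lebesgue_measure_itv/= lte_fin ltr_pM2r ?invr_gt0// ltrD2r xy.
  by rewrite -!EFinD -EFinM gtr0_norm//; congr EFin; field; rewrite gt_eqF.
rewrite mE /m /mscale/= muleA -EFinM mulVf ?gt_eqF// mul1e.
by [].
Qed.

(** Preimages are measured, so c is the inverse of |det Psi| for an affine map. All maps used are
    products of coordinate exchanges and shears. *)
Definition scales_area (Psi : plane R -> plane R) (c : R) : Prop :=
  measurable_fun setT Psi /\
  forall A, measurable A -> @area R (Psi @^-1` A) = (c%:E * @area R A)%E.

Lemma scales_area_swap : scales_area (fun p => (p.2, p.1)) 1.
Proof.
have mswap : measurable_fun [set: plane R] (fun p => (p.2, p.1) : plane R).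
  by apply: measurable_fun_pair; [exact: measurable_snd|exact: measurable_fst].
split => // A mA; rewrite mul1e.
have -> : @area R A = (leb \x^ leb)%E A.
  rewrite /area; apply: product_measure_unique => // X Y mX mY.
  exact: product_measure2E.
rewrite /area /product_measure1 /product_measure2; apply: eq_integral => x _ /=.
congr (leb _); apply/seteqP; split => y; rewrite /xsection /ysection /=;
  by move=> /set_mem h; apply/mem_set.
Qed.

Lemma scales_area_comp Psi Psi' c c' : scales_area Psi c -> scales_area Psi' c' ->
  scales_area (Psi \o Psi') (c * c').
Proof.
move=> [mP cP] [mP' cP']; split; first exact: measurableT_comp.
move=> A mA; rewrite comp_preimage cP'; last by rewrite -[_ @^-1` _]setTI; exact: mP.
by rewrite cP// muleA -EFinM mulrC.
Qed.

Lemma scales_area_shear (al be ga : R) : al != 0 ->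
  scales_area (fun p => (al * p.1 + be * p.2 + ga, p.2)) `|al|^-1.
Proof.
move=> al0.
have mP : measurable_fun [set: plane R]
    (fun p => (al * p.1 + be * p.2 + ga, p.2) : plane R).
  by apply: measurable_fun_pair; [exact: measurable_affine|exact: measurable_snd].
have areaE A : measurable A -> @area R A = (leb \x^ leb)%E A.
  move=> mA; rewrite /area; apply: product_measure_unique => // X Y mX mY.
  exact: product_measure2E.
split => // A mA; have mPA : measurable ((fun p : plane R =>
    (al * p.1 + be * p.2 + ga, p.2) : plane R) @^-1` A).
  by rewrite -[_ @^-1` _]setTI; exact: mP.
rewrite !areaE// /product_measure2 -ge0_integralZl//; last first.
  exact: measurable_fun_ysection.
apply: eq_integral => y _ /=.
rewrite -(lebesgue_measure_affine (be * y + ga) al0); last exact: measurable_ysection.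
congr (leb _); apply/seteqP; split => x; rewrite /ysection /= => /set_mem h; apply/mem_set;
  by move: h; rewrite /= addrA.
Qed.

Section ChangeOfVariables.
Variables (Psi : plane R -> plane R) (c : R).
Hypotheses (c_ge0 : 0 <= c) (PsiP : scales_area Psi c).

Lemma ge0_integral_scales_area (f : plane R -> \bar R) : measurable_fun setT f ->
  (forall p, 0 <= f p)%E ->
  (\int[@area R]_p f (Psi p) = c%:E * \int[@area R]_p f p)%E.
Proof.
move=> mf f0; have [mP cP] := PsiP.
have := @ge0_integral_pushforward _ _ _ _ R Psi mP (@area R) setT f measurableT mf.
rewrite preimage_setT => <- //.
rewrite -(ge0_integral_mscale (@area R) measurableT (NngNum c_ge0))//.
by apply: eq_measure_integral => A mA _; exact: cP.
Qed.

Variables (D : set (plane R)) (mD : measurable D).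

Lemma measurable_preim_scales_area : measurable (Psi @^-1` D).
Proof. by have [mP _] := PsiP; rewrite -[_ @^-1` _]setTI; exact: mP. Qed.

Lemma integral_scales_area (f : plane R -> R) :
  (@area R).-integrable D (EFin \o f) ->
  (@area R).-integrable (Psi @^-1` D) (EFin \o (f \o Psi)) /\
  \int[@area R]_(p in Psi @^-1` D) f (Psi p) = c * \int[@area R]_(p in D) f p.
Proof.
move=> intf; have [mP cP] := PsiP.
pose F : plane R -> \bar R := (EFin \o f) \_ D.
have iF : (@area R).-integrable setT F by apply/(integrable_mkcond _ mD).
have mF : measurable_fun setT F by exact: measurable_int iF.
have FPsi : F \o Psi = (EFin \o (f \o Psi)) \_ (Psi @^-1` D).
  apply/funext => p; rewrite /F /= !patchE.
  by have -> : (p \in Psi @^-1` D) = (Psi p \in D)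
    by apply/idP/idP => /set_mem h; apply/mem_set.
have iFP : (@area R).-integrable setT (F \o Psi).
  apply/integrableP; split; first exact: measurableT_comp.
  rewrite (ge0_integral_scales_area (f := fun p => `|F p|%E)) //; last first.
    exact: measurableT_comp.
  have /integrableP[_ Foo] := iF.
  by rewrite lte_mul_pinfty// ?lee_fin.
split; first by apply/(integrable_mkcond _ measurable_preim_scales_area); rewrite -FPsi.
have pos_fin : (\int[@area R]_p F^\+ p \is a fin_num)%E.
  by apply: integrable_fin_num => //; exact: integrable_funepos.
have neg_fin : (\int[@area R]_p F^\- p \is a fin_num)%E.
  by apply: integrable_fin_num => //; exact: integrable_funeneg.
have FE : (\int[@area R]_p F (Psi p) = c%:E * \int[@area R]_p F p)%E.
  rewrite (integralE _ setT (fun p => F (Psi p))) (integralE _ setT F).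
  have -> : ((fun p => F (Psi p))^\+ = (fun p => F^\+ (Psi p)))%E.
    exact: (funepos_comp F Psi).
  have -> : ((fun p => F (Psi p))^\- = (fun p => F^\- (Psi p)))%E.
    exact: (funeneg_comp F Psi).
  rewrite !ge0_integral_scales_area//; last 2 first.
  - exact: measurable_funeneg.
  - exact: measurable_funepos.
  by rewrite [RHS]muleBr// fin_num_adde_defr.
rewrite /Rintegral integral_mkcond [in RHS]integral_mkcond.
have -> : (fun p => (f (Psi p))%:E) \_ (Psi @^-1` D) = fun p => F (Psi p).
  by rewrite -/(F \o Psi) FPsi.
by rewrite FE fineM//; exact: integrable_fin_num.
Qed.

Lemma L2_scales_area (f : plane R -> R) : L2 (@area R) D f ->
  L2 (@area R) (Psi @^-1` D) (f \o Psi).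
Proof.
move=> [mf if2]; have [mP _] := PsiP; split; last first.
  exact: (integral_scales_area (f := fun p => f p ^+ 2) if2).1.
apply: (measurable_comp (F := D)) => //.
- by move=> _ [p Dp <-].
- by apply: measurable_funTS.
Qed.

End ChangeOfVariables.
End AreaScaling.

(** * Barycentric coordinates and unfolding to the unit square *)

Section TriangleGeometry.
Context {R : realType}.
Variables (a b : R).
Hypothesis b_gt0 : 0 < b.

Definition baryE (p : plane R) : R := p.1 - a / b * p.2.
Definition baryV (p : plane R) : R := p.2 / b.
Definition baryO (p : plane R) : R := 1 - baryE p - baryV p.

Definition tri : set (plane R) := triangle ((0, 0) : R * R) (1, 0) (a, b).

Let b_neq0 : b != 0. Proof. by rewrite gt_eqF. Qed.

Lemma triE p : tri p <-> [/\ 0 < baryE p, 0 < baryV p & 0 < baryO p].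
Proof.
split=> [[s [t [u [s0 t0 u0 stu ->]]]]|[E0 V0 O0]].
  have -> : s *: ((0, 0) : R * R) + t *: (1, 0) + u *: (a, b) = (t + u * a, u * b).
    by congr pair => /=; rewrite /GRing.scale/=; ring.
  have -> : baryE (t + u * a, u * b) = t by rewrite /baryE/=; field.
  have V : baryV (t + u * a, u * b) = u by rewrite /baryV/= mulfK.
  rewrite /baryO V (_ : baryE _ = t); last by rewrite /baryE/=; field.
  by split => //; lra.
exists (baryO p), (baryE p), (baryV p); split => //; first by rewrite /baryO; ring.
case: p {E0 V0 O0} => x y; congr pair; rewrite /= /GRing.scale/= /baryE /baryV/=.
  by field.
by rewrite !mulr0 !add0r divfK.
Qed.

(** The coordinates (s, t) are (l_E, l_V). [tri_coord] inverts [tri_param], and [hypo_refl] is the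
    reflection r in the diagonal s + t = 1. *)
Definition tri_param (p : plane R) : plane R := (p.1 + a * p.2, b * p.2).
Definition tri_coord (p : plane R) : plane R := (baryE p, baryV p).
Definition hypo_refl (p : plane R) : plane R := (1 - p.2, 1 - p.1).

Lemma tri_paramK p : tri_coord (tri_param p) = p.
Proof.
by case: p => s t; congr pair; rewrite /baryE /baryV/=; field.
Qed.

Lemma hypo_reflK p : hypo_refl (hypo_refl p) = p.
Proof. by case: p => s t; congr pair => /=; ring. Qed.

Lemma scales_area_tri_param : scales_area tri_param b^-1.
Proof.
have sw := @scales_area_swap R.
(* Scale t by b, as a shear between two exchanges, then shear by (s, y) |-> (s + (a/b) y, y). *)
have s1 := scales_area_shear 0 0 b_neq0.
have s2 := scales_area_shear (a / b) 0 (oner_neq0 R).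
have := scales_area_comp s2 (scales_area_comp sw (scales_area_comp s1 sw)).
rewrite normr1 invr1 !mul1r mulr1 gtr0_norm//; congr scales_area.
apply/funext => -[s t]; congr pair => /=; first by field.
by ring.
Qed.

Lemma scales_area_hypo_refl : scales_area hypo_refl 1.
Proof.
have sw := @scales_area_swap R.
have n1 : - 1 != 0 :> R by rewrite oppr_eq0 oner_neq0.
have s := scales_area_shear 0 1 n1.
have := scales_area_comp sw (scales_area_comp s (scales_area_comp sw (scales_area_comp s sw))).
rewrite normrN normr1 invr1 !mul1r; congr scales_area.
by apply/funext => -[x y]; congr pair => /=; ring.
Qed.

Definition tri_param' := tri_param \o hypo_refl.

Lemma scales_area_tri_param' : scales_area tri_param' b^-1.
Proof.
by have := scales_area_comp scales_area_tri_param scales_area_hypo_refl; rewrite mulr1.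
Qed.

Lemma measurable_tri : measurable tri.
Proof.
have mlt (al be ga : R) : measurable [set p : plane R | 0 < al * p.1 + be * p.2 + ga].
  rewrite (_ : mkset _ = (fun p : plane R => al * p.1 + be * p.2 + ga) @^-1` `]0, +oo[).
    by rewrite -[_ @^-1` _]setTI; apply: measurable_affine => //; exact: measurable_itv.
  by apply/seteqP; split => p /=; rewrite in_itv/= andbT.
have -> : tri = [set p | 0 < 1 * p.1 + - (a / b) * p.2 + 0] `&`
    ([set p | 0 < 0 * p.1 + b^-1 * p.2 + 0] `&`
     [set p | 0 < - 1 * p.1 + (a / b - b^-1) * p.2 + 1]).
  apply/seteqP; split => [p /triE[]|p []] /=; rewrite ?triE /baryO /baryE /baryV.
    move=> h1 h2 h3; split; first by apply: lt_le_trans h1 _; rewrite le_eqVlt; apply/orP; left; apply/eqP; ring.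
    split; first by apply: lt_le_trans h2 _; rewrite le_eqVlt; apply/orP; left; apply/eqP; ring.
    by apply: lt_le_trans h3 _; rewrite le_eqVlt; apply/orP; left; apply/eqP; ring.
  move=> h1 [h2 h3]; split; first by apply: lt_le_trans h1 _; rewrite le_eqVlt; apply/orP; left; apply/eqP; ring.
    by apply: lt_le_trans h2 _; rewrite le_eqVlt; apply/orP; left; apply/eqP; ring.
  by apply: lt_le_trans h3 _; rewrite le_eqVlt; apply/orP; left; apply/eqP; ring.
by apply: measurableI; [exact: mlt|apply: measurableI; exact: mlt].
Qed.

Lemma preimage_tri p : (tri_param @^-1` tri) p <-> [/\ 0 < p.1, 0 < p.2 & p.1 + p.2 < 1].
Proof.
have := tri_paramK p; case: p => s t [E V]; rewrite /preimage/= triE /baryO E V.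
by split=> -[? ? ?]; split => //=; lra.
Qed.

Lemma preimage_tri' p :
  (tri_param' @^-1` tri) p <-> [/\ p.1 < 1, p.2 < 1 & 1 < p.1 + p.2].
Proof.
rewrite /tri_param' comp_preimage; have := preimage_tri (hypo_refl p).
rewrite [X in X <-> _ -> _]/preimage/= => ->; case: p => s t /=.
by split=> -[? ? ?]; split; lra.
Qed.

Lemma preimage_tri_square : tri_param @^-1` tri `<=` square.
Proof.
by move=> [s t] /preimage_tri[/= s0 t0 st]; split; rewrite /= in_itv/=; lra.
Qed.

Lemma preimage_tri'_square : tri_param' @^-1` tri `<=` square.
Proof.
by move=> [s t] /preimage_tri'[/= s0 t0 st]; split; rewrite /= in_itv/=; lra.
Qed.

Lemma preimage_tri_disj : [disjoint tri_param @^-1` tri & tri_param' @^-1` tri].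
Proof.
apply/disj_set2P/seteqP; split => // -[s t] [/preimage_tri[/= ? ? ?]].
by move=> /preimage_tri'[/= ? ? ?]; lra.
Qed.

Lemma area_tri_fin : (@area R tri < +oo)%E.
Proof.
have [mP cP] := scales_area_tri_param.
have -> : @area R tri = (b%:E * @area R (tri_param @^-1` tri))%E.
  by rewrite cP ?muleA -?EFinM ?divff ?mul1e//; exact: measurable_tri.
rewrite lte_mul_pinfty// ?lee_fin ?ltW//.
rewrite (le_lt_trans (le_measure (@area R) _ _ preimage_tri_square))//.
- by rewrite inE; exact: (measurable_preim_scales_area scales_area_tri_param measurable_tri).
- by rewrite inE; exact: measurable_square.
- exact: area_square_fin.
Qed.

(* A pair of functions on the triangle, seen as one function on the unit square:
   the first one through [tri_param] below the diagonal, the second one through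
   its composition with the reflection above it. *)
Definition unfold (f g : plane R -> R) (p : plane R) : R :=
  (f \o tri_param) \_ (tri_param @^-1` tri) p +
  (g \o tri_param') \_ (tri_param' @^-1` tri) p.

Lemma unfold_below f g p : (tri_param @^-1` tri) p -> unfold f g p = f (tri_param p).
Proof.
move=> Tp; rewrite /unfold !patchE mem_set// memNset ?addr0// => T'p.
have /disj_set2P dj := preimage_tri_disj.
by have : set0 p by rewrite -dj.
Qed.

Lemma unfold_above f g p : (tri_param' @^-1` tri) p -> unfold f g p = g (tri_param' p).
Proof.
move=> Tp; have nTp : ~ (tri_param @^-1` tri) p.
  move=> T'p; have /disj_set2P dj := preimage_tri_disj.
  by have : set0 p by rewrite -dj.
by rewrite /unfold !patchE (memNset nTp) (mem_set Tp) add0r.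
Qed.

Lemma unfold_out f g p : ~ (tri_param @^-1` tri) p -> ~ (tri_param' @^-1` tri) p ->
  unfold f g p = 0.
Proof. by move=> nT nT'; rewrite /unfold !patchE !memNset// addr0. Qed.

Lemma unfoldM f g f' g' p : unfold f g p * unfold f' g' p =
  unfold (fun q => f q * f' q) (fun q => g q * g' q) p.
Proof.
have [Tp|nTp] := pselect ((tri_param @^-1` tri) p); first by rewrite !unfold_below.
have [Tp|nTp'] := pselect ((tri_param' @^-1` tri) p); first by rewrite !unfold_above.
by rewrite !unfold_out// mul0r.
Qed.

Lemma unfoldMr f g F p : unfold f g p * F p =
  unfold (fun q => f q * F (tri_coord q)) (fun q => g q * F (hypo_refl (tri_coord q))) p.
Proof.
have [Tp|nTp] := pselect ((tri_param @^-1` tri) p).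
  by rewrite !unfold_below// tri_paramK.
have [Tp|nTp'] := pselect ((tri_param' @^-1` tri) p).
  by rewrite !unfold_above// tri_paramK hypo_reflK.
by rewrite !unfold_out// mul0r.
Qed.

Lemma Rintegral_unfold f g :
  (@area R).-integrable tri (EFin \o f) -> (@area R).-integrable tri (EFin \o g) ->
  \int[@area R]_(p in square) unfold f g p =
  b^-1 * (\int[@area R]_(p in tri) f p + \int[@area R]_(p in tri) g p).
Proof.
move=> intf intg; have b0 : 0 <= b^-1 by rewrite invr_ge0 ltW.
have [if1 f1] := integral_scales_area b0 scales_area_tri_param measurable_tri intf.
have [ig1 g1] := integral_scales_area b0 scales_area_tri_param' measurable_tri intg.
have m1 := measurable_preim_scales_area scales_area_tri_param measurable_tri.
have m2 := measurable_preim_scales_area scales_area_tri_param' measurable_tri.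
have patch_int (h : plane R -> R) (A : set (plane R)) : measurable A ->
    (@area R).-integrable A (EFin \o h) ->
    (@area R).-integrable square (EFin \o (h \_ A)).
  move=> mA ih; apply: (integrableS measurableT measurable_square) => //.
  by rewrite -restrict_EFin; exact/(integrable_mkcond _ mA).
rewrite /unfold RintegralD; [|exact: measurable_square|exact: patch_int|exact: patch_int].
rewrite -!Rintegral_mkcondr !setIidr; [|exact: preimage_tri'_square|exact: preimage_tri_square].
by rewrite mulrDr -f1 -g1.
Qed.

Lemma L2_unfold f g : L2 (@area R) tri f -> L2 (@area R) tri g ->
  L2 (@area R) square (unfold f g).
Proof.
move=> Lf Lg; have b0 : 0 <= b^-1 by rewrite invr_ge0 ltW.
have Lf1 := L2_scales_area b0 scales_area_tri_param measurable_tri Lf.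
have Lg1 := L2_scales_area b0 scales_area_tri_param' measurable_tri Lg.
have m1 := measurable_preim_scales_area scales_area_tri_param measurable_tri.
have m2 := measurable_preim_scales_area scales_area_tri_param' measurable_tri.
have patch_L2 (h : plane R -> R) (A : set (plane R)) : measurable A ->
    L2 (@area R) A h -> L2 (@area R) square (h \_ A).
  move=> mA [mh ih]; split.
    by apply: measurable_funTS; apply/(measurable_restrictT _ mA).
  have -> : (fun p => ((h \_ A) p ^+ 2)%:E) = (fun p => (h p ^+ 2)%:E) \_ A.
    by apply/funext => p; rewrite !patchE; case: ifP => //; rewrite expr0n.
  apply: (integrableS measurableT measurable_square) => //.
  exact/(integrable_mkcond _ mA).
by have := L2D measurable_square (patch_L2 _ _ m1 Lf1) (patch_L2 _ _ m2 Lg1).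
Qed.

End TriangleGeometry.

(** * Weak derivatives and the spectral inequality on triangles *)

Section PlaneCalculus.
Context {R : realType}.

(** An open set is the countable union of the half-open squares of rational centre and half-width
    that it contains. The half-width is taken below e / 2 and the centre closer to the point than
    the half-width: the square then contains the point and lies in its e-ball. *)
Lemma open_measurable_plane (O : set (R * R)) : open O ->
  measurable (O : set (plane R)).
Proof.
move=> oO.
pose cell (q : rat * rat * rat) : set (R * R) :=
  `]ratr q.1.1 - ratr q.2, ratr q.1.1 + ratr q.2[ `*`
  `]ratr q.1.2 - ratr q.2, ratr q.1.2 + ratr q.2[.
pose F q : set (plane R) := if `[< cell q `<=` O >] then cell q else set0.
have -> : (O : set (plane R)) = \bigcup_q F q.
  apply/seteqP; split=> [[x y] Oxy|p [q _]]; last first.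
    by rewrite /F; case: asboolP => [qO /qO|_ []].
  have /nbhs_ballP[e /= e0 eO] : nbhs (x, y) O by apply: open_nbhs_nbhs.
  have e4 : e / 4 < e / 2 by lra.
  have [r rP] := rat_in_itvoo e4; rewrite in_itv/= in rP.
  have xe : x - ratr r < x + ratr r by lra.
  have [q1 q1P] := rat_in_itvoo xe; rewrite in_itv/= in q1P.
  have ye : y - ratr r < y + ratr r by lra.
  have [q2 q2P] := rat_in_itvoo ye; rewrite in_itv/= in q2P.
  exists (q1, q2, r) => //; rewrite /F ifT.
    by split; rewrite /= in_itv/=; lra.
  apply/asboolP => -[x' y'] [/=]; rewrite !in_itv/= => h1 h2; apply: eO.
  by split; rewrite /ball/= ltr_norml; lra.
apply: countable_bigcupT_measurable => // q; rewrite /F; case: ifP => // _.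
by apply: measurableX; exact: measurable_itvR.
Qed.

Lemma continuous_measurable_plane (g : R * R -> R) : continuous g ->
  measurable_fun [set: plane R] g.
Proof.
move=> /continuousP cg.
apply: (measurability _ (RGenOInfty.measurableE R)) => //.
move=> _ [_ [x ->] <-]; rewrite setTI; apply: open_measurable_plane.
by apply: cg; exact: interval_open.
Qed.

(** The partial derivatives are arguments, so that sums, products and affine substitutions compute
    them explicitly. *)
Definition C1 (phi phix phiy : R * R -> R) : Prop :=
  [/\ forall p, is_diff p phi (fun h => phix p * h.1 + phiy p * h.2),
      continuous phix & continuous phiy].

Lemma C1_deriveE phi phix phiy p : C1 phi phix phiy ->
  [/\ differentiable phi p, 'D_e1 phi p = phix p & 'D_e2 phi p = phiy p].
Proof.
move=> [/(_ p) dphi _ _]; have df : differentiable phi p by case: dphi.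
by split; rewrite ?deriveE// diff_val /e1 /e2/= ?mulr1 ?mulr0 ?addr0 ?add0r.
Qed.

Lemma C1_derive phi phix phiy : C1 phi phix phiy ->
  'D_e1 phi = phix /\ 'D_e2 phi = phiy.
Proof. by move=> h; split; apply/funext => p; have [] := C1_deriveE p h. Qed.

Lemma differentiable_C1 phi : (forall p, differentiable phi p) ->
  continuous ('D_e1 phi) -> continuous ('D_e2 phi) ->
  C1 phi ('D_e1 phi) ('D_e2 phi).
Proof.
move=> df c1 c2; split; [|exact: c1|exact: c2].
move=> p; apply: DiffDef; first exact: df.
apply/funext => -[h1 h2] /=; rewrite !deriveE//.
have -> : (h1, h2) = h1 *: e1 + h2 *: e2 :> R * R.
  by congr pair; rewrite /= /GRing.scale/= !(mulr0, mulr1) ?addr0 ?add0r.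
by rewrite linearD !linearZ/= /GRing.scale/= mulrC [h2 * _]mulrC.
Qed.

Lemma C1_continuous phi phix phiy : C1 phi phix phiy -> continuous phi.
Proof.
by move=> h p; apply: differentiable_continuous; have [] := C1_deriveE p h.
Qed.

Lemma continuous_affine (al be ga : R) :
  continuous (fun p : R * R => al * p.1 + be * p.2 + ga).
Proof.
move=> p; apply: cvgD; last exact: cvg_cst.
by apply: cvgD; (apply: cvgM; first exact: cvg_cst); [exact: cvg_fst|exact: cvg_snd].
Qed.

Lemma C1_affine (f f' : R -> R) (al be ga : R) :
  (forall x, is_derive x (1 : R) f (f' x)) -> continuous f' ->
  C1 (fun p => f (al * p.1 + be * p.2 + ga))
     (fun p => al * f' (al * p.1 + be * p.2 + ga))
     (fun p => be * f' (al * p.1 + be * p.2 + ga)).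
Proof.
move=> df cf'; set L : R * R -> R := fun p => al * p.1 + be * p.2 + ga.
have dfst p : is_diff p (fst : R * R -> R) fst.
  apply: DiffDef; first by apply: linear_differentiable => q; exact: cvg_fst.
  by apply: diff_lin => q; exact: cvg_fst.
have dsnd p : is_diff p (snd : R * R -> R) snd.
  apply: DiffDef; first by apply: linear_differentiable => q; exact: cvg_snd.
  by apply: diff_lin => q; exact: cvg_snd.
have dL p : is_diff p L (fun h => al * h.1 + be * h.2).
  have d := is_diffD (is_diffD (is_diffZ al (dfst p)) (is_diffZ be (dsnd p)))
    (is_diff_cst ga p).
  apply: (is_diff_eq d).
  by apply/funext => h; rewrite addr0.
have dfx x : is_diff x f (fun h => h * f' x).
  have d1 : differentiable f x by apply/derivable1_diffP; case: (df x).
  by apply: DiffDef => //; rewrite diff1E//; apply/funext => h; rewrite derive1E derive_val.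
split.
- move=> p; have d := is_diff_comp (dL p) (dfx (L p)).
  by apply: (is_diff_eq d); apply/funext => h /=; ring.
- move=> p; apply: cvgM; first exact: cvg_cst.
  by apply: continuous_comp; [exact: continuous_affine|exact: cf'].
- move=> p; apply: cvgM; first exact: cvg_cst.
  by apply: continuous_comp; [exact: continuous_affine|exact: cf'].
Qed.

Lemma C1M phi phix phiy psi psix psiy : C1 phi phix phiy -> C1 psi psix psiy ->
  C1 (fun p => phi p * psi p) (fun p => phix p * psi p + phi p * psix p)
     (fun p => phiy p * psi p + phi p * psiy p).
Proof.
move=> h1 h2; have c1 := C1_continuous h1; have c2 := C1_continuous h2.
have [d1 cx1 cy1] := h1; have [d2 cx2 cy2] := h2; split.
- move=> p; have d := is_diffM (d1 p) (d2 p).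
  apply: (is_diff_eq d); apply/funext => h.
  rewrite -[LHS]/(phi p * (psix p * h.1 + psiy p * h.2) +
                  psi p * (phix p * h.1 + phiy p * h.2)).
  by ring.
- by move=> p; apply: cvgD; apply: cvgM; [exact: cx1|exact: c2|exact: c1|exact: cx2].
- by move=> p; apply: cvgD; apply: cvgM; [exact: cy1|exact: c2|exact: c1|exact: cy2].
Qed.

Lemma C1D phi phix phiy psi psix psiy : C1 phi phix phiy -> C1 psi psix psiy ->
  C1 (fun p => phi p + psi p) (fun p => phix p + psix p) (fun p => phiy p + psiy p).
Proof.
move=> h1 h2; have [d1 cx1 cy1] := h1; have [d2 cx2 cy2] := h2; split.
- move=> p; have d := is_diffD (d1 p) (d2 p).
  apply: (is_diff_eq d); apply/funext => h.
  rewrite -[LHS]/((phix p * h.1 + phiy p * h.2) + (psix p * h.1 + psiy p * h.2)).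
  by ring.
- by move=> p; apply: cvgD; [exact: cx1|exact: cx2].
- by move=> p; apply: cvgD; [exact: cy1|exact: cy2].
Qed.

Lemma C1_cst (c : R) : C1 (cst c) (cst 0) (cst 0).
Proof.
split=> [p|p|p]; try exact: cvg_cst.
apply: (is_diff_eq (is_diff_cst c p)).
by apply/funext => h /=; rewrite !mul0r addr0.
Qed.

Lemma C1Z c phi phix phiy : C1 phi phix phiy ->
  C1 (fun p => c * phi p) (fun p => c * phix p) (fun p => c * phiy p).
Proof.
by move=> /(C1M (C1_cst c)); congr C1; apply/funext => p /=; rewrite mul0r add0r.
Qed.

End PlaneCalculus.

(** * Integration by parts against test functions *)

Section TestFunctions.
Context {R : realType}.
Implicit Types (F phi v : R * R -> R) (K Om : set (R * R)).

Lemma continuous_compact_bounded F K : continuous F -> compact K ->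
  exists B, forall p, K p -> `|F p| <= B.
Proof.
move=> cF cK; have : compact (F @` K).
  by apply: continuous_compact => //; exact: continuous_subspaceT.
move=> /compact_bounded[B [_ BP]]; exists (B + 1) => p Kp.
by apply: (BP (B + 1)); [rewrite ltrDl|exists p].
Qed.

Definition box (M : R) : set (plane R) := `[- M, M] `*` `[- M, M].

Lemma measurable_box M : measurable (box M).
Proof. by apply: measurableX; exact: measurable_itvR. Qed.

Lemma area_box_fin M : 0 < M -> (@area R (box M) < +oo)%E.
Proof.
move=> M0; rewrite /area product_measure1E; try exact: measurable_itvR.
by rewrite /= !lebesgue_measure_itvcc ?lte_mul_pinfty ?lee_fin ?ltry//; lra.
Qed.

Lemma box_integrable F M : 0 < M -> continuous F ->
  (@area R).-integrable (box M) (EFin \o F).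
Proof.
move=> M0 cF; have cb : compact (box M : set (R * R)).
  by apply: compact_setX; exact: segment_compact.
have [B BP] := continuous_compact_bounded cF cb.
apply: (integrable_bounded (measurable_box M)) BP.
- exact: area_box_fin.
- by apply: measurable_funTS; exact: continuous_measurable_plane.
Qed.

Lemma box_integral0 F phi M : 0 < M -> continuous F ->
  (forall x y, is_derive y (1 : R) (fun z => phi (x, z)) (F (x, y))) ->
  (forall x, phi (x, M) = 0 /\ phi (x, - M) = 0) ->
  \int[@area R]_(p in box M) F p = 0.
Proof.
move=> M0 cF dphi phi0; rewrite Rintegral_fubini; last 2 first.
- exact: measurable_box.
- exact: box_integrable.
have MM : - M < M by lra.
rewrite (_ : (fun x => _) = cst 0) ?Rintegral_cst ?mul0r//; apply/funext => x /=.
have cFx : continuous (fun y => F (x, y)).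
  move=> y; apply: (@continuous_comp _ _ _ (fun z : R => (x, z)) F); last exact: cF.
  apply: (@cvg_pair _ _ _ (nbhs y) (nbhs x) (nbhs y) _ _ _ (fun=> x) id).
    exact: cvg_cst.
  exact: cvg_id.
have [xM|nxM] := boolP (x \in `[- M, M]).
  have := Rintegral_FTC MM (dphi x) cFx.
  have [-> ->] := phi0 x; rewrite subrr => <-.
  rewrite [RHS]Rintegral_mkcond; apply: eq_Rintegral => y _.
  rewrite !patchE; congr (if _ then _ else _).
  by apply/idP/idP => /set_mem h; apply/mem_set; [case: h|split].
rewrite (_ : (fun y => _) = cst 0) ?Rintegral_cst ?mul0r//; apply/funext => y /=.
by rewrite patchE memNset// => -[/= xM]; move/negP: nxM.
Qed.

Lemma box_swap M : (fun p : plane R => (p.2, p.1)) @^-1` box M = box M.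
Proof. by apply/seteqP; split => p []. Qed.

Section Test.
Variables (Om : set (R * R)) (phi : R * R -> R).
Hypothesis phi_test : test_function Om phi.

Let K := closure [set p | phi p != 0].

Lemma test_C1 : C1 phi ('D_e1 phi) ('D_e2 phi).
Proof. by case: phi_test => *; exact: differentiable_C1. Qed.

Lemma test_continuous : continuous phi.
Proof. exact: C1_continuous test_C1. Qed.

Lemma test_support p : ~ Om p -> ~ K p.
Proof. by case: phi_test => _ _ _ _ KO nO Kp; apply: nO; exact: KO. Qed.

Lemma test0 p : ~ K p -> phi p = 0.
Proof.
move=> nK; apply/eqP; apply: contra_notT nK => phip; exact: subset_closure.
Qed.

Lemma test_near0 p : ~ K p -> \forall q \near p, phi q = 0.
Proof.
move=> nK; have oK : open (~` K) by apply: closed_openC; exact: closed_closure.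
have : nbhs p (~` K) by apply: open_nbhs_nbhs.
by apply: filterS => q; exact: test0.
Qed.

Lemma test_derive0 (e p : R * R) : ~ K p -> 'D_e phi p = 0.
Proof.
move=> nK; have [->|e0] := eqVneq e 0; first exact: derive0.
rewrite -(derive_cst (0 : R) p e); apply: near_eq_derive => //.
exact: test_near0.
Qed.

Lemma test_bounded F G : continuous F -> (forall p, ~ K p -> G p = 0) ->
  continuous G -> exists B, forall p, `|F p * G p| <= B.
Proof.
move=> cF G0 cG; have [_ _ _ cK _] := phi_test.
have cFG : continuous (fun p => F p * G p).
  by move=> p; apply: cvgM; [exact: cF|exact: cG].
have [B BP] := continuous_compact_bounded cFG cK.
exists `|B| => p; have [Kp|nKp] := pselect (K p).
  by rewrite (le_trans (BP _ Kp))// ler_norm.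
by rewrite G0// mulr0 normr0.
Qed.

Lemma test_box : exists2 M, 0 < M & forall p, K p -> `|p.1| < M /\ `|p.2| < M.
Proof.
have [_ _ _ cK _] := phi_test; have [B [_ BP]] := compact_bounded cK.
exists (`|B| + 2); first by rewrite ltr_wpDl.
move=> p Kp; have := BP (`|B| + 1); rewrite (le_lt_trans (ler_norm B)) ?ltrDl//.
move=> /(_ isT p Kp) /= pB; have : `|p| < `|B| + 2 by lra.
by rewrite [`|p|]prod_normE gt_max => /andP[].
Qed.

Lemma test_section2 x y :
  is_derive y (1 : R) (fun z => phi (x, z)) ('D_e2 phi (x, y)).
Proof.
have [dphi _ _] := test_C1.
have [dd E] := is_diff_comp (is_diff_pair (is_diff_cst x y) (is_diff_id y)) (dphi (x, y)).
apply: DeriveDef; first exact: diff_derivable dd.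
by rewrite (deriveE _ dd) E/= mulr0 add0r mulr1.
Qed.

Lemma test_section1 x y :
  is_derive x (1 : R) (fun z => phi (z, y)) ('D_e1 phi (x, y)).
Proof.
have [dphi _ _] := test_C1.
have [dd E] := is_diff_comp (is_diff_pair (is_diff_id x) (is_diff_cst y x)) (dphi (x, y)).
apply: DeriveDef; first exact: diff_derivable dd.
by rewrite (deriveE _ dd) E/= mulr0 addr0 mulr1.
Qed.

(** The integral may be taken over a box around the support, where the fundamental theorem applies
    on each line. The x-direction is reduced to the y-direction by exchanging the coordinates. *)
Lemma test_integral0 : (\int[@area R]_(p in Om) 'D_e1 phi p = 0) /\
  (\int[@area R]_(p in Om) 'D_e2 phi p = 0).
Proof.
have [_ c1 c2 _ _] := phi_test; have [M M0 MP] := test_box.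
have to_box (e : R * R) :
    \int[@area R]_(p in Om) 'D_e phi p = \int[@area R]_(p in box M) 'D_e phi p.
  rewrite Rintegral_mkcond [RHS]Rintegral_mkcond; congr (Rintegral _ _ _).
  apply/funext => p; rewrite !patchE.
  have [Kp|nKp] := pselect (K p); last first.
    by rewrite test_derive0//; case: ifP; case: ifP.
  rewrite !ifT//; apply/mem_set; last by apply: contrapT => /test_support.
  by have [] := MP p Kp; rewrite !ltr_norml => /andP[? ?] /andP[? ?]; split;
    rewrite /= in_itv/= !ltW.
have out (p : R * R) : `|p.1| = M \/ `|p.2| = M -> phi p = 0.
  move=> pM; apply: test0 => /MP[h1 h2].
  by case: pM => pM; [move: h1|move: h2]; rewrite pM ltxx.
rewrite !to_box; split; last first.
  apply: (box_integral0 M0 c2 test_section2) => x; split; apply: out; right;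
    by rewrite /= ?normrN gtr0_norm.
have cswap : continuous (fun p : R * R => 'D_e1 phi (p.2, p.1)).
  move=> p; apply: (@continuous_comp _ _ _ (fun q : R * R => (q.2, q.1)) ('D_e1 phi)); last exact: c1.
  exact: swap_continuous.
have [_] := integral_scales_area ler01 (@scales_area_swap R) (measurable_box M)
  (box_integrable M0 c1).
rewrite mul1r box_swap => <-.
apply: (@box_integral0 (fun p => 'D_e1 phi (p.2, p.1)) (fun p => phi (p.2, p.1)) M) => //.
  by move=> x y; exact: test_section1.
by move=> x; split; apply: out; left; rewrite /= ?normrN gtr0_norm.
Qed.

End Test.

(** If phi is a test function and v is of class C^1, then v phi is again a test function; the
    identity says that its derivatives integrate to 0. *)
Lemma C1_weak_derivative Om v vx vy :
  measurable (Om : set (plane R)) -> (@area R Om < +oo)%E -> C1 v vx vy ->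
  weak_derivative Om e1 v vx /\ weak_derivative Om e2 v vy.
Proof.
move=> mO Ofin Cv.
have main phi : test_function Om phi ->
    (\int[@area R]_(p in Om) (v p * 'D_e1 phi p) =
      - (\int[@area R]_(p in Om) (vx p * phi p))) /\
    (\int[@area R]_(p in Om) (v p * 'D_e2 phi p) =
      - (\int[@area R]_(p in Om) (vy p * phi p))).
  move=> tphi; have Cvphi := C1M Cv (test_C1 tphi).
  have [D1 D2] := C1_derive Cvphi.
  have [_ cvx cvy] := Cv; have cv := C1_continuous Cv.
  have cphi := test_continuous tphi.
  have [_ c1 c2 cK KO] := tphi.
  have tvphi : test_function Om (fun p => v p * phi p).
    have supp : closure [set p | v p * phi p != 0] `<=` closure [set p | phi p != 0].
      by apply: closure_subset => p /=; apply: contraNN => /eqP ->; rewrite mulr0.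
    split.
    - by move=> p; have [] := C1_deriveE p Cvphi.
    - by rewrite D1; have [_ h _] := Cvphi; exact: h.
    - by rewrite D2; have [_ _ h] := Cvphi; exact: h.
    - by apply: subclosed_compact supp => //; exact: closed_closure.
    - exact: subset_trans supp KO.
  have int F G : continuous F -> continuous G ->
      (forall p, ~ closure [set p | phi p != 0] p -> G p = 0) ->
      (@area R).-integrable Om (EFin \o (fun p => F p * G p)).
    move=> cF cG G0; have [B BP] := test_bounded tphi cF G0 cG.
    apply: (@integrable_bounded _ _ _ _ _ mO (fun p => F p * G p) B Ofin); last first.
      by move=> p _; exact: BP.
    apply: measurable_funTS; apply: continuous_measurable_plane => p.
    by apply: cvgM; [exact: cF|exact: cG].
  have [] := test_integral0 tvphi; rewrite D1 D2 => h1 h2.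
  have iv1 := int _ _ cv c1 (@test_derive0 phi e1).
  have iv2 := int _ _ cv c2 (@test_derive0 phi e2).
  have ix := int _ _ cvx cphi (@test0 phi).
  have iy := int _ _ cvy cphi (@test0 phi).
  have /= E1 := RintegralD mO ix iv1; have /= E2 := RintegralD mO iy iv2.
  rewrite E1 in h1; rewrite E2 in h2.
  by split; apply/eqP; rewrite -addr_eq0 addrC; apply/eqP; [exact: h1|exact: h2].
by split=> phi /main[].
Qed.

End TestFunctions.

(** * Cutoff functions of class C^1 *)

Section Cutoff.
Context {R : realType}.

Lemma lipschitz_derive (f f' : R -> R) (C x y : R) :
  (forall z, is_derive z (1 : R) f (f' z)) -> (forall z, `|f' z| <= C) ->
  `|f x - f y| <= C * `|x - y|.
Proof.
move=> df fC; wlog xy : x y / y <= x.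
  by move=> H; have [/H//|/ltW/H] := leP y x; rewrite distrC [`|y - x|]distrC.
have [c _ ->] := MVT_segment xy (fun z _ => df z)
  (continuous_subspaceT (is_derive_continuous df)).
by rewrite normrM ler_wpM2r.
Qed.

Lemma is_derive_quadratic (f : R -> R) (x l C : R) :
  (forall h, `|f (x + h) - f x - l * h| <= C * h ^+ 2) -> is_derive x (1 : R) f l.
Proof.
move=> H; have cvg : h^-1 *: ((f \o shift x) (h *: (1 : R)) - f x) @[h --> 0^'] --> l.
  apply/cvgrPdistC_le => eps eps0.
  have C1 : 0 < `|C| + 1 by rewrite ltr_wpDl.
  near=> h; have h0 : h != 0 by near: h; exact: nbhs_dnbhs_neq.
  have hle : `|h| <= eps / (`|C| + 1).
    near: h; apply: dnbhs0_le; exact: divr_gt0.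
  rewrite /= /GRing.scale/= mulr1 [h + x]addrC.
  rewrite -(ler_pM2r (_ : 0 < `|h|)) ?normr_gt0// -normrM.
  rewrite (_ : _ * h = f (x + h) - f x - l * h); last by field.
  rewrite (le_trans (H h))// -real_normK ?num_real// expr2 mulrA ler_wpM2r//.
  rewrite ler_pdivlMr// in hle; have Cn := ler_norm C; have hn := normr_ge0 h.
  by nra.
apply: DeriveDef; last exact: (cvg_lim (@Rhausdorff R) cvg).
by apply/cvg_ex; exists l.
Unshelve. all: by end_near. Qed.

Definition pospart (r : R) : R := (r + `|r|) / 2.

Lemma pospart_ge r : 0 <= r -> pospart r = r.
Proof. by move=> r0; rewrite /pospart ger0_norm//; field. Qed.

Lemma pospart_le r : r <= 0 -> pospart r = 0.
Proof. by move=> r0; rewrite /pospart ler0_norm// subrr mul0r. Qed.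

Lemma continuous_pospart : continuous pospart.
Proof.
move=> r; apply: cvgM; last exact: cvg_cst.
by apply: cvgD; [exact: cvg_id|exact: norm_continuous].
Qed.

Lemma is_derive_pospart2 (c r : R) :
  is_derive r (1 : R) (fun x => pospart (x - c) ^+ 2) (2 * pospart (r - c)).
Proof.
apply: (@is_derive_quadratic _ _ _ 1) => h; rewrite mul1r.
have -> : r + h - c = (r - c) + h by ring.
rewrite ler_norml; have [r0|r0] := leP 0 (r - c); have [h0|h0] := leP 0 (r - c + h).
- by rewrite !pospart_ge//; apply/andP; split; nra.
- by rewrite (pospart_le (ltW h0)) (pospart_ge r0); apply/andP; split; nra.
- by rewrite (pospart_ge h0) (pospart_le (ltW r0)); apply/andP; split; nra.
- by rewrite (pospart_le (ltW h0)) (pospart_le (ltW r0)); apply/andP; split; nra.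
Qed.

(* A C^1 step from 0 before 1 to 1 after 2. *)
Definition cstep (r : R) : R :=
  2 * pospart (r - 1) ^+ 2 - 4 * pospart (r - 3 / 2) ^+ 2 + 2 * pospart (r - 2) ^+ 2.

Definition dcstep (r : R) : R :=
  4 * pospart (r - 1) - 8 * pospart (r - 3 / 2) + 4 * pospart (r - 2).

Lemma is_derive_cstep r : is_derive r (1 : R) cstep (dcstep r).
Proof.
have d c := is_derive_pospart2 c r.
have D := is_deriveD (is_deriveB (is_deriveZ 2 (d 1)) (is_deriveZ 4 (d (3 / 2))))
  (is_deriveZ 2 (d 2)).
by apply: (is_derive_eq D); rewrite /GRing.scale/= /dcstep; ring.
Qed.

Lemma continuous_dcstep : continuous dcstep.
Proof.
have c x : continuous (fun r => pospart (r - x)).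
  move=> r; apply: (@continuous_comp _ _ _ (fun y => y - x) pospart).
    by apply: cvgB; [exact: cvg_id|exact: cvg_cst].
  exact: continuous_pospart.
move=> r; apply: cvgD; [apply: cvgB|]; apply: cvgM; by [exact: cvg_cst|exact: c].
Qed.

Lemma cstep_cases r (P : R -> R -> Prop) :
  (r <= 1 -> P 0 0) ->
  (1 <= r <= 3 / 2 -> P (2 * (r - 1) ^+ 2) (4 * (r - 1))) ->
  (3 / 2 <= r <= 2 -> P (1 - 2 * (2 - r) ^+ 2) (4 * (2 - r))) ->
  (2 <= r -> P 1 0) -> P (cstep r) (dcstep r).
Proof.
move=> P1 P2 P3 P4; have [r1|r1] := leP r 1.
  have -> : cstep r = 0 by rewrite /cstep !pospart_le ?expr0n//=; lra.
  have -> : dcstep r = 0 by rewrite /dcstep !pospart_le//; lra.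
  exact: P1.
have [r2|r2] := leP r (3 / 2).
  have -> : cstep r = 2 * (r - 1) ^+ 2.
    by rewrite /cstep pospart_ge ?(@pospart_le (r - 3 / 2)) ?(@pospart_le (r - 2)); [ring|lra..].
  have -> : dcstep r = 4 * (r - 1).
    by rewrite /dcstep pospart_ge ?(@pospart_le (r - 3 / 2)) ?(@pospart_le (r - 2)); [ring|lra..].
  by apply: P2; rewrite r2 ltW.
have [r3|r3] := leP r 2.
  have -> : cstep r = 1 - 2 * (2 - r) ^+ 2.
    rewrite /cstep (@pospart_ge (r - 1)) ?(@pospart_ge (r - 3 / 2)) ?(@pospart_le (r - 2)); [|lra..].
    by field.
  have -> : dcstep r = 4 * (2 - r).
    rewrite /dcstep (@pospart_ge (r - 1)) ?(@pospart_ge (r - 3 / 2)) ?(@pospart_le (r - 2)); [|lra..].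
    by field.
  by apply: P3; rewrite r3 ltW.
have -> : cstep r = 1 by rewrite /cstep !pospart_ge; [field|lra..].
have -> : dcstep r = 0 by rewrite /dcstep !pospart_ge; [field|lra..].
by apply: P4; rewrite ltW.
Qed.

Lemma cstep01 r : 0 <= cstep r <= 1.
Proof. by apply: (@cstep_cases r (fun x _ => 0 <= x <= 1)) => *; nra. Qed.

Lemma cstep0 r : r <= 1 -> cstep r = 0.
Proof.
by apply: (@cstep_cases r (fun x _ => r <= 1 -> x = 0)) => // *; nra.
Qed.

Lemma cstep1 r : 2 <= r -> cstep r = 1 /\ dcstep r = 0.
Proof.
by apply: (@cstep_cases r (fun x y => 2 <= r -> x = 1 /\ y = 0)) => // *; split; nra.
Qed.

(** This bound is scale invariant: it survives when the step is compressed to width of order 1/N,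
    and lets a factor vanishing linearly at the boundary absorb the derivative of the cutoff. *)
Lemma dcstep_bound r : 0 <= r -> `|dcstep r * r| <= 4.
Proof.
move=> r0; rewrite ler_norml.
by apply: (@cstep_cases r (fun _ x => -4 <= x * r <= 4)) => *; nra.
Qed.

Definition cutoff (N : nat) (r : R) : R := cstep (N.+1%:R * r).
Definition dcutoff (N : nat) (r : R) : R := N.+1%:R * dcstep (N.+1%:R * r).

Lemma is_derive_cutoff N r : is_derive r (1 : R) (cutoff N) (dcutoff N r).
Proof.
have h : is_derive r (1 : R) (fun x : R => N.+1%:R * x) N.+1%:R.
  by have := is_deriveZ (N.+1%:R : R) (is_derive_id r (1 : R)); rewrite /GRing.scale/= mulr1.
apply: is_derive_eq (is_derive1_comp (is_derive_cstep (N.+1%:R * r)) h) _.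
by rewrite /dcutoff; ring.
Qed.

Lemma continuous_dcutoff N : continuous (dcutoff N).
Proof.
move=> r; apply: cvgM; first exact: cvg_cst.
apply: (@continuous_comp _ _ _ (fun x : R => N.+1%:R * x) dcstep).
  by apply: cvgM; [exact: cvg_cst|exact: cvg_id].
exact: continuous_dcstep.
Qed.

Lemma cutoff01 N r : 0 <= cutoff N r <= 1. Proof. exact: cstep01. Qed.

Lemma normr_cutoff N r : `|cutoff N r| <= 1.
Proof. by have /andP[h1 h2] := cutoff01 N r; rewrite ger0_norm. Qed.

Lemma cutoff_support N r : cutoff N r != 0 -> N.+1%:R^-1 <= r.
Proof.
move=> h; rewrite leNgt; apply/negP => rN; move/negP: h; apply.
by rewrite /cutoff cstep0// -ler_pdivlMl// mulr1 ltW.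
Qed.

Lemma dcutoff_bound N r x C : 0 <= r -> 0 <= C -> `|x| <= C * r ->
  `|dcutoff N r * x| <= 4 * C.
Proof.
move=> r0 C0 xr; have N0 : 0 <= N.+1%:R * r by rewrite mulr_ge0.
have := dcstep_bound N0; rewrite /dcutoff !normrM (ger0_norm r0) normr_nat => h.
have := normr_ge0 (dcstep (N.+1%:R * r)); have : 0 <= (N.+1%:R : R) by [].
set n : R := N.+1%:R in h *; set s := `|dcstep _| in h * => n0 s0.
apply: (@le_trans _ _ (n * s * (C * r))); first by rewrite ler_wpM2l// mulr_ge0.
by nra.
Qed.

Lemma cutoff_eventually r : 0 < r ->
  \forall N \near \oo, cutoff N r = 1 /\ dcutoff N r = 0.
Proof.
move=> r0; near=> N; have : 2 <= N.+1%:R * r.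
  rewrite -ler_pdivrMr//; near: N; exists (Num.trunc (2 / r)) => // N /= rN.
  have /truncn_itv/andP[_ /ltW h] : 0 <= 2 / r by rewrite divr_ge0// ltW.
  by rewrite (le_trans h)// ler_nat.
by move=> /cstep1[h1 h2]; rewrite /cutoff /dcutoff h1 h2 mulr0.
Unshelve. all: by end_near. Qed.

End Cutoff.

(** * Affine coordinates and cutoffs on the triangle *)

Section TangentialFields.
Context {R : realType}.
Variables (a b : R).
Hypothesis b_gt0 : 0 < b.
Let b_neq0 : b != 0. Proof. by rewrite gt_eqF. Qed.
Local Notation T := (tri a b).
Local Notation E := (baryE a b).
Local Notation V := (baryV b).
Local Notation O := (baryO a b).

(* Partial derivatives with respect to the coordinates (s, t) = tri_coord p. *)
Definition C1st (f fs ft : R * R -> R) : Prop :=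
  C1 f fs (fun p => b^-1 * (ft p - a * fs p)).

Lemma C1stM f fs ft g gs gt : C1st f fs ft -> C1st g gs gt ->
  C1st (fun p => f p * g p) (fun p => fs p * g p + f p * gs p)
       (fun p => ft p * g p + f p * gt p).
Proof.
by move=> cf cg; have := C1M cf cg; congr C1; apply/funext => p; ring.
Qed.

Section OneVariable.
Variables (f f' : R -> R).
Hypothesis df : forall x, is_derive x (1 : R) f (f' x).
Hypothesis cf' : continuous f'.

Lemma C1st_E : C1st (fun p => f (E p)) (fun p => f' (E p)) (cst 0).
Proof.
have L p : E p = 1 * p.1 + - (a / b) * p.2 + 0 by rewrite /baryE; ring.
have := C1_affine 1 (- (a / b)) 0 df cf'; rewrite /C1st; congr C1;
  by apply/funext => p; rewrite ?L//=; field.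
Qed.

Lemma C1st_V : C1st (fun p => f (V p)) (cst 0) (fun p => f' (V p)).
Proof.
have L p : V p = 0 * p.1 + b^-1 * p.2 + 0 by rewrite /baryV; ring.
have := C1_affine 0 b^-1 0 df cf'; rewrite /C1st; congr C1;
  by apply/funext => p; rewrite ?L//=; field.
Qed.

Lemma C1st_O : C1st (fun p => f (O p)) (fun p => - f' (O p)) (fun p => - f' (O p)).
Proof.
have L p : O p = - 1 * p.1 + (a / b - b^-1) * p.2 + 1.
  by rewrite /baryO /baryE /baryV; ring.
have := C1_affine (- 1) (a / b - b^-1) 1 df cf'; rewrite /C1st; congr C1;
  by apply/funext => p; rewrite ?L//=; field.
Qed.

Lemma C1st_1E : C1st (fun p => f (1 - E p)) (fun p => - f' (1 - E p)) (cst 0).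
Proof.
have L p : 1 - E p = - 1 * p.1 + a / b * p.2 + 1 by rewrite /baryE; ring.
have := C1_affine (- 1) (a / b) 1 df cf'; rewrite /C1st; congr C1;
  by apply/funext => p; rewrite ?L//=; field.
Qed.

Lemma C1st_1V : C1st (fun p => f (1 - V p)) (cst 0) (fun p => - f' (1 - V p)).
Proof.
have L p : 1 - V p = 0 * p.1 + - b^-1 * p.2 + 1 by rewrite /baryV; ring.
have := C1_affine 0 (- b^-1) 1 df cf'; rewrite /C1st; congr C1;
  by apply/funext => p; rewrite ?L//=; field.
Qed.

End OneVariable.

Definition tri_cutoff N p : R := cutoff N (E p) * cutoff N (V p) * cutoff N (O p).
Definition tri_cutoff_s N p : R :=
  dcutoff N (E p) * cutoff N (V p) * cutoff N (O p) -
  cutoff N (E p) * cutoff N (V p) * dcutoff N (O p).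
Definition tri_cutoff_t N p : R :=
  cutoff N (E p) * dcutoff N (V p) * cutoff N (O p) -
  cutoff N (E p) * cutoff N (V p) * dcutoff N (O p).

Lemma C1st_tri_cutoff N : C1st (tri_cutoff N) (tri_cutoff_s N) (tri_cutoff_t N).
Proof.
have dk := @is_derive_cutoff R N; have ck := @continuous_dcutoff R N.
have := C1stM (C1stM (C1st_E dk ck) (C1st_V dk ck)) (C1st_O dk ck).
by rewrite /C1st; congr C1; apply/funext => p;
  rewrite /tri_cutoff_s /tri_cutoff_t/=; ring.
Qed.

Lemma tri_box p : T p -> box (1 + `|a| + b) p.
Proof.
case: p => x y /(triE a b_gt0)[E0 V0 O0].
have V1 : V (x, y) < 1 by move: O0; rewrite /baryO; lra.
have E1 : E (x, y) < 1 by move: O0; rewrite /baryO; lra.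
have yE : y = b * V (x, y) by rewrite /baryV/=; field.
have xE : x = E (x, y) + a * V (x, y) by rewrite /baryE /baryV/=; field.
set s := E (x, y) in xE E0 E1; set t := V (x, y) in xE yE V0 V1.
have : `|a * t| <= `|a| by rewrite normrM (gtr0_norm V0) ler_piMr// ltW.
rewrite ler_norml => /andP[at1 at2]; have a0 := normr_ge0 a.
have bt0 : 0 <= b * t by rewrite mulr_ge0// ltW.
have bt1 : b * t <= b by rewrite ler_piMr// ltW.
by split; rewrite /= in_itv/=; apply/andP; split; lra.
Qed.

Lemma tri_cutoff_test N F Fs Ft : C1st F Fs Ft ->
  test_function T (fun p => tri_cutoff N p * F p).
Proof.
move=> CF; have CKF := C1stM (C1st_tri_cutoff N) CF; have [D1 D2] := C1_derive CKF.
pose e : R := N.+1%:R^-1; have e0 : 0 < e by rewrite invr_gt0.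
pose C : set (R * R) := [set p | e <= E p] `&` ([set p | e <= V p] `&` [set p | e <= O p]).
have clC : closed C.
  have cl al be ga : closed [set p : R * R | e <= al * p.1 + be * p.2 + ga].
    rewrite (_ : mkset _ = (fun p : R * R => al * p.1 + be * p.2 + ga) @^-1` [set x | e <= x]) //.
    apply: preimage_closed; last exact: closed_ge.
    by move=> p _; exact: continuous_affine.
  apply: closedI; last apply: closedI.
  - rewrite (_ : mkset _ = [set p | e <= 1 * p.1 + - (a / b) * p.2 + 0]); first exact: cl.
    by apply/funext => p; rewrite /mkset (_ : E p = 1 * p.1 + - (a / b) * p.2 + 0)// /baryE; ring.
  - rewrite (_ : mkset _ = [set p | e <= 0 * p.1 + b^-1 * p.2 + 0]); first exact: cl.
    by apply/funext => p; rewrite /mkset (_ : V p = 0 * p.1 + b^-1 * p.2 + 0)// /baryV; ring.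
  - rewrite (_ : mkset _ = [set p | e <= - 1 * p.1 + (a / b - b^-1) * p.2 + 1]); first exact: cl.
    by apply/funext => p; rewrite /mkset (_ : O p = - 1 * p.1 + (a / b - b^-1) * p.2 + 1)// /baryO /baryE /baryV; ring.
have suppC : closure [set p | tri_cutoff N p * F p != 0] `<=` C.
  have -> : C = closure C by apply/closure_id.
  apply: closure_subset => p /=.
  rewrite /tri_cutoff !mulf_eq0 !negb_or -!andbA => /and4P[h1 h2 h3 _].
  by split; [|split]; exact: cutoff_support.
have CT : C `<=` T.
  by move=> p [/= h1 [h2 h3]]; apply/(triE _ b_gt0); split; exact: lt_le_trans e0 _.
have Cbox : C `<=` box (1 + `|a| + b) by move=> p /CT; exact: tri_box.
split.
- by move=> p; have [] := C1_deriveE p CKF.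
- by rewrite D1; have [_ h _] := CKF; exact: h.
- by rewrite D2; have [_ _ h] := CKF; exact: h.
- apply: (subclosed_compact (@closed_closure _ _) _ (subset_trans suppC Cbox)).
  by apply: compact_setX; exact: segment_compact.
- exact: subset_trans suppC CT.
Qed.

Lemma square_integrable_L2 (Om : set (R * R)) (u : R * R -> R) :
  square_integrable Om u -> L2 (@area R) Om u.
Proof. by []. Qed.

Variables (u gx gy : R * R -> R).
Hypothesis uH1 : H1 T u gx gy.

Let Lu : L2 (@area R) T u.
Proof. by case: uH1 => h *; exact: square_integrable_L2. Qed.
Let Lgx : L2 (@area R) T gx.
Proof. by case: uH1 => _ h *; exact: square_integrable_L2. Qed.
Let Lgy : L2 (@area R) T gy.
Proof. by case: uH1 => _ _ h *; exact: square_integrable_L2. Qed.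
Let gt (p : R * R) := a * gx p + b * gy p.
Let mT : measurable (T : set (plane R)). Proof. exact: measurable_tri. Qed.
Let Tfin : (@area R T < +oo)%E. Proof. exact: area_tri_fin. Qed.
Let Lgt : L2 (@area R) T gt.
Proof. by have := L2D mT (L2Z mT a Lgx) (L2Z mT b Lgy). Qed.

Let int_bounded (h : R * R -> R) (g : R * R -> R) (B : R) : L2 (@area R) T h ->
  continuous g -> (forall p, `|g p| <= B) ->
  (@area R).-integrable T (EFin \o (fun p => h p * g p)).
Proof.
move=> Lh cg gB; apply: (integrableM_bounded mT (M := B)).
- exact: L2_integrable.
- by apply: measurable_funTS; exact: continuous_measurable_plane.
- by move=> p _; exact: gB.
Qed.

(** In the coordinates (s, t) the weak gradient of u is (gx, a gx + b gy), because x = s + a t and y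
    = b t. *)
Lemma weak_derivative_st phi phis phit : test_function T phi -> C1st phi phis phit ->
  [/\ (@area R).-integrable T (EFin \o (fun p => u p * phis p + gx p * phi p)),
      \int[@area R]_(p in T) (u p * phis p + gx p * phi p) = 0,
      (@area R).-integrable T
        (EFin \o (fun p => u p * phit p + (a * gx p + b * gy p) * phi p)) &
      \int[@area R]_(p in T) (u p * phit p + (a * gx p + b * gy p) * phi p) = 0].
Proof.
move=> tphi Cphi; have [D1 D2] := C1_derive Cphi; have [_ _ _ w1 w2] := uH1.
have W1 : \int[@area R]_(p in T) (u p * phis p) =
    - (\int[@area R]_(p in T) (gx p * phi p)).
  rewrite -(w1 _ tphi); apply: eq_Rintegral => p _.
  by have [_ -> _] := C1_deriveE p Cphi.
have W2 : \int[@area R]_(p in T) (u p * (b^-1 * (phit p - a * phis p))) =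
    - (\int[@area R]_(p in T) (gy p * phi p)).
  rewrite -(w2 _ tphi); apply: eq_Rintegral => p _.
  by have [_ _ ->] := C1_deriveE p Cphi.
have [_ c1 c2] := Cphi; have cphi := test_continuous tphi.
have bnd (g : R * R -> R) : continuous g ->
    (forall p, ~ closure [set p | phi p != 0] p -> g p = 0) ->
    exists B, forall p, `|g p| <= B.
  move=> cg g0; have cc : continuous (cst 1 : R * R -> R) by move=> ?; exact: cvg_cst.
  have [B BP] := test_bounded tphi cc g0 cg.
  by exists B => p; have := BP p; rewrite mul1r.
have [B0 B0P] := bnd _ cphi (@test0 _ phi).
have [B1 B1P] : exists B, forall p, `|phis p| <= B.
  apply: bnd => [|p np]; first exact: c1.
  by rewrite -(@test_derive0 _ phi e1 p np); have [_ -> _] := C1_deriveE p Cphi.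
have [B2 B2P] : exists B, forall p, `|b^-1 * (phit p - a * phis p)| <= B.
  apply: (bnd (fun p => b^-1 * (phit p - a * phis p))); first exact: c2.
  move=> p np; rewrite -(@test_derive0 _ phi e2 p np).
  by have [_ _ ->] := C1_deriveE p Cphi.
have i1 := int_bounded Lu c1 B1P.
have i2 := int_bounded Lu c2 B2P.
have ix := int_bounded Lgx cphi B0P.
have iy := int_bounded Lgy cphi B0P.
have S1 : \int[@area R]_(p in T) (u p * phis p + gx p * phi p) = 0.
  have /= -> := RintegralD mT i1 ix.
  by apply/eqP; rewrite addr_eq0; apply/eqP.
have S2 : \int[@area R]_(p in T)
    (u p * (b^-1 * (phit p - a * phis p)) + gy p * phi p) = 0.
  have /= -> := RintegralD mT i2 iy.
  by apply/eqP; rewrite addr_eq0; apply/eqP.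
have j1 := integrableZl mT a (integrableD mT i1 ix).
have j2 := integrableZl mT b (integrableD mT i2 iy).
have /= Z1 := RintegralZl a mT (integrableD mT i1 ix).
have /= Z2 := RintegralZl b mT (integrableD mT i2 iy).
have stE p : u p * phit p + (a * gx p + b * gy p) * phi p =
    a * (u p * phis p + gx p * phi p) +
    b * (u p * (b^-1 * (phit p - a * phis p)) + gy p * phi p) by field.
split; [exact: (integrableD mT i1 ix)|exact: S1| |].
  by apply: eq_integrable (integrableD mT j1 j2) => // p _ /=; rewrite stE.
have /= := RintegralD mT j1 j2.
by rewrite Z1 Z2 S1 S2 !mulr0 addr0 => <-; apply: eq_Rintegral => p _.
Qed.

End TangentialFields.

(** * Testing against tangential fields without boundary terms *)

Section NeumannCoefficients.
Context {R : realType}.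
Variables (a b : R).
Hypothesis b_gt0 : 0 < b.
Let b_neq0 : b != 0. Proof. by rewrite gt_eqF. Qed.
Local Notation T := (tri a b).
Local Notation E := (baryE a b).
Local Notation V := (baryV b).
Local Notation O := (baryO a b).
Variables (u gx gy : R * R -> R).
Hypothesis uH1 : H1 T u gx gy.
Let gt (p : R * R) := a * gx p + b * gy p.
Let mT : measurable (T : set (plane R)). Proof. exact: measurable_tri. Qed.
Let Tfin : (@area R T < +oo)%E. Proof. exact: area_tri_fin. Qed.
Let Lu : L2 (@area R) T u. Proof. by case: uH1. Qed.
Let Lgx : L2 (@area R) T gx. Proof. by case: uH1. Qed.
Let Lgy : L2 (@area R) T gy. Proof. by case: uH1. Qed.
Let Lgt : L2 (@area R) T gt.
Proof. by have := L2D mT (L2Z mT a Lgx) (L2Z mT b Lgy). Qed.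

Lemma normr_sinn_le m (x : R) : 0 <= x -> `|sinn m x| <= m%:R * pi * x.
Proof.
move=> x0; have B z : `|m%:R * pi * cosn m z| <= m%:R * pi :> R.
  by rewrite normrM (ger0_norm (mulr_ge0 _ (pi_ge0 R)))// ler_piMr ?normr_cosn ?mulr_ge0 ?pi_ge0.
have := lipschitz_derive x 0 (is_derive_sinn m) B.
by rewrite subr0 (ger0_norm x0) /sinn mulr0 sin0 subr0.
Qed.

Lemma sinn_1B m (x : R) : sinn m (1 - x) = - cos (m%:R * pi) * sinn m x.
Proof. by rewrite /sinn mulrBr mulr1 sinB sin_nat_pi; ring. Qed.

Lemma cosn_1B m (x : R) : cosn m (1 - x) = cos (m%:R * pi) * cosn m x.
Proof. by rewrite /cosn mulrBr mulr1 cosB sin_nat_pi; ring. Qed.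

Lemma sqr_cos_nat_pi m : cos (m%:R * pi) ^+ 2 = 1 :> R.
Proof. by rewrite cos2sin2 sin_nat_pi expr0n subr0. Qed.

Variables (m n : nat).
(** [A1] and [A2] are A and A o r in the coordinates (s, t); the field is ([A1], - [A2]) and its
    divergence is [A1s] - [A2t]. *)
Let A1 (p : R * R) := sinn m (E p) * cosn n (V p).
Let A2 (p : R * R) := sinn m (1 - V p) * cosn n (1 - E p).
Let A1s (p : R * R) := m%:R * pi * cosn m (E p) * cosn n (V p).
Let A2t (p : R * R) := - (m%:R * pi * cosn m (1 - V p)) * cosn n (1 - E p).

Let CA1 : C1st a b A1 A1s
  (fun p => sinn m (E p) * (- (n%:R * pi) * sinn n (V p))).
Proof.
have cs : continuous (fun x : R => m%:R * pi * cosn m x).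
  by move=> x; apply: cvgM; [exact: cvg_cst|exact: continuous_cosn].
have cc : continuous (fun x : R => - (n%:R * pi) * sinn n x).
  by move=> x; apply: cvgM; [exact: cvg_cst|exact: continuous_sinn].
have := C1stM (C1st_E a b_gt0 (is_derive_sinn m) cs) (C1st_V a b_gt0 (is_derive_cosn n) cc).
rewrite /C1st; congr C1; apply/funext => p; rewrite /A1s/=; ring.
Qed.

Let CA2 : C1st a b A2 (fun p => sinn m (1 - V p) * (n%:R * pi * sinn n (1 - E p))) A2t.
Proof.
have cs : continuous (fun x : R => m%:R * pi * cosn m x).
  by move=> x; apply: cvgM; [exact: cvg_cst|exact: continuous_cosn].
have cc : continuous (fun x : R => - (n%:R * pi) * sinn n x).
  by move=> x; apply: cvgM; [exact: cvg_cst|exact: continuous_sinn].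
have := C1stM (C1st_1V a b_gt0 (is_derive_sinn m) cs) (C1st_1E a b_gt0 (is_derive_cosn n) cc).
rewrite /C1st; congr C1; apply/funext => p; rewrite /A2t/=; ring.
Qed.

(** The weak divergence identity for the field multiplied by [tri_cutoff], an admissible pair of
    test functions. *)
Let F N (p : R * R) :=
  (u p * (tri_cutoff_s a b N p * A1 p + tri_cutoff a b N p * A1s p) +
     gx p * (tri_cutoff a b N p * A1 p)) -
  (u p * (tri_cutoff_t a b N p * A2 p + tri_cutoff a b N p * A2t p) +
     gt p * (tri_cutoff a b N p * A2 p)).

Let intF N : (@area R).-integrable T (EFin \o F N) /\ \int[@area R]_(p in T) F N p = 0.
Proof.
have t1 := tri_cutoff_test b_gt0 N CA1.
have t2 := tri_cutoff_test b_gt0 N CA2.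
have [i1 z1 _ _] := weak_derivative_st b_gt0 uH1 t1 (C1stM (C1st_tri_cutoff a b_gt0 N) CA1).
have [_ _ i2 z2] := weak_derivative_st b_gt0 uH1 t2 (C1stM (C1st_tri_cutoff a b_gt0 N) CA2).
split; first by have := integrableB mT i1 i2.
by have /= := RintegralB mT i1 i2; rewrite z1 z2 subr0.
Qed.

Let M : R := 4 * (m%:R * pi) + 4 * (m%:R * pi) + 4 * ((m + n)%:R * pi) + 2 * (m%:R * pi).

Let field_bound N p : T p ->
  `|(tri_cutoff_s a b N p * A1 p + tri_cutoff a b N p * A1s p) -
    (tri_cutoff_t a b N p * A2 p + tri_cutoff a b N p * A2t p)| <= M.
Proof.
move=> /(triE a b_gt0)[E0 V0 O0].
have mpi k : 0 <= k%:R * pi :> R by rewrite mulr_ge0 ?pi_ge0.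
have small (x y z B : R) : `|x| <= B -> `|y| <= 1 -> `|z| <= 1 -> `|x * y * z| <= B.
  move=> xB y1 z1; have B0 := le_trans (normr_ge0 x) xB.
  by rewrite !normrM -[B]mulr1 -[B]mulr1 !ler_pM// mulr_ge0.
have kE := normr_cutoff N (E p); have kV := normr_cutoff N (V p).
have kO := normr_cutoff N (O p).
have bE : `|dcutoff N (E p) * A1 p| <= 4 * (m%:R * pi).
  apply: dcutoff_bound => //; first exact: ltW.
  rewrite /A1 normrM -[leRHS]mulr1 ler_pM//; last exact: normr_cosn.
  by apply: normr_sinn_le; exact: ltW.
have bV : `|dcutoff N (V p) * A2 p| <= 4 * (m%:R * pi).
  apply: dcutoff_bound => //; first exact: ltW.
  rewrite /A2 normrM -[leRHS]mulr1 ler_pM//; last exact: normr_cosn.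
  rewrite sinn_1B normrM -[leRHS]mul1r ler_pM//.
    by rewrite normrN ler_norml cos_geN1 cos_le1.
  by apply: normr_sinn_le; exact: ltW.
(* [A1] and [A2] evaluate the same sine and cosine at arguments that differ by l_O, so their
   difference is of order l_O. *)
have bO : `|dcutoff N (O p) * (A1 p - A2 p)| <= 4 * ((m + n)%:R * pi).
  apply: dcutoff_bound => //; first exact: ltW.
  have Bs z : `|m%:R * pi * cosn m z| <= m%:R * pi :> R.
    by rewrite normrM (ger0_norm (mpi m)) ler_piMr ?normr_cosn.
  have Bc z : `|- (n%:R * pi) * sinn n z| <= n%:R * pi :> R.
    by rewrite normrM normrN (ger0_norm (mpi n)) ler_piMr ?normr_sinn.
  have := lipschitz_derive (E p) (1 - V p) (is_derive_sinn m) Bs.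
  have := lipschitz_derive (V p) (1 - E p) (is_derive_cosn n) Bc.
  have -> : V p - (1 - E p) = - O p by rewrite /baryO; ring.
  have -> : E p - (1 - V p) = - O p by rewrite /baryO; ring.
  rewrite normrN (gtr0_norm O0) => h1 h2.
  have -> : A1 p - A2 p = (sinn m (E p) - sinn m (1 - V p)) * cosn n (V p) +
      sinn m (1 - V p) * (cosn n (V p) - cosn n (1 - E p)) by rewrite /A1 /A2; ring.
  rewrite (le_trans (ler_normD _ _))// !normrM natrD !mulrDl lerD//.
    by rewrite -[leRHS]mulr1 ler_pM// normr_cosn.
  by rewrite -[leRHS]mul1r ler_pM// normr_sinn.
have bc : `|A1s p - A2t p| <= 2 * (m%:R * pi).
  have Bs z z' : `|m%:R * pi * cosn m z * cosn n z'| <= m%:R * pi :> R.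
    rewrite normrM -[leRHS]mulr1 ler_pM//; last exact: normr_cosn.
    by rewrite normrM (ger0_norm (mpi m)) ler_piMr ?normr_cosn.
  have B2 : `|A2t p| <= m%:R * pi by rewrite /A2t mulNr normrN; exact: Bs.
  have B1 : `|A1s p| <= m%:R * pi by exact: Bs.
  by rewrite (le_trans (ler_normB _ _))//; lra.
(* Grouped by sides: each derivative of a cutoff multiplies the component that vanishes on its side,
   namely [A1] on l_E = 0, [A2] on l_V = 0 and [A1] - [A2] on l_O = 0. *)
have -> : (tri_cutoff_s a b N p * A1 p + tri_cutoff a b N p * A1s p) -
    (tri_cutoff_t a b N p * A2 p + tri_cutoff a b N p * A2t p) =
    dcutoff N (E p) * A1 p * cutoff N (V p) * cutoff N (O p) -
    dcutoff N (V p) * A2 p * cutoff N (E p) * cutoff N (O p) -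
    dcutoff N (O p) * (A1 p - A2 p) * cutoff N (E p) * cutoff N (V p) +
    (A1s p - A2t p) * cutoff N (E p) * (cutoff N (V p) * cutoff N (O p)).
  by rewrite /tri_cutoff_s /tri_cutoff_t /tri_cutoff; ring.
rewrite (le_trans (ler_normD _ _))// lerD//; last first.
  by apply: small => //; rewrite normrM -[1]mulr1 ler_pM.
rewrite (le_trans (ler_normB _ _))// lerD//; last exact: small.
by rewrite (le_trans (ler_normB _ _))// lerD//; exact: small.
Qed.

(* The fields A1, A2 are cut off near the boundary. Where the gradient of the
   cutoff is of order N, the normal component of the field is of order 1/N, which
   is why dominated convergence applies (field_bound). *)
Lemma neumann_field_identity :
  (@area R).-integrable T (EFin \o (fun p =>
    u p * (A1s p - A2t p) + (gx p * A1 p - gt p * A2 p))) /\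
  (\int[@area R]_(p in T) (u p * (A1s p - A2t p) + (gx p * A1 p - gt p * A2 p)) = 0).
Proof.
have cvgF p : T p -> F ^~ p @ \oo -->
    u p * (A1s p - A2t p) + (gx p * A1 p - gt p * A2 p).
  move=> /(triE a b_gt0)[E0 V0 O0]; apply: cvg_near_cst.
  have := cutoff_eventually E0; have := cutoff_eventually V0.
  have := cutoff_eventually O0; apply: filterS3 => N [k1 d1] [k2 d2] [k3 d3].
  rewrite /F /tri_cutoff_s /tri_cutoff_t /tri_cutoff k1 k2 k3 d1 d2 d3; ring.
have mF N : measurable_fun (T : set (plane R)) (F N).
  by have [/measurable_int /measurable_EFinP] := intF N.
pose g p := `|u p| * M + `|gx p| + `|gt p|.
have ig : (@area R).-integrable T (EFin \o g).
  have iu := integrable_norm (L2_integrable mT Tfin Lu).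
  have igx := integrable_norm (L2_integrable mT Tfin Lgx).
  have igt := integrable_norm (L2_integrable mT Tfin Lgt).
  have := integrableD mT (integrableD mT (integrableZl mT M iu) igx) igt.
  by apply: eq_integrable => // p _ /=; rewrite !EFinD EFinM muleC.
have Fg N p : T p -> `|F N p| <= g p.
  move=> Tp; rewrite /F /g.
  have -> : forall x y z w : R, (u p * x + gx p * y) - (u p * z + gt p * w) =
    u p * (x - z) + gx p * y - gt p * w by move=> *; ring.
  have kb : `|tri_cutoff a b N p| <= 1.
    rewrite /tri_cutoff !normrM -[1]mulr1 ler_pM ?mulr_ge0 ?normr_cutoff//.
    by rewrite -[1]mulr1 ler_pM ?normr_cutoff.
  rewrite (le_trans (ler_normB _ _))// lerD//; last first.
    rewrite normrM ler_piMr// normrM -[1]mulr1 ler_pM//.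
    by rewrite normrM -[1]mulr1 ler_pM ?normr_cosn ?normr_sinn.
  rewrite (le_trans (ler_normD _ _))// lerD//.
    by rewrite normrM ler_wpM2l// field_bound.
  rewrite normrM ler_piMr// normrM -[1]mulr1 ler_pM//.
  by rewrite normrM -[1]mulr1 ler_pM ?normr_cosn ?normr_sinn.
have [iH cvgH] := Rintegral_cvg mT mF cvgF ig Fg.
split; first exact: iH.
rewrite -(cvg_lim (@Rhausdorff R) cvgH); apply: (cvg_lim (@Rhausdorff R)).
rewrite (_ : (fun k => _) = cst 0); first exact: cvg_cst.
by apply/funext => N; have [] := intF N.
Qed.

End NeumannCoefficients.

(** * The spectral inequality on the triangle *)

Section TriangleSpectral.
Context {R : realType}.
Variables (a b : R).
Hypothesis b_gt0 : 0 < b.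
Local Notation T := (tri a b).
Let mT : measurable (T : set (plane R)). Proof. exact: measurable_tri. Qed.
Let Tfin : (@area R T < +oo)%E. Proof. exact: area_tri_fin. Qed.
Let mS : measurable (@square R). Proof. exact: measurable_square. Qed.

Let coord := tri_coord a b.

Lemma measurable_tri_coord : measurable_fun [set: plane R] coord.
Proof.
have mE : measurable_fun [set: plane R] (baryE a b).
  have := @measurable_affine R 1 (- (a / b)) 0; congr measurable_fun.
  by apply/funext => p; rewrite /baryE; ring.
have mV : measurable_fun [set: plane R] (baryV b).
  have := @measurable_affine R 0 b^-1 0; congr measurable_fun.
  by apply/funext => p; rewrite /baryV; ring.
exact: measurable_fun_pair.
Qed.

Lemma measurable_hypo_refl : measurable_fun [set: plane R] (@hypo_refl R).
Proof. by case: (@scales_area_hypo_refl R). Qed.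

(* Up to a factor b, the pull-back to the triangle of integration against F
   over the square. *)
Lemma ip_unfold (f g F : plane R -> R) :
  L2 (@area R) T f -> L2 (@area R) T g -> measurable_fun [set: plane R] F ->
  (forall p, `|F p| <= 1) ->
  ip (@area R) square (unfold a b f g) F =
  b^-1 * (ip (@area R) T f (F \o coord) +
          ip (@area R) T g (F \o (@hypo_refl R) \o coord)).
Proof.
move=> Lf Lg mF F1; have mc := measurable_tri_coord; have mr := measurable_hypo_refl.
have LF (H : plane R -> plane R) : measurable_fun [set: plane R] H ->
    L2 (@area R) T (F \o H).
  move=> mH; apply: (@L2_bounded _ _ _ _ _ mT _ 1) => //.
    by apply: measurable_funTS; exact: measurableT_comp.
  by move=> p _; exact: F1.
rewrite /ip; under eq_Rintegral do rewrite (unfoldMr a b_gt0).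
rewrite (Rintegral_unfold b_gt0)//.
  by have := L2M mT Lf (LF _ mc).
by have := L2M mT Lg (LF _ (measurableT_comp mr mc)).
Qed.

Lemma ip_unfold_unfold (f g : plane R -> R) :
  L2 (@area R) T f -> L2 (@area R) T g ->
  ip (@area R) square (unfold a b f g) (unfold a b f g) =
  b^-1 * (ip (@area R) T f f + ip (@area R) T g g).
Proof.
move=> Lf Lg; rewrite /ip; under eq_Rintegral do rewrite (unfoldM a b_gt0).
rewrite (Rintegral_unfold b_gt0)//.
  by have := L2M mT Lf Lf.
by have := L2M mT Lg Lg.
Qed.

Let mcos m n : measurable_fun [set: plane R] (@cosn2 R m n).
Proof. by apply: measurable_prodfun; exact: continuous_cosn. Qed.
Let cos1 m n p : `|@cosn2 R m n p| <= 1.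
Proof. by apply: normr_prodfun => x; exact: normr_cosn. Qed.
Let msin m n : measurable_fun [set: plane R] (@sincosn R m n).
Proof. by apply: measurable_prodfun; [exact: continuous_sinn|exact: continuous_cosn]. Qed.
Let sin1 m n p : `|@sincosn R m n p| <= 1.
Proof. by apply: normr_prodfun => x; [exact: normr_sinn|exact: normr_cosn]. Qed.

Lemma cosn2_refl m n p : cosn2 m n (hypo_refl p) =
  cos (m%:R * pi) * cos (n%:R * pi) * cosn2 n m p :> R.
Proof. by rewrite /cosn2 /= !cosn_1B; ring. Qed.

Definition tri_coef (u : plane R -> R) m n : R :=
  ip (@area R) square (unfold a b u u) (cosn2 m n).

(** The unfolded u is invariant under r, while r turns [cosn2 m n] into [cosn2 n m] times cos (m pi)
    cos (n pi), whose square is 1. *)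
Lemma sqr_tri_coefC u m n : L2 (@area R) T u ->
  tri_coef u m n ^+ 2 = tri_coef u n m ^+ 2.
Proof.
move=> Lu; rewrite /tri_coef !ip_unfold//.
have coefE k l : ip (@area R) T u (cosn2 k l \o (@hypo_refl R) \o coord) =
    cos (k%:R * pi) * cos (l%:R * pi) * ip (@area R) T u (cosn2 l k \o coord).
  have Lc : L2 (@area R) T (cosn2 l k \o coord).
    apply: (@L2_bounded _ _ _ _ _ mT _ 1) => //; last by move=> p _; exact: cos1.
    apply: measurable_funTS; apply: measurableT_comp => //.
    exact: measurable_tri_coord.
  have := RintegralZl (cos (k%:R * pi) * cos (l%:R * pi)) mT (L2M mT Lu Lc) => /= <-.
  by apply: eq_Rintegral => p _; rewrite /= cosn2_refl; ring.
rewrite !coefE; set x := ip _ _ _ _; set y := ip _ _ _ _.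
have := @sqr_cos_nat_pi R m; have := @sqr_cos_nat_pi R n.
set c := cos (m%:R * pi); set d := cos (n%:R * pi) => d2 c2.
have -> : b^-1 * (x + c * d * y) = c * d * (b^-1 * (y + d * c * x)).
  transitivity (b^-1 * (d ^+ 2 * c ^+ 2 * x + c * d * y)).
    by rewrite d2 c2 !mul1r.
  by ring.
by rewrite !exprMn c2 d2 !mul1r.
Qed.

(** This is [neumann_field_identity] read on the square: [A1s] - [A2t] is m pi times the sum of
    [cosn2 m n] over the two copies, and the gradient term pairs the unfolding of (gx, - gt) with
    [sincosn m n], where gt = a gx + b gy. *)
Lemma tri_coef_derivative u gx gy m n : H1 T u gx gy ->
  m%:R * pi * tri_coef u m n = - ip (@area R) square
    (unfold a b gx (fun p => - (a * gx p + b * gy p))) (sincosn m n).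
Proof.
move=> uH1; have [Lu Lgx Lgy _ _] := uH1.
have Lgt : L2 (@area R) T (fun p => - (a * gx p + b * gy p)).
  have := L2Z mT (-1) (L2D mT (L2Z mT a Lgx) (L2Z mT b Lgy)).
  by congr L2; apply/funext => p; exact: mulN1r.
rewrite /tri_coef !ip_unfold//.
have bnd (F : plane R -> R) (H : plane R -> plane R) :
    measurable_fun [set: plane R] F -> (forall p, `|F p| <= 1) ->
    measurable_fun [set: plane R] H -> L2 (@area R) T (F \o H).
  move=> mF F1 mH; apply: (@L2_bounded _ _ _ _ _ mT _ 1) => //.
    by apply: measurable_funTS; exact: measurableT_comp.
  by move=> p _; exact: F1.
have mc := measurable_tri_coord; have mrc := measurableT_comp measurable_hypo_refl mc.
have i1 := L2M mT Lu (bnd _ _ (mcos m n) (cos1 m n) mc).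
have i2 := L2M mT Lu (bnd _ _ (mcos m n) (cos1 m n) mrc).
have j1 := L2M mT Lgx (bnd _ _ (msin m n) (sin1 m n) mc).
have j2 := L2M mT Lgt (bnd _ _ (msin m n) (sin1 m n) mrc).
apply/eqP; rewrite -addr_eq0 mulrCA -mulrDr mulf_eq0; apply/orP; right; apply/eqP.
have [_ H0] := neumann_field_identity b_gt0 uH1 m n; rewrite -[RHS]H0.
rewrite /ip -(RintegralD mT i1 i2) -(RintegralD mT j1 j2).
have /= <- := RintegralZl (m%:R * pi) mT (integrableD mT i1 i2).
have /= <- := RintegralD mT (integrableZl mT (m%:R * pi) (integrableD mT i1 i2))
  (integrableD mT j1 j2).
by apply: eq_Rintegral => p _; rewrite /cosn2 /sincosn /=; ring.
Qed.

(** The factor 2 on the left counts the two copies of T. The constant comes from gx^2 + (a gx + b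
    gy)^2 <= 2 (1 + a^2 + b^2) (gx^2 + gy^2). *)
Lemma tri_spectral u gx gy N : (0 < N)%N -> H1 T u gx gy ->
  2 * ip (@area R) T u u <=
  \sum_(m < N) \sum_(n < N) b * tri_coef u m n ^+ 2 / (cosw m * cosw n) +
  2 / (pi * N%:R) ^+ 2 * (2 * (1 + a ^+ 2 + b ^+ 2)) *
  (ip (@area R) T gx gx + ip (@area R) T gy gy).
Proof.
move=> N0 uH1; have [Lu Lgx Lgy _ _] := uH1.
have Lgt : L2 (@area R) T (fun p => - (a * gx p + b * gy p)).
  have := L2Z mT (-1) (L2D mT (L2Z mT a Lgx) (L2Z mT b Lgy)).
  by congr L2; apply/funext => p; exact: mulN1r.
have gt_le : ip (@area R) T (fun p => - (a * gx p + b * gy p))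
      (fun p => - (a * gx p + b * gy p)) <=
    2 * a ^+ 2 * ip (@area R) T gx gx + 2 * b ^+ 2 * ip (@area R) T gy gy.
  have ix := L2M mT Lgx Lgx; have iy := L2M mT Lgy Lgy.
  have := RintegralZl (2 * a ^+ 2) mT ix; have := RintegralZl (2 * b ^+ 2) mT iy.
  rewrite /ip => <- <-.
  have /= <- := RintegralD mT (integrableZl mT (2 * a ^+ 2) ix) (integrableZl mT (2 * b ^+ 2) iy).
  apply: le_Rintegral => //; first exact: (L2M mT Lgt Lgt).
    exact: (integrableD mT (integrableZl mT (2 * a ^+ 2) ix) (integrableZl mT (2 * b ^+ 2) iy)).
  move=> p _; rewrite -subr_ge0 (_ : _ - _ = (a * gx p - b * gy p) ^+ 2) ?sqr_ge0//.
  by ring.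
have := square_spectral N0 (L2_unfold b_gt0 Lu Lu) (L2_unfold b_gt0 Lgx Lgt)
  (fun m n => etrans (congr1 (fun x => x ^+ 2) (tri_coef_derivative m n uH1)) (sqrrN _))
  (fun m n => sqr_tri_coefC m n Lu).
rewrite !ip_unfold_unfold//; set c := 2 / _; set S := \sum_(m < N) _.
have -> : \sum_(m < N) \sum_(n < N) b * tri_coef u m n ^+ 2 / (cosw m * cosw n) = b * S.
  rewrite mulr_sumr; apply: eq_bigr => m _; rewrite mulr_sumr.
  by apply: eq_bigr => n _; rewrite mulrA.
have c0 : 0 <= c by rewrite divr_ge0// sqr_ge0.
have gx0 := ip_ge0 (@area R) T gx; have gy0 := ip_ge0 (@area R) T gy.
move: gt_le gx0 gy0; set w := ip _ _ _ _.
move: (ip (@area R) T u u) (ip (@area R) T gx gx) (ip (@area R) T gy gy).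
move=> x y z gt_le y0 z0.
rewrite -(ler_pM2l b_gt0) => h.
have h1 : 2 * x <= b * S + c * (y + w).
  move: h; rewrite (mulVKf (lt0r_neq0 b_gt0)) => h.
  apply: le_trans (_ : x + x <= _); first by lra.
  apply: le_trans h _; rewrite mulrDr lerD2l le_eqVlt; apply/orP; left.
  by apply/eqP; field; rewrite gt_eqF.
apply: (le_trans h1); rewrite lerD2l -mulrA ler_wpM2l//.
have a2 := sqr_ge0 a; have b2 := sqr_ge0 b.
have : 0 <= a ^+ 2 * z by rewrite mulr_ge0.
have : 0 <= b ^+ 2 * y by rewrite mulr_ge0.
by lra.
Qed.

End TriangleSpectral.

(** * The Sobolev space of the triangle *)

Section SobolevSpace.
Context {R : realType}.
Variables (a b : R).
Hypothesis b_gt0 : 0 < b.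
Local Notation T := (tri a b).
Let mT : measurable (T : set (plane R)). Proof. exact: measurable_tri. Qed.
Let Tfin : (@area R T < +oo)%E. Proof. exact: area_tri_fin. Qed.

Lemma test_L2 (phi : R * R -> R) : test_function T phi ->
  [/\ L2 (@area R) T phi, L2 (@area R) T ('D_e1 phi) & L2 (@area R) T ('D_e2 phi)].
Proof.
move=> tphi; have cc : continuous (cst 1 : R * R -> R) by move=> ?; exact: cvg_cst.
have bnd (g : R * R -> R) : continuous g ->
    (forall p, ~ closure [set p | phi p != 0] p -> g p = 0) -> L2 (@area R) T g.
  move=> cg g0; have [B BP] := test_bounded tphi cc g0 cg.
  apply: (@L2_bounded _ _ _ _ _ mT _ B) => //.
    by apply: measurable_funTS; exact: continuous_measurable_plane.
  by move=> p _; have := BP p; rewrite mul1r.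
have [_ c1 c2 _ _] := tphi; split.
- by apply: bnd; [exact: test_continuous tphi|exact: test0].
- by apply: bnd; [exact: c1|exact: test_derive0].
- by apply: bnd; [exact: c2|exact: test_derive0].
Qed.

Lemma weak_derivativeP (e : R * R) (u g : R * R -> R) :
  weak_derivative T e u g <-> forall phi, test_function T phi ->
    ip (@area R) T u ('D_e phi) = - ip (@area R) T g phi.
Proof. by []. Qed.

Lemma H1_linear c u gx gy v hx hy : H1 T u gx gy -> H1 T v hx hy ->
  H1 T (c *: u + v) (c *: gx + hx) (c *: gy + hy).
Proof.
move=> [Lu Lgx Lgy u1 u2] [Lv Lhx Lhy v1 v2].
have LD (f g : R * R -> R) : L2 (@area R) T f -> L2 (@area R) T g ->
    L2 (@area R) T (c *: f + g) by move=> Lf Lg; apply: L2D => //; exact: L2Z.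
split; [exact: LD|exact: LD|exact: LD| |]; apply/weak_derivativeP => phi tphi;
  have [L0 L1 L2'] := test_L2 tphi; rewrite !(ip_linear mT)//.
  have /weak_derivativeP -> // := u1; have /weak_derivativeP -> // := v1; ring.
have /weak_derivativeP -> // := u2; have /weak_derivativeP -> // := v2; ring.
Qed.

Lemma C1_H1 v vx vy : C1 v vx vy -> H1 T v vx vy.
Proof.
move=> Cv; have [w1 w2] := C1_weak_derivative mT Tfin Cv.
have [_ cvx cvy] := Cv; have cv := C1_continuous Cv.
have L2c (g : R * R -> R) : continuous g -> L2 (@area R) T g.
  move=> cg; have cb : compact (box (1 + `|a| + b) : set (R * R)).
    by apply: compact_setX; exact: segment_compact.
  have [B BP] := continuous_compact_bounded cg cb.
  apply: (@L2_bounded _ _ _ _ _ mT _ B) => //.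
    by apply: measurable_funTS; exact: continuous_measurable_plane.
  by move=> p Tp; apply: BP; exact: tri_box.
by split => //; exact: L2c.
Qed.

Lemma H10 : H1 T 0 0 0.
Proof. exact: C1_H1 (C1_cst 0). Qed.

Lemma H1_one : H1 T (cst 1) 0 0.
Proof. exact: C1_H1 (C1_cst 1). Qed.

(** For a fixed test function both sides of the defining identity are continuous in L^2, by
    Cauchy-Schwarz. *)
Lemma weak_derivative_limit (e : R * R) (u g : R * R -> R) (u_ g_ : nat -> R * R -> R) :
  e = e1 \/ e = e2 ->
  L2 (@area R) T u -> L2 (@area R) T g ->
  (forall k, L2 (@area R) T (u_ k)) -> (forall k, L2 (@area R) T (g_ k)) ->
  (forall k, weak_derivative T e (u_ k) (g_ k)) ->
  (forall k, ip (@area R) T (u - u_ k) (u - u_ k) <= 4^-1 ^+ k) ->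
  (forall k, ip (@area R) T (g - g_ k) (g - g_ k) <= 4^-1 ^+ k) ->
  weak_derivative T e u g.
Proof.
move=> eE Lu Lg Lu_ Lg_ wd uu gg; apply/weak_derivativeP => phi tphi.
have [L0 L1 L2'] := test_L2 tphi.
have LDe : L2 (@area R) T ('D_e phi) by case: eE => ->.
apply/eqP; rewrite -addr_eq0; apply/eqP.
pose A := ip (@area R) T ('D_e phi) ('D_e phi); pose B := ip (@area R) T phi phi.
have A0 : 0 <= A by exact: ip_ge0.
have B0 : 0 <= B by exact: ip_ge0.
have cs (f f_ h : R * R -> R) k : L2 (@area R) T f -> L2 (@area R) T f_ ->
    L2 (@area R) T h -> ip (@area R) T (f - f_) (f - f_) <= 4^-1 ^+ k ->
    `|ip (@area R) T (f - f_) h| <= 2^-1 ^+ k * (ip (@area R) T h h + 1).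
  move=> Lf Lf_ Lh fk; have h0 : 0 <= ip (@area R) T h h by exact: ip_ge0.
  rewrite -(ler_pXn2r (ltn0Sn 1)) ?nnegrE ?normr_ge0 ?mulr_ge0 ?exprn_ge0 ?addr_ge0//.
  rewrite real_normK ?num_real//.
  rewrite (le_trans (ip_cauchy_schwarz mT (L2B mT Lf Lf_) Lh))// exprMn.
  have -> : (2^-1 ^+ k) ^+ 2 = 4^-1 ^+ k :> R by rewrite exprAC; congr (_ ^+ _); field.
  have k0 : 0 <= 4^-1 ^+ k :> R by rewrite exprn_ge0.
  rewrite (le_trans (ler_wpM2r h0 fk))// ler_wpM2l//.
  have le_sqr (t : R) : 0 <= t -> t <= (t + 1) ^+ 2 by move=> t0; nra.
  exact: le_sqr.
apply: (@eqr0_geometric _ _ (A + 1 + (B + 1))) => [|k]; first by rewrite !addr_ge0.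
have Bl f f_ h : L2 (@area R) T f -> L2 (@area R) T f_ -> L2 (@area R) T h ->
    ip (@area R) T (f - f_) h = ip (@area R) T f h - ip (@area R) T f_ h.
  move=> Lf Lf_ Lh; have := ip_linear mT (- 1) Lf_ Lf Lh.
  by rewrite scaleN1r (addrC (- f_)) => ->; ring.
have /weak_derivativeP wdk := wd k.
have -> : ip (@area R) T u ('D_e phi) + ip (@area R) T g phi =
    ip (@area R) T (u - u_ k) ('D_e phi) + ip (@area R) T (g - g_ k) phi.
  by rewrite !Bl// wdk//; ring.
by rewrite (le_trans (ler_normD _ _))// mulrDr lerD//; apply: cs.
Qed.

(** An element is a function together with a weak gradient, so that the energy is a bilinear form in
    the element. The proof of 0 < b is an argument for the sake of the inferred submodule
    structure. *)
Definition H1pred (_ : 0 < b) : {pred (R * R -> R) * (R * R -> R) * (R * R -> R)} :=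
  [pred x | `[< H1 T x.1.1 x.1.2 x.2 >]].

Fact H1pred_submod_closed : submod_closed (H1pred b_gt0).
Proof.
split; first by apply/asboolP; exact: H10.
move=> c [[u gx] gy] [[v hx] hy] /asboolP Hx /asboolP Hy; apply/asboolP.
have := H1_linear c Hx Hy.
rewrite (_ : c *: (u, gx, gy) + (v, hx, hy) = (c *: u + v, c *: gx + hx, c *: gy + hy)).
  by [].
by [].
Qed.

End SobolevSpace.

HB.instance Definition _ (R : realType) (a b : R) (b_gt0 : 0 < b) :=
  GRing.isSubmodClosed.Build R _ (H1pred a b_gt0) (H1pred_submod_closed a b_gt0).

Definition H1space (R : realType) (a b : R) (b_gt0 : 0 < b) :=
  {x : (R * R -> R) * (R * R -> R) * (R * R -> R) | x \in H1pred a b_gt0}.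

HB.instance Definition _ (R : realType) (a b : R) (b_gt0 : 0 < b) :=
  SubChoice.on (H1space a b_gt0).
HB.instance Definition _ (R : realType) (a b : R) (b_gt0 : 0 < b) :=
  [SubChoice_isSubLmodule of H1space a b_gt0 by <:].

(** The coefficients have two indices, but the functionals of [compact_embedding] have one. *)
Lemma sum_divn_modn (V : nmodType) N M (F : nat -> nat -> V) :
  \sum_(i < N * M) F (i %/ M)%N (i %% M)%N = \sum_(m < N) \sum_(n < M) F m n.
Proof.
rewrite -(big_mkord xpredT (fun i => F (i %/ M)%N (i %% M)%N)) big_nat_mul big_mkord.
apply: eq_bigr => m _; rewrite mulSn -{1}[(m * M)%N]add0n big_addn addnK big_mkord.
apply: eq_bigr => n _; have M0 : (0 < M)%N by case: (M) n => // -[].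
by rewrite addnC divnMDl// modnMDl modn_small// divn_small// addn0.
Qed.

(** * Existence of the second eigenvalue and the Rayleigh bound *)

Section Existence.
Context {R : realType}.
Variables (a b : R).
Hypothesis b_gt0 : 0 < b.
Local Notation T := (tri a b).
Local Notation W := (H1space a b_gt0).
Let mT : measurable (T : set (plane R)). Proof. exact: measurable_tri. Qed.
Let Tfin : (@area R T < +oo)%E. Proof. exact: area_tri_fin. Qed.
Local Notation "<< f , g >>" := (ip (@area R) T f g).

Definition H1pack u gx gy (uH1 : H1 T u gx gy) : W :=
  exist _ (u, gx, gy) (introT (asboolP (H1 T _ _ _)) uH1).

Lemma H1spaceP (x : W) : H1 T (val x).1.1 (val x).1.2 (val x).2.
Proof. by have /asboolP := valP x. Qed.

Definition mass_form (x y : W) := <<(val x).1.1, (val y).1.1>>.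

Definition energy_form (x y : W) :=
  <<(val x).1.2, (val y).1.2>> + <<(val x).2, (val y).2>>.

Let L1 (x : W) : L2 (@area R) T (val x).1.1. Proof. by case: (H1spaceP x). Qed.
Let L2' (x : W) : L2 (@area R) T (val x).1.2. Proof. by case: (H1spaceP x). Qed.
Let L3 (x : W) : L2 (@area R) T (val x).2. Proof. by case: (H1spaceP x). Qed.

Lemma mass_formP : semi_inner_product mass_form.
Proof.
split=> [c x y z|x y|x].
- by rewrite /mass_form -(ip_linear mT c (L1 x) (L1 y) (L1 z)).
- by rewrite /mass_form ipC.
- exact: ip_ge0.
Qed.

Lemma energy_formP : semi_inner_product energy_form.
Proof.
split=> [c x y z|x y|x].
- rewrite /energy_form mulrDr addrACA; congr (_ + _).
    by rewrite -(ip_linear mT c (L2' x) (L2' y) (L2' z)).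
  by rewrite -(ip_linear mT c (L3 x) (L3 y) (L3 z)).
- by rewrite /energy_form ipC (ipC (@area R) T (val x).2).
- by rewrite addr_ge0// ip_ge0.
Qed.

Lemma H1_complete (x_ : nat -> W) :
  (forall k j, (k <= j)%N -> mass_form (x_ j - x_ k) (x_ j - x_ k) +
     energy_form (x_ j - x_ k) (x_ j - x_ k) <= 4^-1 ^+ k) ->
  exists x, forall k, mass_form (x - x_ k.+1) (x - x_ k.+1) +
    energy_form (x - x_ k.+1) (x - x_ k.+1) <= 4^-1 ^+ k.
Proof.
move=> fast.
have fast3 k j : (k <= j)%N ->
  [/\ <<(val (x_ j)).1.1 - (val (x_ k)).1.1, (val (x_ j)).1.1 - (val (x_ k)).1.1>> <= 4^-1 ^+ k,
  <<(val (x_ j)).1.2 - (val (x_ k)).1.2, (val (x_ j)).1.2 - (val (x_ k)).1.2>> <= 4^-1 ^+ k &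
  <<(val (x_ j)).2 - (val (x_ k)).2, (val (x_ j)).2 - (val (x_ k)).2>> <= 4^-1 ^+ k].
  have le3 (r s t e : R) : 0 <= r -> 0 <= s -> 0 <= t -> r + (s + t) <= e ->
      [/\ r <= e, s <= e & t <= e] by split; lra.
  move=> kj; apply: (le3 _ _ _ _ (ip_ge0 _ _ _) (ip_ge0 _ _ _) (ip_ge0 _ _ _)).
  exact: (fast k j kj).
have [u [Lu uP]] := L2_complete mT (fun k => L1 (x_ k))
  (fun k j kj => let: And3 h _ _ := fast3 k j kj in h).
have [gx [Lgx gxP]] := L2_complete mT (fun k => L2' (x_ k))
  (fun k j kj => let: And3 _ h _ := fast3 k j kj in h).
have [gy [Lgy gyP]] := L2_complete mT (fun k => L3 (x_ k))
  (fun k j kj => let: And3 _ _ h := fast3 k j kj in h).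
have uH1 : H1 T u gx gy.
  split=> //.
  - apply: (weak_derivative_limit b_gt0 (or_introl erefl) Lu Lgx (fun k => L1 (x_ k)) (fun k => L2' (x_ k)) _ uP gxP).
    by move=> k; case: (H1spaceP (x_ k)).
  - apply: (weak_derivative_limit b_gt0 (or_intror erefl) Lu Lgy (fun k => L1 (x_ k)) (fun k => L3 (x_ k)) _ uP gyP).
    by move=> k; case: (H1spaceP (x_ k)).
exists (H1pack uH1) => k.
rewrite /mass_form /energy_form.
have h1 := uP k.+1; have h2 := gxP k.+1; have h3 := gyP k.+1.
have k0 : 0 <= 4^-1 ^+ k :> R by rewrite exprn_ge0.
apply: (@le_trans _ _ (4^-1 ^+ k.+1 + (4^-1 ^+ k.+1 + 4^-1 ^+ k.+1))).
  by apply: lerD => //; exact: lerD.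
by rewrite exprS; lra.
Qed.

Lemma tri_coefB u v m n : L2 (@area R) T u -> L2 (@area R) T v ->
  tri_coef a b (u - v) m n = tri_coef a b u m n - tri_coef a b v m n.
Proof.
move=> Lu Lv; have mS := @measurable_square R.
rewrite /tri_coef; have := ip_linear mS (- 1) (L2_unfold b_gt0 Lv Lv) (L2_unfold b_gt0 Lu Lu) (@L2_cosn2 R m n).
rewrite mulN1r [X in _ = X -> _]addrC => <-; congr ip; apply/funext => p.
transitivity (- unfold a b v v p + unfold a b u u p); last by rewrite -[- unfold a b v v p]mulN1r.
have subE q : (u - v) q = u q - v q by [].
have point0 : point = 0 :> R by [].
by rewrite /unfold !patchE; do 2 case: ifP => _ /=; rewrite ?subE ?point0; ring.
Qed.

Lemma sqr_tri_coef_le u m n : L2 (@area R) T u ->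
  b / (2 * (cosw m * cosw n)) * tri_coef a b u m n ^+ 2 <= <<u, u>>.
Proof.
move=> Lu; have mS := @measurable_square R.
have cw : 0 < cosw m * cosw n :> R by rewrite mulr_gt0// cosw_gt0.
have := ip_cauchy_schwarz mS (L2_unfold b_gt0 Lu Lu) (@L2_cosn2 R m n).
rewrite ip_unfold_unfold// ip_cosn2 eqxx mul1r => h.
have c0 : 0 < b / (2 * (cosw m * cosw n)) by rewrite divr_gt0// mulr_gt0.
move: h; rewrite -(ler_pM2l c0) => /le_trans; apply; rewrite le_eqVlt; apply/orP; left.
by apply/eqP; field; rewrite !gt_eqF ?cosw_gt0.
Qed.

Lemma compact_mass eps : 0 < eps -> exists (K : nat) (l : nat -> W -> R) (C : R),
  [/\ forall i x y, l i (x - y) = l i x - l i y,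
      forall i x, l i x ^+ 2 <= C * mass_form x x &
      forall x, mass_form x x <= \sum_(i < K) l i x ^+ 2 + eps * energy_form x x].
Proof.
move=> eps0; pose c := 2 * (1 + a ^+ 2 + b ^+ 2).
have c0 : 0 < c by rewrite mulr_gt0// -addrA ltr_pwDl// addr_ge0// sqr_ge0.
(* Since c / eps < N <= (pi N)^2, the factor of the energy in [tri_spectral] drops below eps, up to
   the factor 2 common to both sides. *)
pose N := (Num.trunc (c / eps)).+1.
have N_gt : c / eps < N%:R by rewrite truncnS_gt.
have N1 : 1 <= N%:R :> R by rewrite ler1n.
have pi1 : 1 <= pi :> R by apply: le_trans (pi_ge2 R); rewrite ler1n.
have piN : c / (pi * N%:R) ^+ 2 <= eps.
  rewrite ler_pdivrMr ?exprn_gt0 ?mulr_gt0 ?pi_gt0//.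
  rewrite ltr_pdivrMr// in N_gt; apply: (le_trans (ltW N_gt)).
  rewrite [leLHS]mulrC ler_pM2l//.
  have piNN : N%:R <= pi * N%:R :> R by rewrite ler_peMl.
  by rewrite (le_trans piNN)// expr2 ler_peMl// (le_trans _ piNN)// (le_trans ler01).
(* Half the weight of [tri_spectral], whose left side carries the mass twice; [sqr_tri_coef_le] uses
   this normalization, so C = 1. *)
pose d m n : R := b / (2 * (cosw m * cosw n)).
have d0 m n : 0 <= d m n.
  by rewrite divr_ge0 ?mulr_ge0 ?ltW// cosw_gt0.
exists (N * N)%N, (fun i x => Num.sqrt (d (i %/ N)%N (i %% N)%N) *
  tri_coef a b (val x).1.1 (i %/ N)%N (i %% N)%N), 1; split.
- move=> i x y; rewrite -mulrBr; congr (_ * _).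
  exact: (tri_coefB _ _ (L1 x) (L1 y)).
- move=> i x; rewrite exprMn sqr_sqrtr// mul1r; exact: sqr_tri_coef_le.
move=> x; under eq_bigr do rewrite exprMn sqr_sqrtr//.
rewrite (sum_divn_modn N N (fun m n => d m n * tri_coef a b (val x).1.1 m n ^+ 2)).
have h := tri_spectral b_gt0 (ltn0Sn _ : (0 < N)%N) (H1spaceP x).
rewrite -(@ler_pM2l _ 2)// (le_trans h)//.
rewrite [leRHS]mulrDr lerD//.
  rewrite mulr_sumr ler_sum// => m _; rewrite mulr_sumr ler_sum// => n _.
  rewrite le_eqVlt; apply/orP; left; apply/eqP; rewrite /d; field.
  by rewrite !gt_eqF ?cosw_gt0.
rewrite [leRHS]mulrA /energy_form ler_wpM2r ?addr_ge0 ?ip_ge0//.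
by rewrite mulrAC -mulrA ler_pM2l// mulrC mulrA.
Qed.

Let one : W := H1pack (H1_one a b_gt0).

(** This is [tri_spectral] with N = 1: the only coefficient left is the mean of the unfolded
    function. *)
Lemma tri_poincare : exists2 P, 0 < P &
  forall x, mass_form x one = 0 -> mass_form x x <= P * energy_form x x.
Proof.
exists (2 / (pi * 1%:R) ^+ 2 * (2 * (1 + a ^+ 2 + b ^+ 2))).
  rewrite mulr_gt0 ?divr_gt0 ?exprn_gt0 ?mulr_gt0 ?pi_gt0//.
  by rewrite -addrA ltr_pwDl// addr_ge0// sqr_ge0.
move=> x x1; have := tri_spectral b_gt0 (ltn0Sn 0) (H1spaceP x).
rewrite !big_ord1.
have -> : tri_coef a b (val x).1.1 0 0 = 0.
  have cosn2_one : @cosn2 R 0 0 = cst 1.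
    by apply/funext => p; rewrite /cosn2 /cosn !mul0r cos0 mulr1.
  rewrite /tri_coef ip_unfold ?cosn2_one//; last by move=> p; rewrite normr1.
  rewrite !(_ : forall H : plane R -> plane R, cst 1 \o H = cst 1)//.
  by rewrite [ip _ _ _ _]x1 addr0 mulr0.
rewrite expr0n mulr0 mul0r add0r => /(le_trans _); apply.
by rewrite /mass_form ler_peMl ?ip_ge0// ler1n.
Qed.

Lemma ae_eq0P u : L2 (@area R) T u ->
  {ae @area R, forall p, T p -> u p = 0} <-> <<u, u>> = 0.
Proof.
move=> Lu; split=> [u0|/(ip_ae0 mT Lu)//].
have mu2' : measurable_fun T (fun p => (u p ^+ 2)%:E).
  by apply/measurable_EFinP/measurable_funX; exact: L2_measurable Lu.
have := ipE mT Lu; rewrite (ae_eq_integral (cst 0%E) _ mT mu2')//.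
  by rewrite integral0 => -[].
by apply: filterS u0 => p up /up ->; rewrite expr0n.
Qed.

Theorem mu2_le_rayleigh w wx wy Lambda : H1 T w wx wy ->
  <<w, cst 1>> = 0 -> 0 < <<w, w>> ->
  <<wx, wx>> + <<wy, wy>> <= Lambda * <<w, w>> ->
  exists2 mu2 : R, is_mu2 T mu2 & mu2 <= Lambda.
Proof.
move=> wH1 w1 w0 wLambda.
have [P P0 poincare] := tri_poincare.
have one0 : 0 < mass_form one one.
  (* T has positive area: otherwise w, like every function on T, would have zero mass. *)
  rewrite lt_neqAle ip_ge0 andbT eq_sym; apply/eqP => one0.
  have : <<w, w>> = 0.
    apply/ae_eq0P; first by case: wH1.
    have : {ae @area R, forall p, T p -> (1 : R) = 0}.
      by apply/(ae_eq0P (u := cst 1)); [case: (H1_one a b_gt0)|exact: one0].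
    by apply: filterS => p T1 /T1 /eqP; rewrite oner_eq0.
  by move/eqP; rewrite gt_eqF.
have one_grad v : energy_form one v = 0.
  have ip0l f : <<0, f>> = 0.
    by rewrite /ip /Rintegral integral0_eq// => p _; rewrite mul0r.
  by rewrite /energy_form /= !ip0l addr0.
have [mu2 [u [/andP[mu0 muL] u0 uP least]]] :=
  @least_eigenvector _ _ mass_form energy_form one (H1pack wH1) Lambda
    mass_formP energy_formP one0 one_grad H1_complete compact_mass P P0 poincare
    w1 w0 wLambda.
exists mu2 => //; split => //.
- exists (val u).1.1; split; last first.
    by move/ae_eq0P => /(_ (L1 u))/eqP; rewrite gt_eqF.
  exists (val u).1.2, (val u).2; split; first exact: H1spaceP.
  move=> v hx hy vH1; have := uP (H1pack vH1).
  rewrite /mass_form => <-; have [_ Lhx Lhy _ _] := vH1.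
  by have /= -> := RintegralD mT (L2M mT (L2' u) Lhx) (L2M mT (L3 u) Lhy).
- move=> nu nu0 [v [[gx [gy [vH1 vP]]] v0]].
  have [Lv Lgx Lgy _ _] := vH1.
  apply: (least nu (H1pack vH1)) => //.
    rewrite lt_neqAle ip_ge0 andbT eq_sym; apply/eqP => vv; apply: v0.
    exact/ae_eq0P.
  move=> h; rewrite -[nu * _]/(nu * <<v, (val h).1.1>>) -(vP _ _ _ (H1spaceP h)).
  by have /= -> := RintegralD mT (L2M mT Lgx (L2' h)) (L2M mT Lgy (L3 h)).
Qed.

End Existence.

(** * The trial function *)

Section Simplex.
Context {R : realType}.
Local Notation leb := (@lebesgue_measure R).

Let integrable_itvcc (f : R -> R) (x y : R) : continuous f ->
  leb.-integrable [set` `[x, y]] (EFin \o f).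
Proof.
move=> cf; apply: continuous_compact_integrable; first exact: segment_compact.
exact: continuous_subspaceT.
Qed.

Lemma integrable_continuous_itv (f : R -> R) (bx lx : bool) (x y : R) :
  continuous f ->
  leb.-integrable [set` Interval (BSide bx x) (BSide lx y)] (EFin \o f).
Proof.
move=> /(@integrable_itvcc _ x y); apply: integrableS => //.
by apply: subset_itv; rewrite bnd_simp; case: bx lx => -[].
Qed.

Lemma Rintegral_itvoo (f : R -> R) (x y : R) : continuous f ->
  \int[leb]_(z in `]x, y[) f z = \int[leb]_(z in `[x, y]) f z.
Proof.
move=> cf; rewrite Rintegral_itv_obnd_cbnd; last exact: integrable_continuous_itv.
by rewrite Rintegral_itv_bndo_bndc//; exact: integrable_continuous_itv.
Qed.

Definition simplex : set (plane R) := [set p | [/\ 0 < p.1, 0 < p.2 & p.1 + p.2 < 1]].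

Lemma simplexE a b : 0 < b -> simplex = tri_param a b @^-1` tri a b.
Proof.
by move=> b0; apply/seteqP; split => p; have := preimage_tri a b0 p; case.
Qed.

Lemma measurable_simplex : measurable simplex.
Proof.
rewrite (simplexE 0 ltr01).
have sc := scales_area_tri_param (0 : R) ltr01.
exact: (measurable_preim_scales_area sc (measurable_tri 0 ltr01)).
Qed.

Lemma area_simplex_fin : (@area R simplex < +oo)%E.
Proof.
rewrite (simplexE 0 ltr01).
have [_ ->] := scales_area_tri_param (0 : R) ltr01; last exact: measurable_tri.
by rewrite invr1 mul1e; exact: area_tri_fin.
Qed.

Lemma Rintegral_simplex_prod (f g G : R -> R) : continuous f -> continuous g ->
  (forall x, is_derive x (1 : R) G (g x)) ->
  (forall x, `|f x| <= 1) -> (forall x, `|g x| <= 1) ->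
  \int[@area R]_(p in simplex) (f p.1 * g p.2) =
  \int[leb]_(x in `[0, 1]) (f x * (G (1 - x) - G 0)).
Proof.
move=> cf cg dG f1 g1; have mD := measurable_simplex.
have cG : continuous G by exact: is_derive_continuous dG.
rewrite Rintegral_fubini//; last first.
  apply: (@integrable_bounded _ _ _ _ _ mD _ 1); first exact: area_simplex_fin.
    by apply: measurable_funTS; exact: measurable_prodfun.
  by move=> p _; rewrite normrM mulr_ile1.
rewrite -Rintegral_itvoo; last first.
  move=> x; apply: cvgM; first exact: cf.
  apply: cvgB; last exact: cvg_cst.
  apply: (continuous_comp (f := fun x : R => 1 - x) (g := G)); last exact: cG.
  by apply: cvgB; [exact: cvg_cst|exact: cvg_id].
rewrite [RHS]Rintegral_mkcond; apply: eq_Rintegral => x _; rewrite patchE.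
case: ifPn => [/set_mem/=|/negP xn].
  rewrite in_itv/= => /andP[x0 x1]; have x1' : 0 < 1 - x by rewrite subr_gt0.
  rewrite -(Rintegral_FTC x1' dG cg) -Rintegral_itvoo// -RintegralZl//; last first.
    exact: integrable_continuous_itv.
  rewrite [RHS]Rintegral_mkcond; apply: eq_Rintegral => y _; rewrite !patchE.
  case: ifPn => [/set_mem[/= _ y0 xy]|/negP yn].
    by rewrite mem_set//= in_itv/= y0 /=; lra.
  rewrite memNset//= in_itv/= => /andP[y0 y1]; apply: yn; apply/mem_set; split => //=.
  by lra.
rewrite /Rintegral integral0_eq// => y _.
rewrite patchE memNset// => -[/= x0 y0 xy]; apply: xn; rewrite inE/= in_itv/= x0/=.
by lra.
Qed.

End Simplex.

(** * Integrals of sines and cosines over the reference triangle *)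

Section SimplexCosines.
Context {R : realType}.
Local Notation leb := (@lebesgue_measure R).
Local Notation c := (@cosn R 1).
Local Notation s := (@sinn R 1).
Implicit Types f g : R -> R.

Let dD f g x (f' g' : R) : is_derive x (1 : R) f f' -> is_derive x (1 : R) g g' ->
  is_derive x (1 : R) (fun y => f y + g y) (f' + g').
Proof. exact: is_deriveD. Qed.

Let dM f g x (f' g' : R) : is_derive x (1 : R) f f' -> is_derive x (1 : R) g g' ->
  is_derive x (1 : R) (fun y => f y * g y) (f x * g' + f' * g x).
Proof.
by move=> df dg; have := is_deriveM df dg; rewrite /GRing.scale/= [f' * _]mulrC.
Qed.

Let dZ k f x (f' : R) : is_derive x (1 : R) f f' ->
  is_derive x (1 : R) (fun y => k * f y) (k * f').
Proof. by move=> df; exact: is_deriveZ. Qed.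

Let dI x : is_derive x (1 : R) (fun y => y) (1 : R).
Proof. exact: is_derive_id. Qed.

Let dl x : is_derive x (1 : R) (fun y => 1 - y) (- 1 : R).
Proof.
apply: is_derive_eq (is_deriveB (is_derive_cst (1 : R) x (1 : R)) (dI x)) _.
exact: sub0r.
Qed.

Let dc x : is_derive x (1 : R) c (- pi * s x).
Proof. by have := is_derive_cosn 1 x; rewrite mul1r. Qed.

Let ds x : is_derive x (1 : R) s (pi * c x).
Proof. by have := is_derive_sinn 1 x; rewrite mul1r. Qed.

Let cc : continuous c. Proof. exact: continuous_cosn. Qed.
Let cs : continuous s. Proof. exact: continuous_sinn. Qed.

Let continuous_sqr f : continuous f -> continuous (fun x => f x ^+ 2).
Proof.
move=> cf x; have -> : (fun x => f x ^+ 2) = (fun x => f x * f x).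
  by apply/funext => y; rewrite expr2.
by apply: cvgM; exact: cf.
Qed.

Let c2s2 x : s x ^+ 2 = 1 - c x ^+ 2.
Proof. by rewrite /sinn /cosn sin2cos2. Qed.

Let pi0 : pi != 0 :> R. Proof. by rewrite gt_eqF// pi_gt0. Qed.

Let c_0 : c 0 = 1. Proof. by rewrite /cosn mulr0 cos0. Qed.
Let c_1 : c 1 = -1. Proof. by rewrite /cosn mulr1 mul1r cospi. Qed.
Let s_0 : s 0 = 0. Proof. by rewrite /sinn mulr0 sin0. Qed.
Let s_1 : s 1 = 0. Proof. by rewrite /sinn mulr1 mul1r sinpi. Qed.

Let ftc f F (v : R) : (forall x, is_derive x (1 : R) F (f x)) -> continuous f ->
  F 1 - F 0 = v -> \int[leb]_(x in `[0, 1]) f x = v.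
Proof. by move=> dF cf <-; exact: Rintegral_FTC. Qed.

Let J f g := \int[@area R]_(p in simplex) (f p.1 * g p.2).

Let J1 f : continuous f -> (forall x, `|f x| <= 1) ->
  J f (cst 1) = \int[leb]_(x in `[0, 1]) (f x * (1 - x)).
Proof.
move=> cf f1; have f2 (x : R) : `|cst 1 x : R| <= 1 by rewrite normr1.
have c1 : continuous (cst 1 : R -> R) by move=> ?; exact: cvg_cst.
rewrite /J (Rintegral_simplex_prod cf c1 dI f1 f2).
by apply: eq_Rintegral => x _; rewrite subr0.
Qed.

Let cl : continuous (fun x : R => 1 - x).
Proof. by move=> x; apply: cvgB; [exact: cvg_cst|exact: cvg_id]. Qed.

Lemma Rintegral_simplex_sqr_cos : J (fun x => c x ^+ 2) (cst 1) = 4^-1.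
Proof.
rewrite J1; first last.
- by move=> x; rewrite normrX exprn_ile1 ?normr_cosn.
- exact: continuous_sqr cc.
(* An antiderivative of (1 - x) (1 + cos (2 pi x)) / 2, found by parts, with the double angles
   expressed through [s] and [c]. *)
apply: (ftc (F := fun x => 2^-1 * x + - 4^-1 * (x * x) +
  ((2 * pi)^-1 * ((1 - x) * (s x * c x)) + (4 * pi ^+ 2)^-1 * (s x * s x)))).
- move=> x; apply: is_derive_eq (dD (dD (dZ _ (dI x)) (dZ _ (dM (dI x) (dI x))))
    (dD (dZ _ (dM (dl x) (dM (ds x) (dc x))))
        (dZ _ (dM (ds x) (ds x))))) _.
  transitivity ((1 - x) / 2 * (1 + c x ^+ 2 - s x ^+ 2)); first by move: (pi : R) pi0 => P P0; field.
  by rewrite c2s2; move: (pi : R) pi0 => P P0; field.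
- by move=> x; apply: cvgM; [exact: continuous_sqr cc _|exact: cl].
- by rewrite c_0 c_1 s_0 s_1; move: (pi : R) pi0 => P P0; field.
Qed.

Lemma Rintegral_simplex_sqr_sin : J (fun x => s x ^+ 2) (cst 1) = 4^-1.
Proof.
rewrite J1; first last.
- by move=> x; rewrite normrX exprn_ile1 ?normr_sinn.
- exact: continuous_sqr cs.
apply: (ftc (F := fun x => 2^-1 * x + - 4^-1 * (x * x) +
  (- (2 * pi)^-1 * ((1 - x) * (s x * c x)) + - (4 * pi ^+ 2)^-1 * (s x * s x)))).
- move=> x; apply: is_derive_eq (dD (dD (dZ _ (dI x)) (dZ _ (dM (dI x) (dI x))))
    (dD (dZ _ (dM (dl x) (dM (ds x) (dc x))))
        (dZ _ (dM (ds x) (ds x))))) _.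
  transitivity ((1 - x) / 2 * (1 - c x ^+ 2 + s x ^+ 2)); first by move: (pi : R) pi0 => P P0; field.
  by rewrite c2s2; move: (pi : R) pi0 => P P0; field.
- by move=> x; apply: cvgM; [exact: continuous_sqr cs _|exact: cl].
- by rewrite c_0 c_1 s_0 s_1; move: (pi : R) pi0 => P P0; field.
Qed.

Let s1B x : s (1 - x) = s x.
Proof. by rewrite /sinn mul1r mulrBr mulr1 addrC sinDpi sinN opprK. Qed.

Let c1B x : c (1 - x) = - c x.
Proof. by rewrite /cosn mul1r mulrBr mulr1 addrC cosDpi cosN. Qed.

Lemma Rintegral_simplex_coscos : J c c = 0.
Proof.
have dG x : is_derive x (1 : R) (fun x => pi^-1 * s x) (c x).
  by apply: is_derive_eq (dZ _ (ds x)) _; move: (pi : R) pi0 => P P0; field.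
rewrite /J (Rintegral_simplex_prod cc cc dG (normr_cosn 1) (normr_cosn 1)).
apply: (ftc (F := fun x => (2 * pi ^+ 2)^-1 * (s x * s x))).
- move=> x; apply: is_derive_eq (dZ _ (dM (ds x) (ds x))) _.
  by rewrite s1B s_0; move: (pi : R) pi0 => P P0; field.
- have -> : (fun y => c y * (pi^-1 * s (1 - y) - pi^-1 * s 0)) =
      (fun y => c y * (pi^-1 * s y)).
    by apply/funext => y; rewrite s1B s_0 mulr0 subr0.
  by move=> x; apply: cvgM; [exact: cc|apply: cvgM; [exact: cvg_cst|exact: cs]].
- by rewrite s_0 s_1; move: (pi : R) pi0 => P P0; field.
Qed.

Lemma Rintegral_simplex_sinsin : J s s = 2 / pi ^+ 2.
Proof.
have dG x : is_derive x (1 : R) (fun x => - pi^-1 * c x) (s x).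
  by apply: is_derive_eq (dZ _ (dc x)) _; move: (pi : R) pi0 => P P0; field.
rewrite /J (Rintegral_simplex_prod cs cs dG (normr_sinn 1) (normr_sinn 1)).
apply: (ftc (F := fun x => (2 * pi ^+ 2)^-1 * (s x * s x) + - (pi ^- 2) * c x)).
- move=> x; apply: is_derive_eq (dD (dZ _ (dM (ds x) (ds x))) (dZ _ (dc x))) _.
  by rewrite c1B c_0; move: (pi : R) pi0 => P P0; field.
- have -> : (fun y => s y * (- pi^-1 * c (1 - y) - - pi^-1 * c 0)) =
      (fun y => s y * (pi^-1 * c y + pi^-1)).
    by apply/funext => y; rewrite c1B c_0; ring.
  move=> x; apply: cvgM; first exact: cs.
  by apply: cvgD; [apply: cvgM; [exact: cvg_cst|exact: cc]|exact: cvg_cst].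
- by rewrite c_0 c_1 s_0 s_1; move: (pi : R) pi0 => P P0; field.
Qed.

End SimplexCosines.

Lemma sip_comb3 (R : realType) (V : lmodType R) (n : V -> V -> R) x y z (X Y Z : V) :
  semi_inner_product n ->
  n (x *: X + y *: Y + z *: Z) (x *: X + y *: Y + z *: Z) =
  x ^+ 2 * n X X + y ^+ 2 * n Y Y + z ^+ 2 * n Z Z +
  2 * (x * y * n X Y + x * z * n X Z + y * z * n Y Z).
Proof.
move=> nP; rewrite !(sipDl nP, sipDr nP, sipZl nP, sipZr nP).
by rewrite (sipC nP Y X) (sipC nP Z X) (sipC nP Z Y); ring.
Qed.

Lemma sip_comb3l (R : realType) (V : lmodType R) (n : V -> V -> R) x y z (X Y Z W : V) :
  semi_inner_product n ->
  n (x *: X + y *: Y + z *: Z) W = x * n X W + y * n Y W + z * n Z W.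
Proof. by move=> nP; rewrite !(sipDl nP, sipZl nP). Qed.

(** * Gram matrices of the three barycentric sines and cosines *)

Section TriangleGram.
Context {R : realType}.
Let mD : measurable (@simplex R). Proof. exact: measurable_simplex. Qed.
Let Dfin : (@area R (@simplex R) < +oo)%E. Proof. exact: area_simplex_fin. Qed.

Lemma L2_simplex (F : plane R -> R) (M : R) : measurable_fun [set: plane R] F ->
  (forall p, `|F p| <= M) -> L2 (@area R) simplex F.
Proof.
move=> mF FM; apply: (@L2_bounded _ _ _ _ _ mD _ M) => //.
exact: measurable_funTS.
Qed.

Lemma Rintegral_simplex_sym (Psi : plane R -> plane R) (F : plane R -> R) :
  scales_area Psi 1 -> Psi @^-1` simplex = simplex ->
  (@area R).-integrable simplex (EFin \o F) ->
  \int[@area R]_(p in simplex) F (Psi p) = \int[@area R]_(p in simplex) F p.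
Proof.
move=> sP PD iF; have [_] := integral_scales_area ler01 sP mD iF.
by rewrite PD mul1r.
Qed.

Lemma ip_tri_simplex (a b : R) (F G : plane R -> R) : 0 < b ->
  L2 (@area R) (tri a b) (F \o tri_coord a b) ->
  L2 (@area R) (tri a b) (G \o tri_coord a b) ->
  ip (@area R) (tri a b) (F \o tri_coord a b) (G \o tri_coord a b) =
  b * ip (@area R) simplex F G.
Proof.
move=> b0 LF LG; have mT := measurable_tri a b0.
have binv : 0 <= b^-1 by rewrite invr_ge0 ltW.
have [_] := integral_scales_area binv (scales_area_tri_param a b0) mT (L2M mT LF LG).
rewrite -(simplexE a b0) => h; rewrite /ip -[LHS](mulVKf (lt0r_neq0 b0)) -h; congr (_ * _).
by apply: eq_Rintegral => p _ /=; rewrite tri_paramK.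
Qed.

Section Symmetry.
Variable f : R -> R.
Hypotheses (cf : continuous f) (f1 : forall x, `|f x| <= 1).

Let f3 (p : plane R) : R := f (1 - p.1 - p.2).
Let f2 (p : plane R) : R := f p.2.
Let f1' (p : plane R) : R := f p.1.

Let m1 : measurable_fun [set: plane R] f1'. Proof. exact: measurable_fun1. Qed.
Let m2 : measurable_fun [set: plane R] f2. Proof. exact: measurable_fun2. Qed.
Let m3 : measurable_fun [set: plane R] f3.
Proof.
have -> : f3 = f \o (fun p : plane R => - 1 * p.1 + - 1 * p.2 + 1).
  by apply/funext => p; rewrite /f3 /=; congr f; ring.
by apply: measurableT_comp; [exact: continuous_measurableR|exact: measurable_affine].
Qed.

(** The affine involution exchanging l_O and l_E. Together with [swap], which exchanges l_E and l_V,
    it generates all permutations of the three coordinates. *)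
Let rot (p : plane R) : plane R := (- 1 * p.1 + - 1 * p.2 + 1, p.2).
Let swap (p : plane R) : plane R := (p.2, p.1).

Let rot_area : scales_area rot 1.
Proof.
have n1 : - 1 != 0 :> R by rewrite oppr_eq0 oner_neq0.
by have := scales_area_shear (- 1) 1 n1; rewrite normrN1 invr1.
Qed.

Let rot_simplex : rot @^-1` simplex = simplex.
Proof. by apply/seteqP; split => -[s t] [/= ? ? ?]; split => //=; lra. Qed.

Let swap_simplex : swap @^-1` simplex = simplex.
Proof. by apply/seteqP; split => -[s t] [/= ? ? ?]; split => //=; lra. Qed.

Let L1 : L2 (@area R) simplex f1'. Proof. by apply: (L2_simplex m1) => p; exact: f1. Qed.
Let L2' : L2 (@area R) simplex f2. Proof. by apply: (L2_simplex m2) => p; exact: f1. Qed.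
Let L3 : L2 (@area R) simplex f3. Proof. by apply: (L2_simplex m3) => p; exact: f1. Qed.
Let Lone : L2 (@area R) simplex (cst 1).
Proof. by apply: (@L2_simplex _ 1) => // p; rewrite normr1. Qed.

Let one := L2pack mD Lone.
Let X1 := L2pack mD L1.
Let X2 := L2pack mD L2'.
Let X3 := L2pack mD L3.
Local Notation N := (L2form (mu := @area R) (mD := mD)).
Local Notation J f g := (\int[@area R]_(p in simplex) (f p.1 * g p.2)).

Let fE p : f3 p = f (rot p).1. Proof. by rewrite /f3 /rot/=; congr f; ring. Qed.

Let N11 : N X1 X1 = J (fun x => f x ^+ 2) (cst 1).
Proof. by apply: eq_Rintegral => p _; rewrite /= mulr1. Qed.

Let N22 : N X2 X2 = N X1 X1.
Proof.
exact: (Rintegral_simplex_sym (@scales_area_swap R) swap_simplex (L2M mD L1 L1)).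
Qed.

Let N33 : N X3 X3 = N X1 X1.
Proof.
rewrite -[RHS](Rintegral_simplex_sym rot_area rot_simplex (L2M mD L1 L1)).
by apply: eq_Rintegral => p _; rewrite /= !fE.
Qed.

Let N32 : N X3 X2 = N X1 X2.
Proof.
rewrite -[RHS](Rintegral_simplex_sym rot_area rot_simplex (L2M mD L1 L2')).
by apply: eq_Rintegral => p _; rewrite /= !fE.
Qed.

Let N31 : N X3 X1 = N X1 X2.
Proof.
rewrite -N32.
rewrite -[RHS](Rintegral_simplex_sym (@scales_area_swap R) swap_simplex (L2M mD L3 L2')).
by apply: eq_Rintegral => p _; rewrite /= /f3 /=; congr (f _ * _); ring.
Qed.

Let M1 : N X1 one = J f (cst 1). Proof. by []. Qed.

Let M2 : N X2 one = N X1 one.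
Proof.
exact: (Rintegral_simplex_sym (@scales_area_swap R) swap_simplex (L2M mD L1 Lone)).
Qed.

Let M3 : N X3 one = N X1 one.
Proof.
rewrite -[RHS](Rintegral_simplex_sym rot_area rot_simplex (L2M mD L1 Lone)).
by apply: eq_Rintegral => p _; rewrite /= !fE.
Qed.

Variables (a b : R).
Hypothesis b_gt0 : 0 < b.

Definition bary_comb (f : R -> R) (x y z : R) (p : plane R) : R :=
  x * f (baryO a b p) + y * f (baryE a b p) + z * f (baryV b p).

Let comb_simplex x y z : bary_comb f x y z =
  (x *: f3 + y *: f1' + z *: f2) \o tri_coord a b.
Proof. by []. Qed.

Let mcoord : measurable_fun [set: plane R] (tri_coord a b).
Proof. exact: measurable_tri_coord. Qed.

Let Lcomb x y z : L2 (@area R) (tri a b) ((x *: f3 + y *: f1' + z *: f2) \o tri_coord a b).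
Proof.
have mT := measurable_tri a b_gt0; have Tfin := area_tri_fin a b_gt0.
have LT (F : plane R -> R) : measurable_fun [set: plane R] F -> (forall p, `|F p| <= 1) ->
    L2 (@area R) (tri a b) (F \o tri_coord a b).
  move=> mF F1; apply: (@L2_bounded _ _ _ _ _ mT _ 1) => //.
    by apply: measurable_funTS; exact: measurableT_comp.
  by move=> p _; exact: F1.
apply: (L2D mT (L2D mT (L2Z mT x (LT _ m3 _)) (L2Z mT y (LT _ m1 _))) (L2Z mT z (LT _ m2 _))) => p;
  exact: f1.
Qed.

Lemma ip_bary_comb x y z :
  ip (@area R) (tri a b) (bary_comb f x y z) (bary_comb f x y z) =
  b * (J (fun x => f x ^+ 2) (cst 1) * (x ^+ 2 + y ^+ 2 + z ^+ 2) +
       2 * J f f * (x * y + x * z + y * z)).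
Proof.
rewrite comb_simplex ip_tri_simplex//; congr (_ * _).
transitivity (N (x *: X3 + y *: X1 + z *: X2) (x *: X3 + y *: X1 + z *: X2)); first by [].
have NP := L2formP (@area R) mD.
rewrite (sip_comb3 x y z X3 X1 X2 NP) N33 N32 N31 N22 N11.
by rewrite -[N X1 X2]/(J f f); ring.
Qed.

Lemma ip_bary_comb1 x y z :
  ip (@area R) (tri a b) (bary_comb f x y z) (cst 1) = b * (J f (cst 1) * (x + y + z)).
Proof.
have Lc : L2 (@area R) (tri a b) ((cst 1 : plane R -> R) \o tri_coord a b).
  by case: (C1_H1 a b_gt0 (C1_cst 1)).
transitivity (ip (@area R) (tri a b) (bary_comb f x y z) (cst 1 \o tri_coord a b)).
  by [].
rewrite comb_simplex ip_tri_simplex//; congr (_ * _).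
transitivity (N (x *: X3 + y *: X1 + z *: X2) one); first by [].
have NP := L2formP (@area R) mD.
by rewrite (sip_comb3l x y z X3 X1 X2 one NP) M3 M2 M1; ring.
Qed.

End Symmetry.

End TriangleGram.

(** The Rayleigh inequality for coefficients (x, 1, z), multiplied by 4 b / pi^2, with p standing
    for 16 / pi^2. As x <= 0, the factor x^2 + 1 - p x of b^2 is nonnegative, so b^2 may be replaced
    by its largest value. *)
Lemma trial_coefficients (R : realType) (a b p : R) :
  0 <= a -> a <= 1 / 2 -> b ^+ 2 <= a ^+ 2 + (1 - a) ^+ 2 -> 1 <= p -> p <= 2 ->
  exists2 x : R, x <= 0 & let z := - 1 - x in
    b ^+ 2 * (x ^+ 2 + 1) + x ^+ 2 * (1 - a) ^+ 2 + a ^+ 2 + z ^+ 2 +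
    p * (- b ^+ 2 * x + x * a * (1 - a) - x * z * (1 - a) - z * a) <=
    x ^+ 2 + 1 + z ^+ 2.
Proof.
move=> a0 a2 bab p1 p2.
have D0 : 0 < 1 - 3 * a + p by lra.
(* For the largest b, left side minus right side is a quadratic polynomial in x
   with coefficients (1-a)(1-3a+p) and 3pa(1-a): this is its minimizer. *)
pose x := - (3 * p * a) / (2 * (1 - 3 * a + p)).
have xD : 2 * (1 - 3 * a + p) * x = - (3 * p * a).
  by rewrite /x; field; rewrite gt_eqF.
have x0 : x <= 0.
  rewrite -(ler_pM2l (_ : 0 < 2 * (1 - 3 * a + p))) ?mulr_gt0// xD mulr0 oppr_le0.
  by rewrite !mulr_ge0//; lra.
clearbody x; exists x => //=.
have px : 0 <= - (p * x) by rewrite -mulrN mulr_ge0//; lra.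
have b2x : b ^+ 2 * (x ^+ 2 + 1 - p * x) <=
    (a ^+ 2 + (1 - a) ^+ 2) * (x ^+ 2 + 1 - p * x).
  by rewrite ler_wpM2r// !addr_ge0// ?sqr_ge0.
have xa : a * (1 - a) <= 1 / 4.
  by have := sqr_ge0 (a - 1 / 2); rewrite expr2; lra.
(* The second bracket times a is the minimal value of the quadratic polynomial. Multiplied by the
   positive denominator of x it factors, with 2 - p as one factor; the other is negative because a
   (1 - a) <= 1/4 and p >= 1. *)
have key : 2 * (1 - 3 * a + p) * (3 * a - 2 + p + 3 * p * (1 - a) / 2 * x) <= 0.
  rewrite (_ : _ * _ = (2 - p) * (9 / 2 * (2 + p) * (a * (1 - a)) - 2 * (1 + p))); last first.
    rewrite mulrDr (_ : 2 * (1 - 3 * a + p) * (3 * p * (1 - a) / 2 * x) =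
      3 * p * (1 - a) / 2 * (2 * (1 - 3 * a + p) * x)); last by ring.
    by rewrite xD; field.
  rewrite mulr_ge0_le0//; first lra.
  have : (2 + p) * (a * (1 - a)) <= (2 + p) * (1 / 4) by rewrite ler_wpM2l//; lra.
  by lra.
rewrite pmulr_rle0 ?mulr_gt0// in key.
have akey : a * (3 * a - 2 + p + 3 * p * (1 - a) / 2 * x) <= 0 by rewrite mulr_ge0_le0.
have xxD : (1 - a) * x * (2 * (1 - 3 * a + p) * x) = (1 - a) * x * - (3 * p * a).
  by rewrite xD.
have -> : b ^+ 2 * (x ^+ 2 + 1) + x ^+ 2 * (1 - a) ^+ 2 + a ^+ 2 + (-1 - x) ^+ 2 +
    p * (- b ^+ 2 * x + x * a * (1 - a) - x * (-1 - x) * (1 - a) - (-1 - x) * a) =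
    b ^+ 2 * (x ^+ 2 + 1 - p * x) + (x ^+ 2 * (1 - a) ^+ 2 + a ^+ 2 + (-1 - x) ^+ 2 +
    p * (x * a * (1 - a) - x * (-1 - x) * (1 - a) - (-1 - x) * a)) by ring.
apply: le_trans (lerD b2x (lexx _)) _.
rewrite -subr_ge0 (_ : _ - _ = - (a * (3 * a - 2 + p + 3 * p * (1 - a) / 2 * x)) -
  ((1 - a) * x * (2 * (1 - 3 * a + p) * x) - (1 - a) * x * - (3 * p * a)) / 2); last first.
  by field.
by rewrite xxD subrr mul0r subr0 oppr_ge0.
Qed.

Section Trial.
Context {R : realType}.
Variables (a b : R).
Hypothesis b_gt0 : 0 < b.
Local Notation T := (tri a b).
Local Notation c := (@cosn R 1).
Local Notation s := (@sinn R 1).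

Let pi_gt : 0 < pi :> R. Proof. exact: pi_gt0. Qed.

Lemma C1_trial x y z : C1 (bary_comb a b c x y z)
  (bary_comb a b s (pi * x) (- pi * y) 0)
  (bary_comb a b s (pi / b * ((1 - a) * x)) (pi / b * (a * y)) (- (pi / b) * z)).
Proof.
have dc t : is_derive t (1 : R) c (- pi * s t).
  by have := is_derive_cosn 1 t; rewrite mul1r.
have cs : continuous (fun t => - pi * s t).
  by move=> t; apply: cvgM; [exact: cvg_cst|exact: continuous_sinn].
have bn : b != 0 by rewrite gt_eqF.
have := C1D (C1D (C1Z x (C1_affine (- 1) (a / b - b^-1) 1 dc cs))
  (C1Z y (C1_affine 1 (- (a / b)) 0 dc cs))) (C1Z z (C1_affine 0 b^-1 0 dc cs)).
have EO q : baryO a b q = - 1 * q.1 + (a / b - b^-1) * q.2 + 1.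
  by rewrite /baryO /baryE /baryV; ring.
have EE q : baryE a b q = 1 * q.1 + - (a / b) * q.2 + 0 by rewrite /baryE; ring.
have EV q : baryV b q = 0 * q.1 + b^-1 * q.2 + 0 by rewrite /baryV; ring.
congr C1; apply/funext => q; rewrite /bary_comb EO EE EV; last 2 first.
- by move: (s _) (s _) (s _) => u v w; ring.
- by move: (s _) (s _) (s _) => u v w; move: (pi : R) => P; field.
by [].
Qed.

Let cs1 t : `|s t| <= 1. Proof. exact: normr_sinn. Qed.
Let cc1 t : `|c t| <= 1. Proof. exact: normr_cosn. Qed.

Let gramC x y z : ip (@area R) T (bary_comb a b c x y z) (bary_comb a b c x y z) =
  b / 4 * (x ^+ 2 + y ^+ 2 + z ^+ 2).
Proof.
rewrite (ip_bary_comb (@continuous_cosn R 1) cc1 a b_gt0).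
by rewrite Rintegral_simplex_sqr_cos Rintegral_simplex_coscos; field.
Qed.

Let gramS x y z : ip (@area R) T (bary_comb a b s x y z) (bary_comb a b s x y z) =
  b / 4 * (x ^+ 2 + y ^+ 2 + z ^+ 2 + 16 / pi ^+ 2 * (x * y + x * z + y * z)).
Proof.
rewrite (ip_bary_comb (@continuous_sinn R 1) cs1 a b_gt0).
rewrite Rintegral_simplex_sqr_sin Rintegral_simplex_sinsin.
by move: (pi : R) (lt0r_neq0 pi_gt) => P P0; field.
Qed.

(** The mass of sin (pi l_O) - sin (pi l_E) is nonnegative and proportional to 2 - 16 / pi^2. *)
Lemma sqr_pi_ge8 : 8 <= pi ^+ 2 :> R.
Proof.
have := ip_ge0 (@area R) T (bary_comb a b s 1 (- 1) 0).
rewrite gramS pmulr_rge0 ?divr_gt0// => h.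
have P2 : 0 < pi ^+ 2 :> R by rewrite exprn_gt0.
have : 16 / pi ^+ 2 <= 2 :> R by lra.
by rewrite ler_pdivrMr//; lra.
Qed.

Theorem mu2_tri_le : 0 <= a -> a <= 1 / 2 -> b ^+ 2 <= a ^+ 2 + (1 - a) ^+ 2 ->
  exists2 mu2 : R, is_mu2 T mu2 & mu2 <= pi ^+ 2 / b ^+ 2.
Proof.
move=> a0 a2 bab; have P2 : 0 < pi ^+ 2 :> R by rewrite exprn_gt0.
have p1 : 1 <= 16 / pi ^+ 2 :> R.
  have /andP[_ pi4] := @pihalf_02 R.
  rewrite ler_pdivlMr// mul1r; have : pi <= 4 :> R by lra.
  by have := pi_gt; nra.
have p2 : 16 / pi ^+ 2 <= 2 :> R.
  by rewrite ler_pdivrMr//; have := sqr_pi_ge8; lra.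
have [x x0 /= xP] := trial_coefficients a0 a2 bab p1 p2.
apply: (mu2_le_rayleigh b_gt0 (C1_H1 a b_gt0 (C1_trial x 1 (- 1 - x)))).
- rewrite (ip_bary_comb1 (@continuous_cosn R 1) cc1 a b_gt0).
  by rewrite (_ : x + 1 + _ = 0) ?mulr0//; ring.
- rewrite gramC mulr_gt0 ?divr_gt0//.
  by rewrite ltr_pwDl ?sqr_ge0// ltr_pwDr ?sqr_ge0// expr1n.
- rewrite gramC !gramS.
  (* The factor b / 4 of the Gram matrices times pi^2 / b^2, common to both sides of the Rayleigh
     inequality. *)
  have c0 : 0 <= pi ^+ 2 / (4 * b) by rewrite divr_ge0 ?ltW// mulr_gt0.
  have := ler_wpM2l c0 xP; congr (_ <= _).
    have P0 := lt0r_neq0 pi_gt; move: (16 / pi ^+ 2) => q; move: (pi : R) P0 => P P0.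
    by field; rewrite gt_eqF.
  have P0 := lt0r_neq0 pi_gt; move: (pi : R) P0 => P P0.
  by field; rewrite gt_eqF.
Qed.

End Trial.

(** * The angle condition *)

Lemma sqr_cos_ge_half (R : realType) (t : R) : 0 <= t <= 1 -> acos t <= pi / 4 ->
  1 <= 2 * t ^+ 2.
Proof.
move=> /andP[t0 t1] tpi.
have tI : -1 <= t <= 1 by rewrite t1 andbT (le_trans _ t0)// oppr_le0.
have [/andP[th0 _] costh] := acos_def tI.
have : 0 <= cos (acos t *+ 2).
  by apply: cos_ge0_pihalf; rewrite -mulr_natl; lra.
by rewrite cos_mulr2n costh subr_ge0 -mulr_natl.
Qed.

(** The cosine of the angle at (1, 0) is (1 - a) / sqrt ((1 - a)^2 + b^2), and an angle of at most
    pi/4 makes its square at least 1/2. *)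
Lemma angle_le_height (R : realType) (a b : R) : a <= 1 -> 0 < b ->
  angle ((0, 0) : R * R) (1, 0) (a, b) <= pi / 4 -> b ^+ 2 <= (1 - a) ^+ 2.
Proof.
move=> a1 b0; pose L := (1 - a) ^+ 2 + b ^+ 2.
have L0 : 0 < L by rewrite ltr_wpDl ?sqr_ge0// exprn_gt0.
have -> : angle ((0, 0) : R * R) (1, 0) (a, b) = acos ((1 - a) / Num.sqrt L).
  rewrite /angle /dotp /eucl_dist /=; congr (acos (_ / _)); first by ring.
  rewrite (_ : (0 - 1) ^+ 2 + _ = 1) ?sqrtr1 ?mul1r; last by ring.
  by congr Num.sqrt; rewrite /L; ring.
have sL : 0 < Num.sqrt L by rewrite sqrtr_gt0.
have t01 : 0 <= (1 - a) / Num.sqrt L <= 1.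
  rewrite divr_ge0 ?subr_ge0//= ?sqrtr_ge0// ler_pdivrMr// mul1r.
  rewrite -(ler_pXn2r (ltn0Sn 1)) ?nnegrE ?subr_ge0 ?sqrtr_ge0// sqr_sqrtr ?(ltW L0)//.
  by rewrite /L lerDl sqr_ge0.
move=> /(sqr_cos_ge_half t01).
rewrite expr_div_n sqr_sqrtr ?(ltW L0)// mulrA ler_pdivlMr// mul1r /L; lra.
Qed.

Theorem lemma1p7 (R : realType) (a b : R)
    (a_ge0 : 0 <= a) (a_le : a <= 1 / 2) (b_gt0 : 0 < b) :
  let O : R * R := (0, 0) in
  let E : R * R := (1, 0) in
  let V : R * R := (a, b) in
  let T := triangle O E V in
  (b ^+ 2 <= a ^+ 2 + (1 - a) ^+ 2 ->
     exists2 mu2 : R, is_mu2 T mu2 & mu2 <= pi ^+ 2 / b ^+ 2) /\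
  (longest_side (eucl_dist O E) (eucl_dist O V) (eucl_dist E V) \/
   middle_side (eucl_dist O E) (eucl_dist O V) (eucl_dist E V) ->
   angle O E V <= pi / 4 ->
     exists2 mu2 : R, is_mu2 T mu2 & mu2 <= pi ^+ 2 / b ^+ 2).
Proof.
move=> O E V T; split=> [bab|_ angle_le]; apply: mu2_tri_le => //.
have b1a : b ^+ 2 <= (1 - a) ^+ 2 by apply: angle_le_height => //; lra.
by rewrite (le_trans b1a)// lerDr sqr_ge0.
Qed.
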